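(* Assume that $\Phi:X\times\Lambda\to\mathbb{R}$ is bounded measurable with uniformly bounded derivative, and assume that $\rho$ is continuously differentiable on $S$. Then for each $(u,a)\in X\times\mathrm{int}(S)$ and $(h,b)\in E\times\mathbb{R}^k$, we have $$\beta^\mu_{(h,b)}(u,a)=-\partial_{(h,b)}\Phi(u,a)-\langle u,h\rangle_E+\partial_b\log\rho(a)=-\partial_{(h,b)}I(u,a).$$ Therefore, $(\hat u,\hat a)$ is a critical point of $I$ if and only if $\beta^\mu_{(h,b)}(\hat u,\hat a)=0$ for all $(h,b)\in E\times\mathbb{R}^k$.
   Context: Fomin derivative. A measure $\lambda$ on a Banach space $W$ (with Borel $\sigma$-algebra $\mathcal{B}(W)$) is called Fomin differentiable along $z\in W$ if for every $A\in\mathcal{B}(W)$ there exists a finite limit $d_z\lambda(A)=\lim_{t\to0}\frac{\lambda(A+tz)-\lambda(A)}{t}$. The Radon-Nikodym density of $d_z\lambda$ with respect to $\lambda$ is denoted $\beta^\lambda_z$ and called the logarithmic derivative of $\lambda$ along $z$. Setting. $X$ is a separable Banach space, $\Lambda\subseteq\mathbb{R}^k$. $\mu_0$ is a Gaussian measure on $X$ with mean zero and Cameron-Martin space $(E,\langle\cdot,\cdot\rangle_E)$; for $h\in E$ and $u\in X$, $\langle u,h\rangle_E$ denotes the measurable linear extension (Paley-Wiener functional) to $X$ of $\langle\cdot,h\rangle_E$. $\nu_0$ is a probability measure on $\mathbb{R}^k$ with compact support $S\subseteq\Lambda$ and Lebesgue density $\rho$, supported on $S$, continuous on $S$ and positive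 on $\mathrm{int}(S)$. $\mu$ is the probability measure $\mu(du,da)=\frac1Z\exp(-\Phi(u,a))\,\mu_0(du)\nu_0(da)$, with $Z=\int\exp(-\Phi)\,d(\mu_0\times\nu_0)$, viewed as a measure on $X\times\mathbb{R}^k$. $I(u,a)=\Phi(u,a)+J(u)+K(a)$, where $J(u)=\tfrac12\|u\|_E^2$ for $u\in E$ and $J(u)=\infty$ otherwise, and $K(a)=-\log\rho(a)$ for $a\in\mathrm{int}(S)$, $K(a)=\infty$ for $a\notin S$ (with $K$ on $\partial S$ defined as the limit from the interior). $\partial_{(h,b)}$ is the directional derivative along $(h,b)$, with the convention that the derivative of $J$ at $u$ along $h\in E$ is $\langle u,h\rangle_E$ (also for $u\in X\setminus E$, in the extended sense above). A critical point of $I$ is a point where $\partial_{(h,b)}I$ vanishes for all $(h,b)\in E\times\mathbb{R}^k$; values $\beta^\mu_{(h,b)}(u,a)$ are those of the representative given by the displayed formula.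
   Formalization: μ need not be Fomin differentiable (ρ uniform on [0,1]); the formal theorem claims that β^μ exists on all of X×R^k only if ρ=0 on ∂S, else on X×C for compact C⊂int(S), and shows that any existing β^μ equals the formula a.e. on X×int(S). *)

(* Defs.v *)
From mathcomp Require Import all_boot all_order all_algebra.
From mathcomp Require Import all_classical all_reals all_analysis.
Import Order.TTheory GRing.Theory Num.Theory.
Import numFieldNormedType.Exports.

Set Implicit Arguments.
Unset Strict Implicit.
Unset Printing Implicit Defensive.

Local Open Scope ring_scope.
Local Open Scope classical_set_scope.

(* [T] with its Borel sigma-algebra. *)
Notation borel T := (g_sigma_algebraType (@open T)).

Definition separable_space (T : topologicalType) : Prop :=
  exists2 D : set T, countable D & dense D.

Section gaussian.
Context {R : realType} {X : completeNormedModType R}.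
Implicit Types (mu : probability (borel X) R) (h k : X).

(* [normal_prob 0 s] is only the centred normal law for [s != 0] (it is uniform
   on [0, 1] for [s = 0]), hence the separate Dirac case. *)
Definition centered_gaussian mu : Prop :=
  forall l : {linear X -> R}, continuous l ->
    (forall A : set R, measurable A -> mu (l @^-1` A) = \d_(0 : R) A) \/
    (exists2 s : R, 0 < s &
      forall A : set R, measurable A -> mu (l @^-1` A) = normal_prob 0 s A).

(* Borel representatives of the elements of the closure of X^* in L^2(mu). *)
Definition L2_dual_closure mu (g : X -> R) : Prop :=
  measurable_fun [set: borel X] (g : borel X -> R) /\
  exists2 l : nat -> {linear X -> R}, (forall n, continuous (l n)) &
    (fun n => \int[mu]_x ((g x - l n x) ^+ 2)%:E)%E @ \oo --> 0%E.

(* h = R_mu g, i.e. h = \int u g(u) mu(du) weakly. *)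
Definition represents mu h (g : X -> R) : Prop :=
  L2_dual_closure mu g /\
  forall l : {linear X -> R}, continuous l ->
    l h = \int[mu]_x (l x * g x).

Definition cameron_martin mu : set X := [set h | exists g, represents mu h g].

Definition cm_repr mu h : X -> R :=
  xget (fun=> 0) [set g : X -> R | represents mu h g].

(* <h, k>_E; independent of the choices made by [cm_repr], which is unique
   mu-almost everywhere. *)
Definition cm_inner mu h k : R := \int[mu]_x (cm_repr mu h x * cm_repr mu k x).

(* f = <., h>_E, linear on all of X. Such an f is mu-measurable, but in general
   not Borel: it is only required to agree mu-a.e. with the Borel function
   [cm_repr mu h]. *)
Definition is_paley_wiener mu h (f : X -> R) : Prop :=
  [/\ scalar f,
      {ae mu, forall u, f u = cm_repr mu h u} &
      forall k, cameron_martin mu k -> f k = cm_inner mu k h].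

End gaussian.

Section euclidean.
Context {R : realType} {k : nat}.

Definition is_lebesgue (lam : {measure set (borel 'rV[R]_k) -> \bar R}) : Prop :=
  forall a b : 'rV[R]_k, (forall i, a 0 i <= b 0 i) ->
    lam [set x | forall i, a 0 i <= x 0 i <= b 0 i] =
      (\prod_i (b 0 i - a 0 i))%:E.

Definition measure_support (nu : set 'rV[R]_k -> \bar R) : set 'rV[R]_k :=
  [set a | forall U : set 'rV[R]_k, open U -> U a -> (0 < nu U)%E].

(* Differentiable in the interior of S, with a gradient that extends
   continuously to S. *)
Definition C1_on (S : set 'rV[R]_k) (f : 'rV[R]_k -> R) : Prop :=
  (forall a, interior S a -> differentiable f a) /\
  exists2 g : 'rV[R]_k -> 'rV[R]_k, {within S, continuous g} &
    forall a b, interior S a -> 'D_b f a = \sum_i g a 0 i * b 0 i.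

End euclidean.

(* Fomin differentiability on W = X * R^k. The sigma-algebra used is the product
   of the two Borel sigma-algebras; it is the Borel sigma-algebra of W when X is
   separable. *)
Section fomin.
Context {R : realType} {X : completeNormedModType R} {k : nat}.
Let W := (X * 'rV[R]_k)%type.
Let mW := (borel X * borel 'rV[R]_k)%type.

Definition translate (A : set W) (z : W) : set W := [set w + z | w in A].

Definition fomin_quotient (lam : set W -> \bar R) (z : W) (A : set W) (t : R) : R :=
  (fine (lam (translate A (t *: z))) - fine (lam A)) / t.

(* Only the Borel subsets A of D are tested; [D = setT] is Fomin
   differentiability. *)
Definition fomin_differentiable_on (lam : set W -> \bar R) (D : set W) (z : W) :=
  forall A : set W, measurable (A : set mW) -> A `<=` D ->
    cvg (fomin_quotient lam z A t @[t --> (0 : R)^']).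

(* d_z lam *)
Definition fomin_derivative (lam : set W -> \bar R) (z : W) (A : set W) : R :=
  lim (fomin_quotient lam z A t @[t --> (0 : R)^']).

(* beta is a version of the Radon-Nikodym density of d_z lam with respect to
   lam, on D; [D = setT] is the logarithmic derivative of lam along z. A version
   may differ from the Borel density gamma on a lam-null set, and need not be
   Borel itself: this matters since <., h>_E is not Borel in general. *)
Definition log_derivative_on (lam : probability mW R) (D : set W) (z : W)
    (beta : W -> R) : Prop :=
  fomin_differentiable_on lam D z /\
  exists gamma : mW -> R,
    [/\ lam.-integrable D (EFin \o gamma),
        forall A : set mW, measurable A -> A `<=` D ->
          fomin_derivative lam z A = \int[lam]_(x in A) gamma x &
        {ae lam, forall x : mW, D x -> beta x = gamma x}].

Definition fomin_differentiable (lam : set W -> \bar R) (z : W) :=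
  fomin_differentiable_on lam setT z.

Definition log_derivative (lam : probability mW R) (z : W) (beta : W -> R) :=
  log_derivative_on lam setT z beta.

End fomin.

Section functional.
Context {R : realType} {X : completeNormedModType R} {k : nat}.
Variables (mu0 : probability (borel X) R).
Variables (nu0 : probability (borel 'rV[R]_k) R).
Variables (S : set 'rV[R]_k) (rho : 'rV[R]_k -> R).
Variable Phi : X * 'rV[R]_k -> R.
(* [PW h u] stands for <u, h>_E. *)
Variable PW : X -> X -> R.

(* Integrals are taken over X * S because Phi is only meaningful on
   X * Lambda, with S included in Lambda, and nu0 is carried by S. *)
Definition partition_function : R :=
  \int[(mu0 \x nu0)%E]_(x in setT `*` S) expR (- Phi x).

Definition posterior (A : set (X * 'rV[R]_k)) : \bar R :=
  ((partition_function^-1)%:E *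
   \int[mu0 \x nu0]_(x in A `&` (setT `*` S)) (expR (- Phi x))%:E)%E.

Definition J_fun (u : X) : \bar R :=
  if `[< cameron_martin mu0 u >] then (2^-1 * cm_inner mu0 u u)%:E else +oo%E.

Definition K_fun (a : 'rV[R]_k) : \bar R :=
  if `[< interior S a >] then (- ln (rho a))%:E
  else if `[< S a >] then
    lim ((- ln (rho a'))%:E @[a' --> within (interior S) (nbhs a)])
  else +oo%E.

Definition I_fun (x : X * 'rV[R]_k) : \bar R := ((Phi x)%:E + J_fun x.1 + K_fun x.2)%E.

(* For u in E this is the directional derivative of I (which is finite on the
   line through (u, a) near that point when a is in the interior of S). For u
   outside E, J is infinite and its derivative along h is <u, h>_E by
   convention. *)
Definition dI (x z : X * 'rV[R]_k) : R :=
  if `[< cameron_martin mu0 x.1 >] then 'D_z (fine \o I_fun) x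
  else 'D_z Phi x + PW z.1 x.1 + 'D_(z.2) (fine \o K_fun) x.2.

Definition critical_point (x : X * 'rV[R]_k) : Prop :=
  forall h b, cameron_martin mu0 h -> dI x (h, b) = 0.

End functional.

(* Main.v *)
(* With respect to mu0 x lam, where lam is Lebesgue measure, mu has the density
   f = Z^-1 exp(- Phi) rho.  By the Cameron-Martin formula and the invariance of
   lam, mu (A + t z) with z = (h, b) is the integral over A of
   f (w + t z) exp(- t g(u) - t^2 |h|^2 / 2), where g is the Borel version of
   <., h>_E.  The difference quotients of this integrand are bounded by a constant
   times exp(2 |g|), which is integrable, as long as f is Lipschitz along z near A;
   so d_z mu has density d_z f / f - g by dominated convergence.  If A is in
   X x C with C compact in the interior of S, short translates of A stay in that
   interior, where f is Lipschitz.  If rho vanishes on the boundary of S, then f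
   is Lipschitz along z everywhere, a segment leaving the interior of S being cut
   at its exit point, where f = 0; and on the null set N outside X x int(S) the
   derivative vanishes because t |-> mu (N + t z) is minimal at t = 0.

   The Cameron-Martin formula itself compares the two sides on exponentials of
   continuous linear functionals, where it is the formula for Gaussian moment
   generating functions.  Polynomials in sines of functionals and their dominated
   limits extend it to indicators of finite intersections of half-spaces, which
   generate the Borel sets of a separable space by the Hahn-Banach theorem. *)
From HB Require Import structures.
From mathcomp Require Import all_boot all_order all_algebra.
From mathcomp Require Import all_classical all_reals all_analysis.
From mathcomp Require Import measurable_realfun ring lra.
Require Import Defs.
Import Order.TTheory GRing.Theory Num.Theory.
Import numFieldNormedType.Exports.
Set Implicit Arguments.
Unset Strict Implicit.
Unset Printing Implicit Defensive.
Local Open Scope ring_scope.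
Local Open Scope classical_set_scope.

(** Three features shape the proof. The Borel function [g] that represents [h] is only an L^2 limit
    of continuous functionals, so its exponential moments are not given. They come from the moment
    generating functions of the approximants, whose variances stay bounded, and serve twice: for the
    exponent in the Cameron-Martin density and for the dominating function of the difference
    quotients. Next, the functions that satisfy the Cameron-Martin formula are not visibly closed
    under products, whereas the indicator of an intersection is a product; this is why multipliers
    of a class are studied and not the class itself. Sines occur because polynomials can imitate the
    sign function only on a bounded interval, while functionals are unbounded. Finally, dominated
    convergence concerns sequences, so limits in t are tested along arbitrary sequences of nonzero
    reals tending to 0. *)

(** * Norming functionals by Hahn-Banach extension *)

Section hahn_banach.
Context {R : realType} {X : normedModType R}.
Implicit Types (G : set (X * R)).

Let linear_graph G := forall a p q, G p -> G q ->
  G (a *: p.1 + q.1, a * p.2 + q.2).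

Let dominated_graph G := forall p, G p -> p.2 <= `|p.1|.

(** The one-step extension. Domination for s = -1 and s = 1 says that [c] lies between the numbers r
    - |v - y| and the numbers |v + y| - r, for (v, r) in [G]; every other nonzero s follows by
    scaling. The supremum of the first family is a possible choice. *)
Let extend_graph G (y : X) (hlin : linear_graph G) (hdom : dominated_graph G)
  (G0 : G (0, 0)) :
  exists c : R, dominated_graph
    [set p | exists v r s, [/\ G (v, r) & p = (v + s *: y, r + s * c)]].
Proof.
pose E := [set z | exists2 p, G p & z = p.2 - `|p.1 - y|].
have key p q : G p -> G q -> p.2 - `|p.1 - y| <= `|q.1 + y| - q.2.
  move=> Gp Gq; have /hdom /= := hlin 1 _ _ Gp Gq.
  rewrite scale1r mul1r => h.
  have : `|p.1 + q.1| <= `|p.1 - y| + `|q.1 + y|.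
    by apply: le_trans (ler_normD _ _); rewrite addrACA addNr addr0.
  lra.
have E0 : E !=set0 by exists (0 - `|0 - y|), (0, 0).
have ubE q : G q -> ubound E (`|q.1 + y| - q.2).
  by move=> Gq _ [p Gp ->]; exact: key.
exists (sup E) => _ [v [r [s [Gvr ->]]]] /=.
have Gs t : G (t *: v, t * r).
  by have := hlin t _ _ Gvr G0; rewrite /= !addr0.
have [s0|s0|->] := ltgtP s 0.
- have : (- s)^-1 * r - `|(- s)^-1 *: v - y| <= sup E.
    apply: ub_le_sup; first by exists (`|0 + y| - 0); exact: (ubE (0, 0)).
    by exists ((- s)^-1 *: v, (- s)^-1 * r).
  have -> : v + s *: y = (- s) *: ((- s)^-1 *: v - y).
    by rewrite scalerBr scalerA mulfV ?oppr_eq0 ?lt_eqF// scale1r scaleNr opprK.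
  rewrite normrZ gtr0_norm ?oppr_gt0//.
  set n := `| _ - y|; rewrite lerBlDr => h.
  have : (- s) * ((- s)^-1 * r) <= (- s) * (sup E + n).
    by rewrite ler_wpM2l// oppr_ge0 ltW.
  rewrite mulrA mulfV ?oppr_eq0 ?lt_eqF// mul1r; lra.
- have : sup E <= `|s^-1 *: v + y| - s^-1 * r.
    by apply: ge_sup => //; exact: (ubE (s^-1 *: v, s^-1 * r)).
  have -> : v + s *: y = s *: (s^-1 *: v + y).
    by rewrite scalerDr scalerA mulfV ?gt_eqF// scale1r.
  rewrite normrZ gtr0_norm//.
  set n := `| _ + y| => h.
  have : s * sup E <= s * (n - s^-1 * r) by rewrite ler_wpM2l// ltW.
  rewrite mulrBr mulrA mulfV ?gt_eqF// mul1r; lra.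
- by rewrite scale0r mul0r !addr0; exact: (hdom _ Gvr).
Qed.

Lemma norming_functional (x0 : X) :
  exists l : {linear X -> R}, (forall y, `|l y| <= `|y|) /\ l x0 = `|x0|.
Proof.
pose L0 : set (X * R) := [set p | exists t, p = (t *: x0, t * `|x0|)].
have L0lin : linear_graph L0.
  move=> a _ _ [t ->] [s ->] /=; exists (a * t + s).
  by rewrite scalerDl scalerA mulrDl mulrA.
have L0dom : dominated_graph L0.
  by move=> _ [t ->] /=; rewrite normrZ ler_wpM2r// ler_norm.
(* Zorn's lemma is applied to the part added to [L0], so that the union of the empty chain, which is
   empty, is still admissible. *)
pose P A := linear_graph (L0 `|` A) /\ dominated_graph (L0 `|` A).
have /Zorn_bigcup[A [[Alin Adom] Amax]] : forall F : set (set (X * R)),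
    F `<=` P -> total_on F subset -> P (\bigcup_(A in F) A).
  move=> F FP Ftot; split; last first.
    move=> p [/L0dom//|[A FA Ap]]; exact: ((FP _ FA).2 p (or_intror Ap)).
  move=> a p q [Lp|[A FA Ap]] [Lq|[B FB Bq]].
  - by left; exact: L0lin.
  - have [] := (FP _ FB).1 a p q (or_introl Lp) (or_intror Bq); first by left.
    by right; exists B.
  - have [] := (FP _ FA).1 a p q (or_intror Ap) (or_introl Lq); first by left.
    by right; exists A.
  - have [C [FC Cp Cq]] : exists C, [/\ F C, C p & C q].
      have [AB|BA] := Ftot _ _ FA FB.
        by exists B; split => //; exact: AB.
      by exists A; split => //; exact: BA.
    have [] := (FP _ FC).1 a p q (or_intror Cp) (or_intror Cq); first by left.
    by right; exists C.
pose G := L0 `|` A.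
have G0 : G (0, 0) by left; exists 0; rewrite scale0r mul0r.
have Gtot y : exists r, G (y, r).
  apply: contrapT => yG.
  have [c cdom] := extend_graph y Alin Adom G0.
  set G' := [set p | _] in cdom.
  have GG' : G `<=` G'.
    by move=> [v r] Gp; exists v, r, 0; rewrite scale0r mul0r !addr0.
  have G'y : G' (y, c) by exists 0, 0, 1; rewrite scale1r mul1r !add0r.
  apply: (Amax G').
    split; first by move=> p Ap; apply: GG'; right.
    by move=> /(_ _ G'y) Ay; apply: yG; exists c; right.
  have G'E : L0 `|` G' = G'.
    by apply/seteqP; split=> [p [Lp|//]|p]; [apply: GG'; left|right].
  split; rewrite G'E// => a _ _ [v [r [s [Gv ->]]]] [w [q [t [Gw ->]]]] /=.
  exists (a *: v + w), (a * r + q), (a * s + t); split.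
    by have := Alin a _ _ Gv Gw.
  congr pair; first by rewrite scalerDr scalerDl scalerA addrACA.
  ring.
(* A dominated linear graph is single-valued: the difference of two values at [y] is a value at 0,
   hence at most 0, in either order. *)
have Guniq y r r' : G (y, r) -> G (y, r') -> r = r'.
  move=> h h'; apply/eqP; rewrite eq_le; apply/andP; split.
    have /Adom /= := Alin (- 1) _ _ h' h.
    by rewrite scaleN1r addNr normr0; lra.
  have /Adom /= := Alin (- 1) _ _ h h'.
  by rewrite scaleN1r addNr normr0; lra.
have [f fG] := choice Gtot.
have flin : linear (f : X -> R).
  by move=> a u v; apply: (Guniq (a *: u + v)) => //; exact: (Alin a _ _ (fG u) (fG v)).
pose fL := GRing.isLinear.Build R X R _ f flin.
pose l : {linear X -> R} := HB.pack f fL.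
exists l; split; last by apply: (Guniq x0) => //; left; exists 1; rewrite scale1r mul1r.
move=> y; rewrite ler_norml; apply/andP; split; last exact: (Adom _ (fG y)).
by have /Adom /= := fG (- y); rewrite normrN -[f _]/(l _) linearN/=; lra.
Qed.

End hahn_banach.

Lemma norm_bounded_continuous (R : realType) (X : normedModType R)
  (l : {linear X -> R}) : (forall y, `|l y| <= `|y|) -> continuous l.
Proof.
move=> lb; apply: bounded_linear_continuous.
apply/linear_boundedP; near=> M => y.
by apply: (le_trans (lb y)); rewrite ler_peMl//; near: M; exact: nbhs_pinfty_ge.
Unshelve. all: by end_near. Qed.

(** * Half-spaces generate the Borel sets of a separable space *)

Section halfspaces.
Context {R : realType} {X : normedModType R}.

Definition halfspaces : set (set X) :=
  [set A | exists l : {linear X -> R}, continuous l /\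
    exists c, A = [set x | c < l x]].

Lemma separable_dense_sequence : separable_space X ->
  exists e : nat -> X, forall x r, 0 < r -> exists n, `|x - e n| < r.
Proof.
move=> [D /pcard_surjP[e eD] dD]; exists e => x r r0.
have := dD (ball x r) _ (ball_open x r); case.
  by exists x; exact: ballxx.
move=> y [+ Dy]; have [n _ <-] := eD _ Dy.
by rewrite -ball_normE => h; exists n.
Qed.

(* The norm is the supremum of countably many functionals, those norming a dense
   sequence. *)
Lemma open_sub_halfspaces : separable_space X ->
  @open X `<=` <<s halfspaces >>.
Proof.
move=> /separable_dense_sequence[e ed] U oU.
change (measurable (U : set (g_sigma_algebraType halfspaces))).
have [l lP] := choice (fun n => norming_functional (e n)).
have normP x r : (forall n, l n x <= r) -> `|x| <= r.
  move=> lr; apply/ler_addgt0Pr => eps eps0.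
  have [n xn] := ed x (eps / 2) (divr_gt0 eps0 (ltr0n _ 2)).
  have [ln len] := lP n.
  have : `|x| <= `|x - e n| + `|e n| by rewrite -{1}(subrK (e n) x) ler_normD.
  have := le_trans (ler_norm _) (ln (e n - x)).
  rewrite linearB/= len distrC; have := lr n; lra.
have mball c r : measurable
    ([set x | `|x - c| <= r] : set (g_sigma_algebraType halfspaces)).
  rewrite (_ : mkset _ = \bigcap_n ~` [set x | l n c + r < l n x]).
    apply: bigcap_measurable => // n _; apply: measurableC.
    apply: sub_sigma_algebra; exists (l n); split; last by exists (l n c + r).
    exact: norm_bounded_continuous (lP n).1.
  apply/seteqP; split => x /= xc.
    move=> n _ /=; apply/negP; rewrite -leNgt addrC -lerBlDr -linearB/=.
    by apply: le_trans xc; apply: le_trans (ler_norm _) ((lP n).1 _).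
  apply: normP => n; have /negP := xc n I.
  by rewrite -leNgt linearB/= lerBlDl.
pose I n := [set m | [set x | `|x - e n| <= m.+1%:R^-1] `<=` U].
rewrite (_ : U = \bigcup_n \bigcup_(m in I n) [set x | `|x - e n| <= m.+1%:R^-1]).
  by apply: bigcup_measurable => n _; apply: bigcup_measurable => m _.
apply/seteqP; split => [x Ux|x [n _ [m Inm]]]; last exact: Inm.
have /nbhs_ballP[r /= r0 xrU] : nbhs x U by exact: open_nbhs_nbhs.
(* The ball around some e n must contain x and stay within distance r of x, hence a radius below r /
   2. *)
have [m mr] : exists m : nat, m.+1%:R^-1 < r / 2.
  have [m _ /(_ m (leqnn m))] := near_infty_natSinv_lt (PosNum (divr_gt0 r0 (ltr0n R 2))).
  by exists m.
have [n xn] := ed x m.+1%:R^-1 (ltac:(by rewrite invr_gt0)).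
exists n => //; exists m; last by rewrite /= ltW.
move=> y /= yn; apply: xrU; rewrite -ball_normE /=.
have : `|x - y| <= `|x - e n| + `|e n - y|.
  by apply: le_trans (ler_normD _ _); rewrite addrA subrK.
rewrite (distrC (e n)) => h.
by apply: le_lt_trans h _; rewrite (splitr r) ltrD// ?(lt_trans xn)// (le_lt_trans yn).
Qed.

End halfspaces.

(** * Integration against a measure given by a density *)

Section integral_density.
Local Open Scope ereal_scope.
Context d (T : measurableType d) (R : realType).
Variables (m nu : {measure set T -> \bar R}) (p : T -> R).
Hypotheses (mp : measurable_fun setT p) (p0 : forall x, (0 <= p x)%R).
Hypothesis nuE : forall A, measurable A -> nu A = \int[m]_(x in A) (p x)%:E.

Import HBNNSimple.

Let integral_density_nnsfun (h : {nnsfun T >-> R}) :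
  \int[nu]_x (h x)%:E = \int[m]_x ((h x)%:E * (p x)%:E).
Proof.
under eq_integral do rewrite fimfunE -fsumEFin//.
rewrite ge0_integral_fsum//; last 2 first.
- by move=> y; exact/measurable_EFinP/measurable_funM.
- by move=> y x _; rewrite nnfun_muleindic_ge0.
transitivity (\sum_(k \in range h)
    \int[m]_x (k * \1_(h @^-1` [set k]) x * p x)%:E).
  apply: eq_fsbigr => r _; rewrite integralZl_indic_nnsfun// integral_indic//=.
  rewrite setIT nuE//.
  have [r0|r0] := leP 0%R r; last first.
    rewrite preimage_nnfun0// integral_set0 mule0 integral0_eq// => x _.
    by rewrite indic0 mulr0 mul0r.
  rewrite integral_mkcond -ge0_integralZl ?lee_fin//; last 2 first.
  - apply/(measurable_restrictT (EFin \o p)) => //.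
    by apply: measurable_funTS; exact/measurable_EFinP.
  - by move=> x _; apply: erestrict_ge0 => y _; rewrite lee_fin.
  - apply: eq_integral => x _; rewrite -mulrA EFinM; congr (_ * _).
    by rewrite patchE indicE; case: ifP => _; rewrite ?mul1r ?mul0r.
rewrite -ge0_integral_fsum//.
- apply: eq_integral => x _; rewrite fsumEFin//.
  rewrite -EFinM [in RHS]fimfunE; congr EFin; rewrite !fsbig_finite//=.
  by rewrite mulr_suml.
- move=> r; apply/measurable_EFinP/measurable_funM => //.
  exact/measurable_funM.
- move=> r x _; rewrite EFinM mule_ge0//; last by rewrite lee_fin.
  by rewrite nnfun_muleindic_ge0.
Qed.

Lemma ge0_integral_density (f : T -> \bar R) : measurable_fun setT f ->
  (forall x, 0 <= f x) -> \int[nu]_x f x = \int[m]_x (f x * (p x)%:E).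
Proof.
move=> mf f0; pose f_ := nnsfun_approx measurableT mf.
have f_f x : (f_ n x)%:E @[n --> \oo] --> f x.
  by apply: (cvg_nnsfun_approx measurableT mf) => // y _; exact: f0.
have ndf x : {homo (fun n => (f_ n x)%:E) : n k / (n <= k)%N >-> n <= k}.
  by move=> n k nk; rewrite lee_fin; exact/lefP/nd_nnsfun_approx.
transitivity (limn (fun n => \int[nu]_x (f_ n x)%:E)).
  rewrite -monotone_convergence//.
  - by apply: eq_integral => x _; apply/esym/cvg_lim.
  - by move=> n; exact/measurable_EFinP/measurable_funP.
  - by move=> n x _; rewrite lee_fin.
under eq_fun do rewrite integral_density_nnsfun.
rewrite -monotone_convergence//.
- apply: eq_integral => x _; apply/cvg_lim => //.
  by apply: cvgeZr => //; exact: f_f.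
- move=> n; apply: emeasurable_funM; first exact/measurable_EFinP/measurable_funP.
  exact/measurable_EFinP.
- by move=> n x _; rewrite mule_ge0// lee_fin.
- by move=> x _ n k nk; rewrite lee_wpmul2r ?lee_fin//; exact: ndf.
Qed.

Lemma ge0_integral_density_in D (f : T -> \bar R) : measurable D ->
  measurable_fun D f -> (forall x, D x -> 0 <= f x) ->
  \int[nu]_(x in D) f x = \int[m]_(x in D) (f x * (p x)%:E).
Proof.
move=> mD mf f0; rewrite integral_mkcond ge0_integral_density.
- rewrite [RHS]integral_mkcond; apply: eq_integral => x _.
  by rewrite !patchE; case: ifP => // _; rewrite mul0e.
- exact/(measurable_restrictT f).
- by move=> x; apply: erestrict_ge0.
Qed.

Lemma integral_density D (f : T -> R) : measurable D -> measurable_fun D f ->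
  m.-integrable D (EFin \o (fun x => f x * p x)%R) ->
  nu.-integrable D (EFin \o f) /\
  \int[nu]_(x in D) (f x)%:E = \int[m]_(x in D) (f x * p x)%:E.
Proof.
move=> mD mf fi; have mEf : measurable_fun D (EFin \o f) by exact/measurable_EFinP.
have posE x : ((EFin \o (fun x => f x * p x)%R)^\+ x = (EFin \o f)^\+ x * (p x)%:E)%E.
  by rewrite /= !funeposE /= -!EFin_max -EFinM maxr_pMl// mul0r.
have negE x : ((EFin \o (fun x => f x * p x)%R)^\- x = (EFin \o f)^\- x * (p x)%:E)%E.
  by rewrite /= !funenegE /= -?EFinN -!EFin_max -EFinM maxr_pMl// mul0r mulNr.
split.
  apply/integrableP; split => //; rewrite ge0_integral_density_in//; last first.
    exact: measurableT_comp.
  have /integrableP[_] := fi; congr (_ < _); apply: eq_integral => x _ /=.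
  by rewrite normrM (ger0_norm (p0 x)).
rewrite integralE [RHS]integralE; congr (_ - _).
  rewrite ge0_integral_density_in//; last exact: measurable_funepos.
  by apply: eq_integral => x _; rewrite -posE.
rewrite ge0_integral_density_in//; last exact: measurable_funeneg.
by apply: eq_integral => x _; rewrite -negE.
Qed.

End integral_density.

(** * Integrability and dominated convergence for real-valued functions *)

Section real_integrals.
Context d (T : measurableType d) (R : realType).
Variables (m : {measure set T -> \bar R}) (D : set T) (mD : measurable D).
Implicit Types f g : T -> R.

Lemma integrable_le f g : measurable_fun D f ->
  m.-integrable D (EFin \o g) -> (forall x, D x -> `|f x| <= g x) ->
  m.-integrable D (EFin \o f).
Proof.
move=> mf ig fg; apply: le_integrable ig => //; first exact/measurable_EFinP.
by move=> x Dx; rewrite lee_fin (le_trans (fg _ Dx))// ler_norm.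
Qed.

Lemma integrable_add f g : m.-integrable D (EFin \o f) ->
  m.-integrable D (EFin \o g) -> m.-integrable D (EFin \o (fun x => f x + g x)).
Proof. by move=> fi gi; exact: (integrableD mD fi gi). Qed.

Lemma integrable_sub f g : m.-integrable D (EFin \o f) ->
  m.-integrable D (EFin \o g) -> m.-integrable D (EFin \o (fun x => f x - g x)).
Proof. by move=> fi gi; exact: (integrableB mD fi gi). Qed.

Lemma integrable_scale a f : m.-integrable D (EFin \o f) ->
  m.-integrable D (EFin \o (fun x => a * f x)).
Proof. by move=> fi; exact: (integrableZl mD a fi). Qed.

Lemma fin_num_integral f : m.-integrable D (EFin \o f) ->
  (\int[m]_(x in D) (f x)%:E = (\int[m]_(x in D) f x)%R%:E)%E.
Proof. by move=> fi; rewrite /Rintegral fineK// integrable_fin_num. Qed.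

Lemma ge0_lty_integrable f : measurable_fun D f -> (forall x, D x -> 0 <= f x) ->
  (\int[m]_(x in D) (f x)%:E < +oo)%E -> m.-integrable D (EFin \o f).
Proof.
move=> mf f0 fy; apply/integrableP; split; first exact/measurable_EFinP.
apply: le_lt_trans fy; rewrite le_eqVlt; apply/orP; left; apply/eqP.
by apply: eq_integral => x /[!inE] Dx /=; rewrite ger0_norm// f0.
Qed.

Lemma Rintegral_dominated_convergence (f_ : nat -> T -> R) f g :
  (forall n, measurable_fun D (f_ n)) ->
  (forall x, D x -> f_ n x @[n --> \oo] --> f x) ->
  m.-integrable D (EFin \o g) -> (forall n x, D x -> `|f_ n x| <= g x) ->
  m.-integrable D (EFin \o f) /\
  \int[m]_(x in D) f_ n x @[n --> \oo] --> \int[m]_(x in D) f x.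
Proof.
move=> mf_ f_f gi fg.
have mf : measurable_fun D f by apply: measurable_fun_cvg => // x Dx; exact: f_f.
have [] := @dominated_convergence _ _ _ m D mD (fun n => EFin \o f_ n)
    (EFin \o f) (EFin \o g) _ _ _ gi.
- by move=> n; exact/measurable_EFinP.
- exact/measurable_EFinP.
- by apply/aeW => x Dx; apply: cvg_EFin; [exact: nearW|exact: f_f].
- by apply/aeW => x n Dx; rewrite lee_fin; exact: fg.
move=> fi _; rewrite fin_num_integral// => h; split=> //.
exact: (fine_cvg h).
Qed.

End real_integrals.

(** * Elementary bounds on the exponential *)

Section exponential_bounds.
Context {R : realType}.
Implicit Types x y a b : R.

(** The tangent bound 1 - a <= e^(-a), multiplied by e^a. *)
Lemma expR_sub1_le a : expR a - 1 <= a * expR a.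
Proof.
have := expR_ge1Dx (- a); rewrite -(@ler_pM2r _ (expR a)) ?expR_gt0//.
by rewrite -expRD addNr expR0 mulrBl mul1r; lra.
Qed.

Lemma le_norm_expR a : `|a| <= expR `|a|.
Proof. by have := expR_ge1Dx `|a|; lra. Qed.

Lemma normr_expR_sub1 a : `|expR a - 1| <= `|a| * expR `|a|.
Proof.
have h := expR_sub1_le a; have h' := expR_ge1Dx a.
have e1 : 1 <= expR `|a| by rewrite -expR0 ler_expR.
rewrite ler_norml; apply/andP; split; last first.
  apply: (le_trans h); apply: (@le_trans _ _ (`|a| * expR a)).
    by rewrite ler_wpM2r ?expR_ge0// ler_norm.
  by rewrite ler_wpM2l// ler_expR ler_norm.
have : `|a| <= `|a| * expR `|a| by rewrite ler_peMr.
by have := ler_norm (- a); rewrite normrN; lra.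
Qed.

Lemma expR_sub_le a b : `|expR a - expR b| <= `|a - b| * (expR a + expR b).
Proof.
wlog ab : a b / b <= a.
  move=> h; have [/h//|/ltW/h] := leP b a.
  by rewrite distrC (distrC b) (addrC (expR b)).
rewrite !ger0_norm ?subr_ge0 ?ler_expR//.
have := expR_sub1_le (a - b); rewrite -(@ler_pM2r _ (expR b)) ?expR_gt0//.
rewrite mulrBl -mulrA -expRD subrK mul1r => /le_trans; apply.
by rewrite ler_wpM2l ?subr_ge0// lerDl expR_ge0.
Qed.

Lemma expR_norm_le a : expR `|a| <= expR a + expR (- a).
Proof.
have [_|_] := ger0P a; first by rewrite lerDl expR_ge0.
by rewrite lerDr expR_ge0.
Qed.

(** The sequence lies between y and y e^(y / u n). This limit recovers a functional from its
    exponentials. *)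
Lemma cvg_scaled_expR_sub1 (u : nat -> R) y : (forall n, 0 < u n) ->
  (u n)^-1 @[n --> \oo] --> 0 -> u n * (expR (y / u n) - 1) @[n --> \oo] --> y.
Proof.
move=> u0 uoo.
have yu : y / u n @[n --> \oo] --> 0.
  by rewrite -(mulr0 y); apply: cvgMr.
have := @squeeze_cvgr _ \oo _ R (fun=> y) (fun n => y * expR (y / u n))
  (fun n => u n * (expR (y / u n) - 1)).
apply; last 2 first.
- exact: cvg_cst.
- rewrite -[X in _ --> X]mulr1; apply: cvgMr.
  by rewrite -(@expR0 R); apply: continuous_cvg yu; exact: continuous_expR.
- apply: nearW => n; have un := u0 n.
  have e : y = u n * (y / u n) by rewrite mulrC divfK ?gt_eqF.
  apply/andP; split.
    by rewrite {1}e ler_wpM2l ?(ltW un)// lerBrDl expR_ge1Dx.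
  by rewrite {2}e -mulrA ler_wpM2l ?(ltW un)// expR_sub1_le.
Qed.

Lemma cvg_invr_nat : (n.+1%:R : R)^-1 @[n --> \oo] --> 0.
Proof. exact: cvg_harmonic. Qed.

(** A majorant for the preceding limit, uniform in u >= 1: one factor e^|y| bounds |y|, the other
    bounds e^(|y| / u). *)
Lemma normr_scaled_expR_sub1 (u : R) y : 1 <= u ->
  `|u * (expR (y / u) - 1)| <= expR (2 * `|y|).
Proof.
move=> u1; have u0 : 0 < u by lra.
rewrite normrM gtr0_norm//.
apply: le_trans (_ : u * (`|y / u| * expR `|y / u|) <= _).
  by rewrite ler_wpM2l ?(ltW u0)// normr_expR_sub1.
rewrite normrM normfV (gtr0_norm u0) mulrA mulrCA mulfV ?gt_eqF// mulr1.
rewrite mulr_natl mulr2n expRD ler_pM ?expR_ge0 ?le_norm_expR//.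
by rewrite ler_expR ler_pdivrMr// ler_peMr.
Qed.

End exponential_bounds.

Lemma Rintegral_cst_probability d (T : measurableType d) (R : realType)
  (P : probability T R) (r : R) : \int[P]_(x in setT) r = r.
Proof.
rewrite Rintegral_cst//; have := @probability_setT _ _ _ P.
by move=> /(congr1 fine) /= e; rewrite [X in _ * X]e mulr1.
Qed.

(** * Gaussian moment generating functions and their L^2 limits *)

Section gaussian_mgf.
Context d (T : measurableType d) (R : realType) (P : probability T R).
Implicit Types (Y : T -> R) (v t : R).

(** The law N(0, v) described through exponentials, with the Dirac mass at 0 as the case v = 0. That
    v is the variance is derived in [gaussian_mgf_variance]. *)
Definition gaussian_mgf Y v := measurable_fun setT Y /\
  forall t, (\int[P]_x (expR (t * Y x))%:E = (expR (t ^+ 2 * v / 2))%:E)%E.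

Lemma measurable_expR_comp Y : measurable_fun setT Y ->
  measurable_fun setT (fun x => expR (Y x)).
Proof. by move=> mY; exact: measurableT_comp (@measurable_expR R) mY. Qed.

Lemma gaussian_mgf_integrable Y v t : gaussian_mgf Y v ->
  P.-integrable setT (EFin \o (fun x => expR (t * Y x))).
Proof.
move=> [mY Ye]; apply: ge0_lty_integrable => //.
- by apply: measurable_expR_comp; exact: measurable_funM.
- by rewrite Ye ltry.
Qed.

Lemma gaussian_mgfE Y v t : gaussian_mgf Y v ->
  \int[P]_x expR (t * Y x) = expR (t ^+ 2 * v / 2).
Proof. by move=> [mY Ye]; rewrite /Rintegral Ye. Qed.

Lemma integrable_expR_norm Y (c : R) : 0 <= c -> measurable_fun setT Y ->
  (forall t, P.-integrable setT (EFin \o (fun x => expR (t * Y x)))) ->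
  P.-integrable setT (EFin \o (fun x => expR (c * `|Y x|))).
Proof.
move=> c0 mY Yi.
apply: integrable_le (integrable_add measurableT (Yi c) (Yi (- c))) _ => //.
  apply: measurable_expR_comp; apply: measurable_funM => //.
  exact: measurableT_comp.
move=> x _; rewrite ger0_norm ?expR_ge0// -{1}(ger0_norm c0) -normrM mulNr.
exact: expR_norm_le.
Qed.

Lemma sqr_le_expR (y : R) : y ^+ 2 <= expR (2 * `|y|).
Proof.
rewrite -real_normK ?num_real// expr2 mulr_natl mulr2n expRD.
by rewrite ler_pM ?le_norm_expR.
Qed.

Lemma integrable_sqr_expR_norm Y : measurable_fun setT Y ->
  P.-integrable setT (EFin \o (fun x => expR (2 * `|Y x|))) ->
  P.-integrable setT (EFin \o (fun x => Y x ^+ 2)).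
Proof.
move=> mY Yi; apply: integrable_le Yi _ => //; first exact: measurable_funX.
by move=> x _; rewrite ger0_norm ?sqr_ge0// sqr_le_expR.
Qed.

Lemma gaussian_mgf_integrable_sqr Y v : gaussian_mgf Y v ->
  P.-integrable setT (EFin \o (fun x => Y x ^+ 2)).
Proof.
move=> Yv; apply: integrable_sqr_expR_norm; first exact: Yv.1.
by apply: integrable_expR_norm; [|exact: Yv.1|move=> t; exact: gaussian_mgf_integrable Yv].
Qed.

(* Second difference quotients of the moment generating function at 0. *)
Lemma gaussian_mgf_variance Y v : gaussian_mgf Y v -> \int[P]_x Y x ^+ 2 = v.
Proof.
move=> Yv; have [mY _] := Yv.
(* With n+1 for n, n^2 (e^(y/n) + e^(-y/n) - 2) is the square of e^(-y/(2n)) n (e^(y/n) - 1), so the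
   first-order limit and its majorant apply. *)
pose h n x := (expR (- (Y x / 2) / n.+1%:R) * (n.+1%:R * (expR (Y x / n.+1%:R) - 1))) ^+ 2.
have hE n x : h n x = n.+1%:R ^+ 2 *
    (expR (n.+1%:R^-1 * Y x) + expR (- n.+1%:R^-1 * Y x) - 2).
  pose a := Y x / 2 / n.+1%:R.
  have e1 : Y x / n.+1%:R = a + a by rewrite /a -mulrDl -splitr.
  have e2 : n.+1%:R^-1 * Y x = a + a by rewrite mulrC.
  rewrite /h !mulNr e2 -/a e1.
  rewrite opprD !expRD expRN.
  have : expR a != 0 by rewrite gt_eqF ?expR_gt0.
  by move: (expR a) n.+1%:R => z w z0; field.
(* 5 = 2 (1/2 + 2): the prefactor is at most e^(|Y|/2), the scaled difference at most e^(2|Y|), and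
   their product is squared. *)
have hb n x : `|h n x| <= expR (5 * `|Y x|).
  have -> : 5 * `|Y x| = (2^-1 * `|Y x| + 2 * `|Y x|) + (2^-1 * `|Y x| + 2 * `|Y x|) by field.
  rewrite /h normrX normrM expRD -expr2 expRD.
  rewrite lerXn2r ?nnegrE ?mulr_ge0 ?expR_ge0// ler_pM//.
    rewrite ger0_norm ?expR_ge0// ler_expR; apply: (le_trans (ler_norm _)).
    rewrite normrM normrN normrM (mulrC `|Y x|) !(@gtr0_norm _ (_^-1)) ?invr_gt0//.
    by rewrite ler_piMr// ?mulr_ge0// invf_le1// ler1n.
  by rewrite normr_scaled_expR_sub1// ler1n.
have hi t := gaussian_mgf_integrable t Yv.
have [||||_] := @Rintegral_dominated_convergence _ _ _ P _ measurableT h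
    (fun x => Y x ^+ 2) (fun x => expR (5 * `|Y x|)).
- move=> n; rewrite (_ : h n = fun x => n.+1%:R ^+ 2 *
    (expR (n.+1%:R^-1 * Y x) + expR (- n.+1%:R^-1 * Y x) - 2)); last first.
    by apply/funext => x; exact: hE.
  apply: measurable_funM => //; apply: measurable_funB => //.
  by apply: measurable_funD; apply: measurable_expR_comp; apply: measurable_funM.
- move=> x _.
  apply: (@continuous_cvg _ _ _ _ _ _ (fun y : R => y ^+ 2)).
    exact: exprn_continuous.
  rewrite -[X in _ --> X]mul1r; apply: cvgM.
    rewrite -[X in _ --> X](@expR0 R); apply: continuous_cvg; first exact: continuous_expR.
    by rewrite -[X in _ --> X](mulr0 (- (Y x / 2))); apply: cvgMr; exact: cvg_invr_nat.
  by apply: cvg_scaled_expR_sub1 => //; exact: cvg_invr_nat.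
- by apply: integrable_expR_norm.
- by move=> n x _; exact: hb.
move=> cv; apply: (cvg_unique _ cv) => //=.
(* The integral of [h n] is u (2 e^(v/(2u)) - 2) with u = (n+1)^2, which tends to v. *)
pose u (n : nat) : R := n.+1%:R ^+ 2.
have u0 n : 0 < u n by rewrite exprn_gt0.
rewrite (_ : (fun n => _) = fun n => 2 * (u n * (expR ((v / 2) / u n) - 1))).
  rewrite [X in _ --> X](_ : v = 2 * (v / 2)); last by field.
  apply: cvgMr; apply: cvg_scaled_expR_sub1 => //.
  rewrite (_ : (fun n => _) = fun n => n.+1%:R^-1 * n.+1%:R^-1).
    by rewrite -(mulr0 0); apply: cvgM; exact: cvg_invr_nat.
  by apply/funext => n; rewrite /u expr2 invfM.
apply/funext => n; under eq_Rintegral do rewrite hE.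
rewrite RintegralZl//; last first.
  apply: integrable_sub => //; first exact: integrable_add.
  exact: finite_measure_integrable_cst.
rewrite RintegralB//; [|exact: integrable_add|exact: finite_measure_integrable_cst].
rewrite RintegralD// !(gaussian_mgfE _ Yv) sqrrN Rintegral_cst_probability.
rewrite exprVn -/(u n) -mulrA (mulrC (u n)^-1).
by move: (expR _) => z; ring.
Qed.

Lemma gaussian_mgf_scale Y v (t : R) : gaussian_mgf Y v ->
  gaussian_mgf (fun x => t * Y x) (t ^+ 2 * v).
Proof.
move=> [mY Ye]; split; first exact: measurable_funM.
move=> s; under eq_integral do rewrite mulrA.
by rewrite Ye exprMn; congr (expR _)%:E; ring.
Qed.

(** C may depend on e but not on n: e is fixed first to make e K small, then n is taken large. In
    the uses, D n is a squared L^2 distance and the bound is a form of Young's inequality with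
    weight e. *)
Let cvg_trade_off (x D : nat -> R) (a K : R) : D n @[n --> \oo] --> 0 -> 0 <= K ->
  (forall e, 0 < e -> exists2 C, 0 <= C & forall n, `|a - x n| <= C * D n + e * K) ->
  x n @[n --> \oo] --> a.
Proof.
move=> D0 K0 h; apply/cvgrPdist_le => /= e e0.
have eK : 0 < e / 2 / (K + 1) by rewrite !divr_gt0// ltr_wpDl.
have [C C0 Cn] := h _ eK.
have eC : 0 < e / 2 / (C + 1) by rewrite !divr_gt0// ltr_wpDl.
near=> n; apply: (le_trans (Cn n)); rewrite [leRHS](splitr e) lerD//.
  apply: (@le_trans _ _ ((C + 1) * (e / 2 / (C + 1)))); last first.
    by rewrite mulrC divfK// gt_eqF// ltr_wpDl.
  apply: (@le_trans _ _ (C * `|0 - D n|)).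
    by rewrite ler_wpM2l// sub0r normrN ler_norm.
  rewrite ler_pM// ?lerDl//; near: n.
  by move/cvgrPdist_le : D0; apply.
rewrite -[leLHS]mulrA ler_piMr//; first by rewrite divr_ge0 ?(ltW e0).
by rewrite mulrC ler_pdivrMr ?mul1r ?lerDl// ltr_wpDl.
Unshelve. all: by end_near. Qed.

Let le_trade_off (a b K : R) (D : nat -> R) : D n @[n --> \oo] --> 0 -> 0 <= K ->
  (forall e, 0 < e -> exists2 C, 0 <= C & forall n, a <= b + (C * D n + e * K)) ->
  a <= b.
Proof.
move=> D0 K0 h; rewrite leNgt; apply/negP => ba.
have : (fun=> 0 : R) n @[n --> \oo] --> a - b.
  apply: cvg_trade_off D0 K0 _ => e /h[C C0 Cn]; exists C => // n.
  by rewrite subr0 ger0_norm ?subr_ge0 ?(ltW ba)// lerBlDl.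
move=> /(cvg_unique _ (cvg_cst _)) ab.
have : a - b = 0 by apply/esym/ab; exact: Rhausdorff.
by move=> /eqP; rewrite subr_eq0 gt_eqF.
Qed.

Let norm_trade_off (e z : R) : 0 < e -> `|z| <= e^-1 * z ^+ 2 + e.
Proof.
move=> e0; have [ze|ze] := leP `|z| e.
  by rewrite (le_trans ze)// lerDr mulr_ge0 ?sqr_ge0// invr_ge0 ltW.
rewrite -(real_normK (num_real z)); apply: ler_wpDr; first exact: ltW.
by rewrite expr2 mulrA ler_peMl// ler_pdivlMl// mulr1 ltW.
Qed.

Section limit.
Variables (Y_ : nat -> T -> R) (v_ : nat -> R) (Y : T -> R).
Hypotheses (Yv_ : forall n, gaussian_mgf (Y_ n) (v_ n)) (mY : measurable_fun setT Y).
Let q n x := (Y x - Y_ n x) ^+ 2.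
Hypothesis qi : forall n, P.-integrable setT (EFin \o q n).
Let D n := \int[P]_x q n x.
Hypothesis D0 : D n @[n --> \oo] --> 0.

Let Yi_ n : P.-integrable setT (EFin \o (fun x => Y_ n x ^+ 2)).
Proof. exact: gaussian_mgf_integrable_sqr (Yv_ n). Qed.

Let Yi : P.-integrable setT (EFin \o (fun x => Y x ^+ 2)).
Proof.
apply: integrable_le (integrable_add measurableT (integrable_scale measurableT 2 (Yi_ 0))
    (integrable_scale measurableT 2 (qi 0))) _ => //; first exact: measurable_funX.
move=> x _; rewrite ger0_norm ?sqr_ge0// /q.
have := sqr_ge0 (2 * Y_ 0 x - Y x); lra.
Qed.

Let v := \int[P]_x Y x ^+ 2.

Let v_cvg : v_ n @[n --> \oo] --> v.
Proof.
have v0 : 0 <= v by apply: Rintegral_ge0 => x _; exact: sqr_ge0.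
apply: cvg_trade_off D0 v0 _ => e e0; exists (1 + e^-1).
  by rewrite addr_ge0// invr_ge0 ltW.
move=> n; rewrite -(gaussian_mgf_variance (Yv_ n)) /v -RintegralB//.
apply: le_trans (le_normr_Rintegral _ _) _ => //; first exact: integrable_sub.
rewrite -RintegralZl// -RintegralZl// -RintegralD//; last 2 first.
- exact: integrable_scale.
- exact: integrable_scale.
apply: le_Rintegral => //.
- by apply: integrable_norm; exact: integrable_sub.
- by apply: integrable_add => //; exact: integrable_scale.
move=> x _; rewrite /q; set y := Y x; set z := Y_ n x.
have e1 : e * e^-1 = 1 by rewrite mulfV// gt_eqF.
have h : 2 * `|y| * `|y - z| <= e * y ^+ 2 + e^-1 * (y - z) ^+ 2.
  rewrite -(real_normK (num_real y)) -(real_normK (num_real (y - z))).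
  rewrite -subr_ge0; apply: le_trans (_ : 0 <= e^-1 * (e * `|y| - `|y - z|) ^+ 2) _.
    by rewrite mulr_ge0 ?invr_ge0 ?(ltW e0) ?sqr_ge0.
  rewrite le_eqVlt; apply/orP; left; apply/eqP.
  by move: `|y| `|y - z| => p r; field; rewrite gt_eqF.
have -> : y ^+ 2 - z ^+ 2 = 2 * y * (y - z) - (y - z) ^+ 2 by ring.
apply: (le_trans (ler_normB _ _)); rewrite (ger0_norm (sqr_ge0 (y - z))) !normrM.
rewrite (@gtr0_norm _ 2)//; lra.
Qed.

(** L^2 convergence does not control e^(2 Y). For the truncation e^(min (2 Y, c)) it does give the
    bound e^(2 V), which is independent of c, and monotone convergence then removes c. The exponent
    2 is what the quadratic estimate in [exp_limit] asks for. *)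
Let expi : P.-integrable setT (EFin \o (fun x => expR (2 * Y x))).
Proof.
have [V Vn] : exists V, forall n, v_ n <= V.
  have /cvg_seq_bounded[V [_ /(_ (V + 1))]] : cvgn v_ by apply/cvg_ex; exists v.
  rewrite ltrDl ltr01 => /(_ isT) h; exists (V + 1) => n.
  by apply: (le_trans (ler_norm _)); exact: h.
have mexp (c : nat) : measurable_fun setT (fun x => expR (Num.min (2 * Y x) c%:R)).
  apply: measurable_expR_comp; apply: measurable_minr => //; exact: measurable_funM.
have expci (c : nat) :
    P.-integrable setT (EFin \o (fun x => expR (Num.min (2 * Y x) c%:R))).
  apply: integrable_le (finite_measure_integrable_cst P (expR c%:R) measurableT) _ => //.
  by move=> x _; rewrite ger0_norm ?expR_ge0// ler_expR ge_min lexx orbT.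
have bound (c : nat) : \int[P]_x expR (Num.min (2 * Y x) c%:R) <= expR (2 * V).
  apply: (le_trade_off D0 (_ : 0 <= 2 * expR c%:R)); first by rewrite mulr_ge0// expR_ge0.
  move=> e e0; exists (2 * expR c%:R * e^-1).
    by rewrite !mulr_ge0 ?expR_ge0// invr_ge0 ltW.
  move=> n; have e2i := gaussian_mgf_integrable 2 (Yv_ n).
  apply: le_trans (_ : \int[P]_x (expR (2 * Y_ n x) +
      (2 * expR c%:R * e^-1 * q n x + e * (2 * expR c%:R))) <= _); last first.
    rewrite RintegralD//; last first.
      apply: integrable_add => //; first exact: integrable_scale.
      exact: finite_measure_integrable_cst.
    rewrite RintegralD//; last 2 first.
    - exact: integrable_scale.
    - exact: finite_measure_integrable_cst.
    rewrite RintegralZl// Rintegral_cst_probability lerD2r.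
    rewrite (gaussian_mgfE _ (Yv_ n)) ler_expR.
    by have := Vn n; lra.
  apply: le_Rintegral => //.
    apply: integrable_add => //; apply: integrable_add => //.
      exact: integrable_scale.
    exact: finite_measure_integrable_cst.
  move=> x _; rewrite -lerBlDl /q; set w := Num.min _ _.
  have wc : w <= c%:R by rewrite ge_min lexx orbT.
  have wY : w <= 2 * Y x by rewrite ge_min lexx.
  (* Where w exceeds 2 Y_n, the excess is at most 2 |Y - Y_n| and e^w is at most e^c; elsewhere the
     left side is nonpositive. *)
  have [w2|w2] := leP w (2 * Y_ n x).
    apply: le_trans (_ : 0 <= _); first by rewrite subr_le0 ler_expR.
    have c0 := expR_ge0 (c%:R : R).
    apply: addr_ge0; last by rewrite mulr_ge0 ?(ltW e0)// mulr_ge0.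
    by rewrite mulr_ge0 ?sqr_ge0// divr_ge0 ?(ltW e0)// mulr_ge0.
  have h := expR_sub1_le (w - 2 * Y_ n x).
  apply: le_trans (_ : (w - 2 * Y_ n x) * expR w <= _).
    have := ler_wpM2r (expR_ge0 (2 * Y_ n x)) h.
    by rewrite mulrBl mul1r -mulrA -expRD subrK.
  apply: le_trans (_ : (2 * `|Y x - Y_ n x|) * expR c%:R <= _).
    apply: ler_pM; rewrite ?expR_ge0 ?subr_ge0 ?ler_expR//; first exact: ltW.
    by have := ler_norm (Y x - Y_ n x); lra.
  have := ler_wpM2r (expR_ge0 c%:R) (norm_trade_off (Y x - Y_ n x) e0); lra.
apply: ge0_lty_integrable => //.
- by apply: measurable_expR_comp; exact: measurable_funM.
have : (\int[P]_x (expR (Num.min (2 * Y x) c%:R))%:E)%E @[c --> \oo] -->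
    (\int[P]_x (expR (2 * Y x))%:E)%E.
  rewrite [X in _ --> X](_ : _ = \int[P]_x (limn
      (fun c : nat => (expR (Num.min (2 * Y x) c%:R))%:E)))%E.
    apply: cvg_monotone_convergence => //.
    - by move=> c; exact/measurable_EFinP.
    - move=> x _ c k ck; rewrite lee_fin ler_expR le_min ge_min lexx/=.
      by rewrite ge_min ler_nat ck orbT.
  apply: eq_integral => x _; apply/esym/cvg_lim => //.
  apply: cvg_near_cst; near=> c; rewrite min_l//.
  by near: c; exact: nbhs_infty_ger.
move=> cv; apply: (@le_lt_trans _ _ (expR (2 * V))%:E); last exact: ltry.
rewrite -(cvg_lim _ cv)//; apply: lime_le; first by apply/cvg_ex; eexists; exact: cv.
by apply: nearW => c; rewrite fin_num_integral// lee_fin.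
Unshelve. all: by end_near. Qed.

Let expi1 : P.-integrable setT (EFin \o (fun x => expR (Y x))).
Proof.
apply: integrable_le (integrable_add measurableT (finite_measure_integrable_cst P 1 measurableT)
  expi) _ => //; first exact: measurable_expR_comp.
move=> x _; rewrite ger0_norm ?expR_ge0//= mulrC expRM_natr.
have := sqr_ge0 (expR (Y x) - 1); have := expR_ge0 (Y x); nra.
Qed.

(** In |e^Y - e^(Y_n)| <= |Y - Y_n| (e^Y + e^(Y_n)), Young's inequality separates the squared
    distance, which tends to 0, from the means of e^(2 Y) and e^(2 Y_n), which are bounded in n. *)
Let exp_limit : \int[P]_x expR (Y x) = expR (v / 2).
Proof.
have cvl : expR (v_ n / 2) @[n --> \oo] --> expR (v / 2).
  by apply: continuous_cvg; [exact: continuous_expR|exact: cvgMl].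
apply: (cvg_unique _ _ cvl) => /=.
  exact: Rhausdorff.
have [V Vn] : exists V, forall n, v_ n <= V.
  have /cvg_seq_bounded[V [_ /(_ (V + 1))]] : cvgn v_ by apply/cvg_ex; exists v.
  rewrite ltrDl ltr01 => /(_ isT) h; exists (V + 1) => n.
  by apply: (le_trans (ler_norm _)); exact: h.
pose K := 2 * \int[P]_x expR (2 * Y x) + 2 * expR (2 * V).
have K0 : 0 <= K.
  rewrite addr_ge0// mulr_ge0// ?expR_ge0//.
  by apply: Rintegral_ge0 => x _; exact: expR_ge0.
apply: cvg_trade_off D0 K0 _ => e e0; exists e^-1; first by rewrite invr_ge0 ltW.
move=> n; have e2i := gaussian_mgf_integrable 2 (Yv_ n).
have e1i : P.-integrable setT (EFin \o (fun x => expR (Y_ n x))).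
  have := gaussian_mgf_integrable 1 (Yv_ n); apply: eq_integrable => // x _ /=.
  by rewrite mul1r.
have -> : expR (v_ n / 2) = \int[P]_x expR (Y_ n x).
  have := gaussian_mgfE 1 (Yv_ n); rewrite expr1n mul1r => <-.
  by apply: eq_Rintegral => x _; rewrite mul1r.
rewrite -RintegralB//.
apply: le_trans (le_normr_Rintegral _ _) _ => //; first exact: integrable_sub.
apply: le_trans (_ : \int[P]_x (e^-1 * q n x + (e * 2) * (expR (2 * Y x) +
    expR (2 * Y_ n x))) <= _); last first.
  rewrite RintegralD//; last 2 first.
  - exact: integrable_scale.
  - by apply: integrable_scale => //; exact: integrable_add.
  rewrite RintegralZl// RintegralZl//; last exact: integrable_add.
  rewrite RintegralD// (gaussian_mgfE _ (Yv_ n)) lerD2l -[leLHS]mulrA ler_wpM2l ?(ltW e0)//.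
  by rewrite mulrDr lerD2l ler_wpM2l// ler_expR; have := Vn n; lra.
apply: le_Rintegral => //.
- by apply: integrable_norm; exact: integrable_sub.
- apply: integrable_add => //; first exact: integrable_scale.
  by apply: integrable_scale => //; exact: integrable_add.
move=> x _; apply: (le_trans (expR_sub_le _ _)).
have sq (z : R) : expR (2 * z) = expR z ^+ 2 by rewrite mulrC expRM_natr.
rewrite /q !sq -(real_normK (num_real (Y x - _))).
have := expR_ge0 (Y x); have := expR_ge0 (Y_ n x); have := normr_ge0 (Y x - Y_ n x).
move: `|_ - _| (expR (Y x)) (expR (Y_ n x)) => z a b z0 b0 a0.
have h1 : z * (a + b) <= e^-1 * z ^+ 2 + e * (a + b) ^+ 2.
  have e1 : e * e^-1 = 1 by rewrite mulfV// gt_eqF.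
  have : 0 <= e^-1 * (z - e * (a + b) / 2) ^+ 2 by rewrite mulr_ge0 ?invr_ge0 ?(ltW e0) ?sqr_ge0.
  have -> : e^-1 * (z - e * (a + b) / 2) ^+ 2 = e^-1 * z ^+ 2 - z * (a + b) + e * (a + b) ^+ 2 / 4.
    by field; rewrite gt_eqF.
  have : 0 <= e * (a + b) ^+ 2 by rewrite mulr_ge0 ?(ltW e0) ?sqr_ge0.
  by lra.
apply: (le_trans h1); rewrite lerD2l -[leRHS]mulrA ler_wpM2l ?(ltW e0)//.
have := sqr_ge0 (a - b); lra.
Qed.

Lemma gaussian_exp_limit : P.-integrable setT (EFin \o (fun x => Y x ^+ 2)) /\
  (\int[P]_x (expR (Y x))%:E = (expR (v / 2))%:E)%E.
Proof. by split; [exact: Yi|rewrite fin_num_integral// exp_limit]. Qed.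

End limit.

Lemma gaussian_mgf_limit (Y_ : nat -> T -> R) (v_ : nat -> R) (Y : T -> R) :
  (forall n, gaussian_mgf (Y_ n) (v_ n)) -> measurable_fun setT Y ->
  (\int[P]_x ((Y x - Y_ n x) ^+ 2)%:E)%E @[n --> \oo] --> 0%E ->
  gaussian_mgf Y (\int[P]_x Y x ^+ 2).
Proof.
(* Convergence in the extended reals allows infinite distances at first; they are finite from N on,
   and the sequence is shifted by N. *)
move=> Yv_ mY /fine_cvgP[] [N _ Nfin] D0.
have mq n : measurable_fun setT (fun x => (Y x - Y_ n x) ^+ 2).
  by apply: measurable_funX; apply: measurable_funB => //; exact: (Yv_ n).1.
have qi n : P.-integrable setT (EFin \o (fun x => (Y x - Y_ (n + N)%N x) ^+ 2)).
  apply: ge0_lty_integrable => //; first by move=> x _; exact: sqr_ge0.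
  by rewrite -ge0_fin_numE ?Nfin//= ?leq_addl// integral_ge0// => x _; rewrite lee_fin sqr_ge0.
(* The limit argument treats the exponent Y alone; a general t is reached by applying it to t Y and
   t Y_n. *)
have lim t : P.-integrable setT (EFin \o (fun x => (t * Y x) ^+ 2)) /\
    (\int[P]_x (expR (t * Y x))%:E = (expR (\int[P]_x (t * Y x) ^+ 2 / 2))%:E)%E.
  have qE n x : (t * Y x - t * Y_ (n + N)%N x) ^+ 2 = t ^+ 2 * (Y x - Y_ (n + N)%N x) ^+ 2.
    by rewrite -mulrBr exprMn.
  apply: (@gaussian_exp_limit (fun n x => t * Y_ (n + N)%N x) (fun n => t ^+ 2 * v_ (n + N)%N)).
  - by move=> n; exact: gaussian_mgf_scale.
  - exact: measurable_funM.
  - move=> n; apply: eq_integrable (integrable_scale measurableT (t ^+ 2) (qi n)) => //.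
    by move=> x _ /=; rewrite qE.
  - suff : t ^+ 2 * (\int[P]_x (Y x - Y_ (n + N)%N x) ^+ 2) @[n --> \oo] --> 0.
      apply: cvg_trans; apply: near_eq_cvg; apply: nearW => n /=.
      by rewrite -RintegralZl//; apply: eq_Rintegral => x _; rewrite qE.
    rewrite -[X in _ --> X](mulr0 (t ^+ 2)); apply: cvgMr.
    by move: D0; rewrite -(cvg_shiftn N).
split=> // t; have [_ ->] := lim t; congr (expR (_ / 2))%:E.
under eq_Rintegral do rewrite exprMn.
rewrite RintegralZl//; have [+ _] := lim 1; apply: eq_integrable => // x _ /=.
by rewrite mul1r.
Qed.

End gaussian_mgf.

(** * Gaussian laws of functionals and of their L^2 limits *)

Section centered_gaussian.
Context {R : realType} {X : completeNormedModType R}.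

Lemma continuous_borel_measurable (f : X -> R) : continuous f ->
  measurable_fun [set: borel X] (f : borel X -> R).
Proof.
move=> /continuousP cf; apply: (measurability _ (RGenOpens.measurableE R)).
move=> _ [_ [a [b ->] <-]]; rewrite setTI.
by apply: sub_sigma_algebra; apply: cf; exact: interval_open.
Qed.

Lemma normal_prob_mgf (s t : R) : s != 0 ->
  (\int[normal_prob 0 s]_x (expR (t * x))%:E = (expR (t ^+ 2 * s ^+ 2 / 2))%:E)%E.
Proof.
move=> s0; rewrite (@ge0_integral_density _ _ _ lebesgue_measure _ (normal_pdf 0 s)) //.
(* Completing the square: e^(t x) times the N(0, s^2) density is e^(t^2 s^2 / 2) times the N(t s^2,
   s^2) density, whose integral is 1. *)
- rewrite -[RHS]mule1 -(integral_normal_pdf (t * s ^+ 2) s) -ge0_integralZl//.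
  + apply: eq_integral => x _; rewrite -!EFinM; congr EFin.
    rewrite !normal_pdfE// /normal_fun mulrCA [RHS]mulrCA -!expRD; congr (_ * expR _).
    by field.
  + by apply/measurable_EFinP; exact: measurable_normal_pdf.
  + by move=> x _; rewrite lee_fin normal_pdf_ge0.
- exact: measurable_normal_pdf.
- exact: normal_pdf_ge0.
- by apply/measurable_EFinP; apply: measurable_expR_comp; exact: measurable_funM.
Qed.

Lemma centered_gaussian_mgf (mu : probability (borel X) R) (l : {linear X -> R}) :
  centered_gaussian mu -> continuous l -> exists v, gaussian_mgf mu (l : borel X -> R) v.
Proof.
move=> mug cl; have ml := continuous_borel_measurable cl.
have push (nu : {measure set (measurableTypeR R) -> \bar R}) t :
    (forall A : set R, measurable A -> mu (l @^-1` A) = nu A) ->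
    (\int[mu]_x (expR (t * l x))%:E = \int[nu]_y (expR (t * y))%:E)%E.
  move=> munu.
  pose lm : {mfun borel X >-> measurableTypeR R} := HB.pack (l : borel X -> measurableTypeR R)
    (isMeasurableFun.Build _ _ _ _ (l : borel X -> measurableTypeR R) ml).
  rewrite -(@eq_measure_integral _ _ _ setT nu (pushforward mu lm)).
    rewrite ge0_integral_pushforward// ?preimage_setT//.
    by apply/measurable_EFinP; apply: measurable_expR_comp; exact: measurable_funM.
  by move=> A mA _; exact: munu.
have [mu0|[s s0 mus]] := mug l cl.
  exists 0; split=> // t; rewrite (push (@dirac _ (measurableTypeR R) 0 R))// integral_dirac//.
    by rewrite diracT mul1e mulr0 mulr0 mul0r.
  by apply/measurable_EFinP; apply: measurable_expR_comp; exact: measurable_funM.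
exists (s ^+ 2); split=> // t.
by rewrite (push (normal_prob 0 s))// normal_prob_mgf// gt_eqF.
Qed.

Lemma L2_dual_closure_mgf (mu : probability (borel X) R) (g : X -> R) :
  centered_gaussian mu -> L2_dual_closure mu g ->
  gaussian_mgf mu (g : borel X -> R) (\int[mu]_x g x ^+ 2).
Proof.
move=> mug [mg [l cl gl]].
have [v vP] := choice (fun n => centered_gaussian_mgf mug (cl n)).
exact: (gaussian_mgf_limit vP mg gl).
Qed.

End centered_gaussian.

(** * The sign function as a limit of polynomials in sines *)

Section sign_limits.
Context {R : realType}.
Implicit Types x y : R.

Lemma normr_series_sin_coeff x n : `|series (sin_coeff x) n| <= expR `|x|.
Proof.
apply: (@le_trans _ _ (series (exp_coeff `|x|) n)).
  apply: (le_trans (ler_norm_sum _ _ _)); apply: ler_sum => i _.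
  rewrite /sin_coeff /exp_coeff/= !normrM normfV normrX [X in _ / X]ger0_norm//.
  rewrite ler_wpM2r ?invr_ge0// normrX normr_nat.
  by case: (odd i); rewrite ?mul0r ?normrX ?normrN1 ?expr1n ?mul1r// exprn_ge0.
apply: nondecreasing_cvgn_le; last exact: is_cvg_series_exp_coeff.
apply/nondecreasing_seqP => k.
by rewrite -subr_ge0 /series/= big_nat_recr//= addrAC subrr add0r exp_coeff_ge0.
Qed.

Lemma cvg_series_sin_coeff x : series (sin_coeff x) n @[n --> \oo] --> sin x.
Proof. by rewrite unlock; exact: is_cvg_series_sin_coeff. Qed.

(* A polynomial whose iterates converge to the sign function on [-1, 1]: its
   fixed points -1 and 1 are attracting and its fixed point 0 is repelling. *)
Definition cubic x : R := (3 * x - x ^+ 3) / 2.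

Lemma cubicN x : cubic (- x) = - cubic x.
Proof. by rewrite /cubic; field. Qed.

Lemma iter_cubicN n x : iter n cubic (- x) = - iter n cubic x.
Proof. by elim: n => //= n ->; rewrite cubicN. Qed.

(** At each step 1 - y is multiplied by (1 - y) (2 + y) / 2 = 1 - y/2 - y^2/2, which is at most 1 -
    x/2 once y >= x; and cubic y >= y on [0, 1] keeps the iterates above x. *)
Lemma iter_cubic_bounds n x : 0 <= x <= 1 ->
  x <= iter n cubic x <= 1 /\ 1 - iter n cubic x <= (1 - x / 2) ^+ n.
Proof.
move=> /andP[x0 x1]; elim: n => [|n /=]; first by rewrite expr0 lexx x1; split => //=; lra.
move: (iter n _ _) => y [/andP[xy y1] yn].
have e1 : 1 - cubic y = (1 - y) * ((1 - y) * (2 + y) / 2) by rewrite /cubic; field.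
have e2 : cubic y - y = y * (1 - y) * (1 + y) / 2 by rewrite /cubic; field.
have y0 : 0 <= y by lra.
split; first apply/andP; first split.
- have : 0 <= cubic y - y by rewrite e2; apply: divr_ge0 => //; rewrite !mulr_ge0//; lra.
  lra.
- have : 0 <= 1 - cubic y.
    by rewrite e1 mulr_ge0//; [lra|rewrite divr_ge0// mulr_ge0//; lra].
  lra.
- rewrite e1 exprSr ler_pM//; [lra|rewrite divr_ge0// mulr_ge0//; lra|nra].
Qed.

Lemma normr_iter_cubic n x : `|x| <= 1 -> `|iter n cubic x| <= 1.
Proof.
wlog x0 : x / 0 <= x => [h x1|].
  have [/h->//|x0] := leP 0 x.
  by rewrite -normrN -iter_cubicN h// ?normrN// oppr_ge0 ltW.
rewrite ger0_norm// => x1.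
have [|/andP[xn n1] _] := @iter_cubic_bounds n x; first by rewrite x0.
by rewrite ger0_norm// (le_trans x0).
Qed.

Lemma cvg_iter_cubic x : `|x| <= 1 -> iter n cubic x @[n --> \oo] --> Num.sg x.
Proof.
wlog x0 : x / 0 <= x => [h x1|].
  have [/h hx|x0] := leP 0 x; first exact: hx.
  have := @h (- x); rewrite normrN oppr_ge0 (ltW x0) sgrN => /(_ isT x1) /cvgN hN.
  rewrite -[X in _ --> X]opprK; apply: cvg_trans hN; apply: near_eq_cvg.
  by apply: nearW => n; rewrite -[RHS]opprK -iter_cubicN.
rewrite ger0_norm// => x1; move: x0; rewrite le_eqVlt => /predU1P[<-|x0].
  rewrite sgr0 (_ : (fun n => _) = fun=> 0); first exact: cvg_cst.
  by apply/funext; elim=> //= n ->; rewrite /cubic mulr0 expr0n subr0 mul0r.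
rewrite gtr0_sg//.
have B n := @iter_cubic_bounds n x.
have lim1 : 1 - (1 - x / 2) ^+ n @[n --> \oo] --> (1 : R).
  rewrite -[X in _ --> X]subr0; apply: cvgB; first exact: cvg_cst.
  by apply: cvg_expr; rewrite ger0_norm; lra.
apply: (@squeeze_cvgr _ \oo _ R (fun n => 1 - (1 - x / 2) ^+ n) (fun=> 1)
  (fun n => iter n cubic x) _ 1 lim1); last exact: cvg_cst.
apply: nearW => n.
have [|/andP[_ n1] n2] := B n; first by rewrite (ltW x0).
by rewrite n1 andbT; lra.
Qed.

(** Division by a large n brings y into (-pi, pi), where the sine has the sign of its argument; the
    sequence is eventually constant. *)
Lemma cvg_sg_sin y : Num.sg (sin (y / n.+1%:R)) @[n --> \oo] --> Num.sg y.
Proof.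
wlog y0 : y / 0 <= y => [h|].
  have [/h hy|y0] := leP 0 y; first exact: hy.
  have := @h (- y); rewrite oppr_ge0 (ltW y0) sgrN => /(_ isT) /cvgN hN.
  rewrite -[X in _ --> X]opprK; apply: cvg_trans hN; apply: near_eq_cvg.
  by apply: nearW => n; rewrite -[RHS]opprK -sgrN -sinN -mulNr.
move: y0; rewrite le_eqVlt => /predU1P[<-|y0].
  rewrite sgr0 (_ : (fun n => _) = fun=> 0); first exact: cvg_cst.
  by apply/funext=> n; rewrite mul0r sin0 sgr0.
apply: cvg_near_cst; near=> n; rewrite !gtr0_sg//.
apply: sin_gt0_pi; rewrite divr_gt0//=.
apply: (@lt_le_trans _ _ 2); last exact: pi_ge2.
apply: (@le_lt_trans _ _ 1); last by rewrite ltr1n.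
rewrite ler_pdivrMr// mul1r.
apply: (@le_trans _ _ n%:R); last by rewrite ler_nat.
by near: n; exact: nbhs_infty_ger.
Unshelve. all: by end_near. Qed.

End sign_limits.

(** * The Cameron-Martin formula *)

Lemma continuous_borel_measurable_fun (S T : ptopologicalType) (f : S -> T) :
  continuous f -> measurable_fun [set: borel S] (f : borel S -> borel T).
Proof.
move=> /continuousP cf.
apply: (@measurability _ _ (borel S) (borel T) setT _ (@open T) erefl) => _ [U oU <-].
by rewrite setTI; apply: sub_sigma_algebra; exact: cf.
Qed.

Lemma continuous_subr (R : realType) (V : normedModType R) (c : V) :
  continuous (fun u => u - c).
Proof. by move=> x; apply: cvgB; [exact: cvg_id|exact: cvg_cst]. Qed.

Section cameron_martin_theorem.
Context {R : realType} {X : completeNormedModType R}.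

Lemma measurable_translation (h : X) :
  measurable_fun [set: borel X] ((fun u => u - h) : borel X -> borel X).
Proof.
by apply: continuous_borel_measurable_fun; exact: continuous_subr.
Qed.

Variables (mu : probability (borel X) R).
Hypotheses (X_separable : separable_space X) (mug : centered_gaussian mu).
Variables (h : X) (g : X -> R).
Hypothesis hg : represents mu h g.

Let kappa := \int[mu]_x g x ^+ 2.

(** The density of the law of u - h, not of u + h, hence the sign of [g]. The constant normalises
    it, the mean of e^(-g) being e^(kappa / 2). *)
Definition cm_density (u : X) : R := expR (- g u - kappa / 2).
Let r := cm_density.

Let mg : measurable_fun [set: borel X] (g : borel X -> R).
Proof. by have [[]] := hg. Qed.

Lemma measurable_cm_density : measurable_fun [set: borel X] (r : borel X -> R).
Proof.
apply: measurable_expR_comp; apply: measurable_funB => //.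
exact: measurableT_comp.
Qed.

Let g_mgf : gaussian_mgf mu (g : borel X -> R) kappa.
Proof. by apply: L2_dual_closure_mgf => //; case: hg. Qed.

Let l_mgf (l : {linear X -> R}) : continuous l ->
  gaussian_mgf mu (l : borel X -> R) (\int[mu]_x l x ^+ 2).
Proof.
move=> cl; have [v lv] := centered_gaussian_mgf mug cl.
by rewrite (gaussian_mgf_variance lv).
Qed.

(** l - g lies in the same L^2 closure, so it is Gaussian. Its variance is expanded with the mean of
    l g, which is l h: here the vector [h] enters the formula. *)
Let lg_mgf (l : {linear X -> R}) : continuous l ->
  gaussian_mgf mu ((fun u => l u - g u) : borel X -> R)
    (\int[mu]_x (l x ^+ 2) - 2 * l h + kappa).
Proof.
move=> cl; have ml := continuous_borel_measurable cl.
have l2 : mu.-integrable setT (EFin \o (fun x : borel X => l x ^+ 2)).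
  exact: gaussian_mgf_integrable_sqr (l_mgf cl).
have g2 : mu.-integrable setT (EFin \o (fun x : borel X => g x ^+ 2)).
  exact: gaussian_mgf_integrable_sqr g_mgf.
have lgi : mu.-integrable setT (EFin \o (fun x : borel X => l x * g x)).
  apply: integrable_le (integrable_add measurableT l2 g2) _ => //.
    exact: measurable_funM.
  move=> x _; rewrite ler_norml; apply/andP; split.
    have := sqr_ge0 (l x + g x); have := sqr_ge0 (l x); have := sqr_ge0 (g x); lra.
  have := sqr_ge0 (l x - g x); have := sqr_ge0 (l x); have := sqr_ge0 (g x); lra.
have -> : \int[mu]_x (l x ^+ 2) - 2 * l h + kappa = \int[mu]_x (l x - g x) ^+ 2.
  rewrite hg.2// /kappa -RintegralZl// -RintegralB//; last exact: integrable_scale.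
  rewrite -RintegralD//; last by apply: integrable_sub => //; exact: integrable_scale.
  by apply: eq_Rintegral => x _; ring.
apply: L2_dual_closure_mgf => //; have [[_ [l_ cl_ l_g]] _] := hg.
split; first exact: measurable_funB.
exists (fun n => l \- l_ n) => [n x|].
  by apply: cvgB; [exact: cl|exact: cl_].
apply: cvg_trans l_g; apply: near_eq_cvg; apply: nearW => n /=.
by apply: eq_integral => x _; congr EFin; ring.
Qed.

(* The Cameron-Martin formula for f says that defect f has integral 0. *)
Let defect (f : X -> R) u := f (u - h) - f u * r u.
Let total (f : X -> R) u := `|f (u - h)| + `|f u| * r u.

(** Integrability of every power, under the shifted law and under the law with density [r] at once.
    Unlike plain integrability it is stable under products. *)
Let all_moments (f : X -> R) := measurable_fun [set: borel X] (f : borel X -> R) /\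
  forall p, mu.-integrable [set: borel X] (EFin \o total (fun u => f u ^+ p)).

Let r_ge0 u : 0 <= r u. Proof. exact: expR_ge0. Qed.

Let total_ge0 f u : 0 <= total f u.
Proof. by rewrite addr_ge0// mulr_ge0. Qed.

Let measurable_shift (f : X -> R) : measurable_fun [set: borel X] (f : borel X -> R) ->
  measurable_fun [set: borel X] ((fun u => f (u - h)) : borel X -> R).
Proof. by move=> mf; exact: measurableT_comp mf (measurable_translation h). Qed.

Let measurable_total (f : X -> R) : measurable_fun [set: borel X] (f : borel X -> R) ->
  measurable_fun [set: borel X] (total f : borel X -> R).
Proof.
move=> mf; apply: measurable_funD.
  by apply: measurableT_comp => //; exact: measurable_shift.
by apply: measurable_funM; [exact: measurableT_comp|exact: measurable_cm_density].
Qed.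

Let measurable_defect (f : X -> R) : measurable_fun [set: borel X] (f : borel X -> R) ->
  measurable_fun [set: borel X] (defect f : borel X -> R).
Proof.
move=> mf; apply: measurable_funB; first exact: measurable_shift.
by apply: measurable_funM => //; exact: measurable_cm_density.
Qed.

Let total_le (f G : X -> R) u : (forall u, `|f u| <= G u) -> total f u <= total G u.
Proof.
move=> fG; have fG' v : `|f v| <= `|G v| by rewrite (le_trans (fG v))// ler_norm.
by rewrite lerD// ler_wpM2r.
Qed.

Let all_moments_le (f G : X -> R) : measurable_fun [set: borel X] (f : borel X -> R) ->
  all_moments G -> (forall u, `|f u| <= G u) -> all_moments f.
Proof.
move=> mf [mG iG] fG; split=> // p.
apply: integrable_le (iG p) _ => //.
  by apply: measurable_total; exact: measurable_funX.
move=> u _; rewrite ger0_norm//; apply: total_le => v.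
by rewrite normrX lerXn2r// nnegrE// (le_trans (normr_ge0 (f v))).
Qed.

Let total_add (f f' : X -> R) u : (total (fun u => `|f u| + `|f' u|) u = total f u + total f' u)%R.
Proof.
by rewrite /total !(ger0_norm (addr_ge0 _ _))//; ring.
Qed.

Let all_moments_add (f f' : X -> R) : all_moments f -> all_moments f' ->
  all_moments (fun u => f u + f' u).
Proof.
move=> [mf fi] [mf' fi']; split=> [|p]; first exact: measurable_funD.
apply: integrable_le (integrable_scale measurableT (2 ^+ p)
  (integrable_add measurableT (fi p) (fi' p))) _ => //.
  by apply: measurable_total; apply: measurable_funX; exact: measurable_funD.
move=> u _; rewrite ger0_norm//.
have key v : `|(f v + f' v) ^+ p| <= 2 ^+ p * (`|f v ^+ p| + `|f' v ^+ p|).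
  rewrite !normrX; apply: (@le_trans _ _ ((2 * Num.max `|f v| `|f' v|) ^+ p)).
    rewrite lerXn2r ?nnegrE ?mulr_ge0 ?le_max ?normr_ge0//.
    apply: (le_trans (ler_normD _ _)).
    have : `|f v| <= Num.max `|f v| `|f' v| by rewrite le_max lexx.
    have : `|f' v| <= Num.max `|f v| `|f' v| by rewrite le_max lexx orbT.
    lra.
  rewrite exprMn ler_wpM2l ?exprn_ge0//.
  by case: (leP `|f v| `|f' v|) => _; rewrite ?lerDl ?lerDr exprn_ge0.
rewrite -total_add; apply: le_trans (total_le _ key) _.
rewrite /total !normrM !(ger0_norm (exprn_ge0 p (ler0n _ 2))).
by rewrite mulrDr mulrA.
Qed.

Let all_moments_mul (f f' : X -> R) : all_moments f -> all_moments f' ->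
  all_moments (fun u => f u * f' u).
Proof.
move=> [mf fi] [mf' fi']; split=> [|p]; first exact: measurable_funM.
apply: integrable_le (integrable_add measurableT (fi (p * 2)%N) (fi' (p * 2)%N)) _ => //.
  by apply: measurable_total; apply: measurable_funX; exact: measurable_funM.
move=> u _; rewrite ger0_norm// -total_add; apply: total_le => v.
rewrite exprMn normrM !exprM !(ger0_norm (sqr_ge0 _)).
rewrite -(real_normK (num_real (f v ^+ p))) -(real_normK (num_real (f' v ^+ p))).
move: (normr_ge0 (f v ^+ p)) (normr_ge0 (f' v ^+ p)).
by move: `|_| `|_| => a b a0 b0; nra.
Qed.

Let integrable_defect f : all_moments f ->
  mu.-integrable [set: borel X] (EFin \o defect f).
Proof.
move=> [mf /(_ 1) fi]; apply: integrable_le fi _ => //; first exact: measurable_defect.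
by move=> u _; apply: (le_trans (ler_normB _ _)); rewrite normrM (ger0_norm (r_ge0 u)).
Qed.

Let all_moments_expR_norm (l : {linear X -> R}) (c : R) : 0 <= c -> continuous l ->
  all_moments (fun u => expR (c * `|l u|)).
Proof.
move=> c0 cl; have ml := continuous_borel_measurable cl.
have mexp : measurable_fun [set: borel X] ((fun u => expR (c * `|l u|)) : borel X -> R).
  by apply: measurable_expR_comp; apply: measurable_funM => //; exact: measurableT_comp.
split=> // p; apply: integrable_add => //.
  have pc0 : 0 <= p%:R * c by rewrite mulr_ge0.
  have li := integrable_expR_norm pc0 ml (fun t => gaussian_mgf_integrable t (l_mgf cl)).
  apply: integrable_le (integrable_scale measurableT (expR (p%:R * c * `|l h|)) li) _ => //.
    apply: measurableT_comp => //.
    by apply: (@measurable_shift (fun v => expR (c * `|l v|) ^+ p)); exact: measurable_funX.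
  move=> u _; rewrite normr_id ger0_norm ?exprn_ge0 ?expR_ge0//.
  rewrite -expRM_natl -expRD ler_expR -mulrDr mulrA ler_wpM2l//.
  by rewrite linearB [leRHS]addrC ler_normB.
(* The factor e^(-g) of [r] is absorbed: e^(p c |l|) r is at most e^(-kappa/2) (e^(p c l - g) +
   e^(-p c l - g)), and [lg_mgf] covers both exponents. *)
have cs (s : R) : continuous (s \*: l).
  by move=> x; exact: (@cvgMl_tmp _ _ _ _ (l : X -> R) s (l x) (cl x)).
have li (s : R) := gaussian_mgf_integrable 1 (lg_mgf (cs s)).
apply: integrable_le (integrable_scale measurableT (expR (- (kappa / 2)))
   (integrable_add measurableT (li (p%:R * c)) (li (- (p%:R * c))))) _ => //.
  apply: measurable_funM; last exact: measurable_cm_density.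
  by apply: measurableT_comp => //; exact: measurable_funX.
move=> u _; rewrite normrM normr_id (ger0_norm (r_ge0 u)).
rewrite (ger0_norm (exprn_ge0 _ (expR_ge0 _))) -expRM_natl /r /cm_density -expRD addrA expRD mulrC ler_wpM2l ?expR_ge0//.
rewrite !mul1r /= !expRD -mulrDl ler_wpM2r ?expR_ge0//.
have -> : p%:R * (c * `|l u|) = `|p%:R * c * l u|.
  by rewrite normrM (@ger0_norm _ (p%:R * c)) ?mulr_ge0// mulrA.
by apply: (le_trans (expR_norm_le _)); rewrite scaleNr.
Qed.

Let all_moments_expR (l : {linear X -> R}) : continuous l ->
  all_moments (fun u => expR (l u)).
Proof.
move=> cl; apply: all_moments_le (all_moments_expR_norm ler01 cl) _.
  by apply: measurable_expR_comp; exact: continuous_borel_measurable.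
by move=> u; rewrite ger0_norm ?expR_ge0// mul1r ler_expR ler_norm.
Qed.

Let continuous0 : continuous (\0 : X -> R).
Proof. by move=> x; exact: cvg_cst. Qed.

Let all_moments_cst c : all_moments (fun=> c).
Proof.
have cst1 : all_moments (fun=> expR `|c|).
  split=> // p; apply: eq_integrable (integrable_scale measurableT (expR `|c| ^+ p)
    ((all_moments_expR continuous0).2 1)) => //.
  move=> u _ /=; rewrite /total/= expR0 ?expr1n normr1 -expRM_natl.
  by rewrite !(ger0_norm (expR_ge0 _)); congr (_%:E); ring.
by apply: all_moments_le cst1 _ => // u; exact: le_norm_expR.
Qed.

(* Multiplication by m preserves the functions whose product with every e^l
   satisfies the Cameron-Martin formula; these m form an algebra closed under
   dominated pointwise limits. *)
Let balanced (f : X -> R) := forall l : {linear X -> R}, continuous l ->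
  \int[mu]_u defect (fun u => f u * expR (l u)) u = 0.

Let multiplier (m : X -> R) := all_moments m /\
  forall f, all_moments f -> balanced f -> balanced (fun u => m u * f u).

(** Both sides equal e^(V/2 - l h), with V the mean of l^2: on the side of [r], the cross term in
    the variance of l - g produces the shift, and kappa cancels against the normalisation. *)
Let balanced1 : balanced (fun=> 1).
Proof.
move=> l cl; have ml := continuous_borel_measurable cl.
have el : mu.-integrable setT (EFin \o (fun u : borel X => expR (- l h) * expR (l u))).
  apply: integrable_scale => //.
  have := gaussian_mgf_integrable 1 (l_mgf cl); apply: eq_integrable => // x _ /=.
  by rewrite mul1r.
have elg : mu.-integrable setT (EFin \o (fun u : borel X => expR (- (kappa / 2)) * expR (l u - g u))).
  apply: integrable_scale => //.
  have := gaussian_mgf_integrable 1 (lg_mgf cl); apply: eq_integrable => // x _ /=.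
  by rewrite mul1r.
transitivity (\int[mu]_(u in [set: borel X]) (expR (- l h) * expR (l u) - expR (- (kappa / 2)) * expR (l u - g u))).
  apply: eq_Rintegral => u _; rewrite /defect /r /cm_density !mul1r linearB -!expRD.
  by congr (expR _ - expR _); ring.
rewrite RintegralB//.
rewrite RintegralZl//; last first.
  have := gaussian_mgf_integrable 1 (l_mgf cl); apply: eq_integrable => // x _ /=.
  by rewrite mul1r.
rewrite RintegralZl//; last first.
  have := gaussian_mgf_integrable 1 (lg_mgf cl); apply: eq_integrable => // x _ /=.
  by rewrite mul1r.
have -> : \int[mu]_(u in [set: borel X]) expR (l u) = expR ((\int[mu]_x l x ^+ 2) / 2).
  have := gaussian_mgfE 1 (l_mgf cl); rewrite expr1n mul1r => <-.
  by apply: eq_Rintegral => x _; rewrite mul1r.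
have -> : \int[mu]_(u in [set: borel X]) expR (l u - g u) =
    expR ((\int[mu]_x (l x ^+ 2) - 2 * l h + kappa) / 2).
  have := gaussian_mgfE 1 (lg_mgf cl); rewrite expr1n mul1r => <-.
  by apply: eq_Rintegral => x _; rewrite mul1r.
by rewrite -!expRD; apply/eqP; rewrite subr_eq0; apply/eqP; congr expR; field.
Qed.

Let multiplier_cst c : multiplier (fun=> c).
Proof.
split=> // f af bf l cl; rewrite -[RHS](mulr0 c) -(bf _ cl) -RintegralZl//.
  by apply: eq_Rintegral => u _; rewrite /defect; ring.
by apply: integrable_defect; apply: all_moments_mul => //; exact: all_moments_expR.
Qed.

Let multiplier_add m m' : multiplier m -> multiplier m' ->
  multiplier (fun u => m u + m' u).
Proof.
move=> [am Mm] [am' Mm']; split; first exact: all_moments_add.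
move=> f af bf l cl; rewrite -[RHS](addr0 0) -{1}(Mm f af bf l cl) -(Mm' f af bf l cl).
have i n : all_moments n -> mu.-integrable setT (EFin \o defect (fun u => n u * f u * expR (l u))).
  move=> an; apply: integrable_defect; apply: all_moments_mul; last exact: all_moments_expR.
  exact: all_moments_mul.
rewrite -RintegralD//; [|exact: i|exact: i].
by apply: eq_Rintegral => u _; rewrite /defect; ring.
Qed.

Let multiplier_mul m m' : multiplier m -> multiplier m' ->
  multiplier (fun u => m u * m' u).
Proof.
move=> [am Mm] [am' Mm']; split; first exact: all_moments_mul.
move=> f af bf l cl.
rewrite -(Mm _ (all_moments_mul am' af) (Mm' f af bf) l cl).
by apply: eq_Rintegral => u _; rewrite /defect; ring.
Qed.

(** The majorant G f e^l has an integrable [total] because all moments are stable under products. *)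
Let multiplier_lim (m_ : nat -> X -> R) m G : (forall n, multiplier (m_ n)) ->
  (forall u, m_ n u @[n --> \oo] --> m u) -> all_moments G ->
  (forall n u, `|m_ n u| <= G u) -> multiplier m.
Proof.
move=> Mm_ m_m aG mG.
have mm : measurable_fun [set: borel X] (m : borel X -> R).
  by apply: (@measurable_fun_cvg _ _ _ _ (m_ : nat -> borel X -> R)) => [n|u _];
    [have [[]] := Mm_ n|exact: m_m].
have mG' u : `|m u| <= G u.
  have cv : `|m_ n u| @[n --> \oo] --> `|m u| by apply: cvg_norm; exact: m_m.
  rewrite -(cvg_lim _ cv)//.
  by apply: limr_le; [apply/cvg_ex; eexists; exact: cv|exact: nearW].
have am : all_moments m by exact: all_moments_le aG mG'.
split=> // f af bf l cl.
have ae := all_moments_expR cl.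
have aGfe := all_moments_mul (all_moments_mul aG af) ae.
pose F n := defect (fun u => m_ n u * f u * expR (l u)).
have [||||_] := @Rintegral_dominated_convergence _ (borel X) _ mu _ measurableT F
    (defect (fun u => m u * f u * expR (l u)))
    (total (fun u => (G u * f u * expR (l u)) ^+ 1)).
- by move=> n; apply: measurable_defect; have [[]] := Mm_ n;
    move=> mn _ _; apply: measurable_funM; [apply: measurable_funM => //; exact: af.1|exact: ae.1].
- move=> u _; apply: cvgB; first by apply: cvgMr_tmp; apply: cvgMr_tmp; exact: m_m.
  by apply: cvgMr_tmp; apply: cvgMr_tmp; apply: cvgMr_tmp; exact: m_m.
- exact: aGfe.2.
- move=> n u _; apply: (le_trans (ler_normB _ _)); rewrite [X in _ + X <= _]normrM (ger0_norm (r_ge0 u)).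
  have key v : `|m_ n v * f v * expR (l v)| <= `|G v * f v * expR (l v)|.
    rewrite !normrM ler_wpM2r// ler_wpM2r//.
    by apply: (le_trans (mG n v)); exact: ler_norm.
  by rewrite /total !expr1 lerD// ler_wpM2r.
move=> cv; apply: (cvg_unique _ cv) => /=; first exact: Rhausdorff.
rewrite (_ : (fun n => _) = fun=> 0); first exact: cvg_cst.
by apply/funext => n; rewrite /F; exact: (Mm_ n).2.
Qed.

(** The factor e^l merges with the test exponential into e^(l + l'); for this reason [balanced]
    quantifies over all functionals. *)
Let multiplier_expR (l : {linear X -> R}) : continuous l ->
  multiplier (fun u => expR (l u)).
Proof.
move=> cl; split; first exact: all_moments_expR.
move=> f af bf l' cl'.
have cll' : continuous (l \+ l').
  by move=> x; apply: cvgD; [exact: cl|exact: cl'].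
rewrite -(bf _ cll').
by apply: eq_Rintegral => u _; rewrite /defect /= !expRD; ring.
Qed.

Let multiplier_ext m m' : multiplier m -> m =1 m' -> multiplier m'.
Proof. by move=> + /funext mm'; rewrite mm'. Qed.

Let multiplier_exprn m n : multiplier m -> multiplier (fun u => m u ^+ n).
Proof.
move=> Mm; elim: n => [|n ih].
  by apply: multiplier_ext (multiplier_cst 1) _ => u; rewrite expr0.
by apply: multiplier_ext (multiplier_mul Mm ih) _ => u; rewrite exprS.
Qed.

(** A functional l is the derivative of e^(t l) at t = 0, taken along t = 1/(n+1). *)
Let multiplier_affine (l : {linear X -> R}) (c : R) : continuous l ->
  multiplier (fun u => l u + c).
Proof.
move=> cl; apply: multiplier_add (multiplier_cst c).
pose m_ n u := n.+1%:R * (expR (l u / n.+1%:R) - 1).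
apply: (@multiplier_lim m_ l (fun u => expR (2 * `|l u|))) => [n|u||n u].
- have cln : continuous (n.+1%:R^-1 \*: l).
    by move=> x; exact: (@cvgMl_tmp _ _ _ _ (l : X -> R) _ (l x) (cl x)).
  apply: multiplier_ext (multiplier_mul (multiplier_cst n.+1%:R)
    (multiplier_add (multiplier_expR cln) (multiplier_cst (- 1)))) _ => u.
  by rewrite /m_ /= [_ *: _]mulrC.
- by apply: cvg_scaled_expR_sub1 => //; exact: cvg_invr_nat.
- exact: all_moments_expR_norm.
- by rewrite normr_scaled_expR_sub1// ler1n.
Qed.

(** The Taylor sums of the sine are polynomials in m dominated by e^|m|, which is why this majorant
    is assumed to have all moments. *)
Let multiplier_sin m : multiplier m -> all_moments (fun u => expR `|m u|) ->
  multiplier (fun u => sin (m u)).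
Proof.
move=> Mm am; pose m_ n u := series (sin_coeff (m u)) n.
apply: (@multiplier_lim m_ _ (fun u => expR `|m u|)) => // [|u|n u].
- elim=> [|n ih].
    by apply: multiplier_ext (multiplier_cst 0) _ => u; rewrite /m_ /series/= big_geq.
  apply: multiplier_ext (multiplier_add ih (multiplier_mul
    (multiplier_cst ((odd n)%:R * (-1) ^+ n.-1./2 / n`!%:R)) (multiplier_exprn n Mm))) _.
  by move=> u; rewrite /m_ /series/= big_nat_recr//= mulrAC.
- exact: cvg_series_sin_coeff.
- exact: normr_series_sin_coeff.
Qed.

(** The sine brings m into [-1, 1], where the iterates of [cubic] stay bounded by 1 and converge to
    the sign. *)
Let multiplier_sg_sin m : multiplier m -> all_moments (fun u => expR `|m u|) ->
  multiplier (fun u => Num.sg (sin (m u))).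
Proof.
move=> Mm am; have sin1 u : `|sin (m u)| <= 1 by rewrite ler_norml sin_geN1 sin_le1.
apply: (@multiplier_lim (fun n u => iter n cubic (sin (m u))) _ (fun=> 1)) => // [|u|n u].
- elim=> [|n ih]; first exact: multiplier_sin.
  apply: multiplier_ext (multiplier_mul (multiplier_add
      (multiplier_mul (multiplier_cst 3) ih)
      (multiplier_mul (multiplier_cst (- 1)) (multiplier_exprn 3 ih)))
    (multiplier_cst 2^-1)) _ => u.
  by rewrite /= /cubic mulN1r.
- exact: cvg_iter_cubic.
- exact: normr_iter_cubic.
Qed.

Let multiplier_sg (l : {linear X -> R}) (c : R) : continuous l ->
  multiplier (fun u => Num.sg (l u + c)).
Proof.
move=> cl.
apply: (@multiplier_lim (fun n u => Num.sg (sin ((l u + c) / n.+1%:R))) _ (fun=> 1)) => // [n|u|n u].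
- have cln : continuous (n.+1%:R^-1 \*: l).
    by move=> x; exact: (@cvgMl_tmp _ _ _ _ (l : X -> R) _ (l x) (cl x)).
  have e u : (n.+1%:R^-1 \*: l) u + n.+1%:R^-1 * c = (l u + c) / n.+1%:R.
    by rewrite /= mulrDl (mulrC c) [_ *: _]mulrC.
  have Ml := multiplier_affine (n.+1%:R^-1 * c) cln.
  have am : all_moments (fun u => expR `|(n.+1%:R^-1 \*: l) u + n.+1%:R^-1 * c|).
    apply: all_moments_le (all_moments_mul (all_moments_expR_norm ler01 cln)
      (all_moments_cst (expR `|n.+1%:R^-1 * c|))) _.
      by apply: measurable_expR_comp; apply: measurableT_comp => //; case: Ml => -[].
    move=> u; rewrite ger0_norm ?expR_ge0// mul1r -expRD ler_expR.
    exact: ler_normD.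
  by apply: multiplier_ext (multiplier_sg_sin Ml am) _ => u; rewrite e.
- exact: cvg_sg_sin.
- by rewrite normr_sg; case: (_ != 0).
Qed.

Let multiplier_setC A : multiplier \1_A -> multiplier (\1_(~` A) : X -> R).
Proof.
move=> MA; apply: multiplier_ext (multiplier_add (multiplier_cst 1)
  (multiplier_mul (multiplier_cst (- 1)) MA)) _ => u.
by rewrite /= !indicE in_setC; case: (u \in A); rewrite ?mulr1 ?mulr0 ?addr0 ?subrr.
Qed.

(** Products of multipliers give finite intersections, and limits dominated by 1 give countable
    ones, so a sigma-algebra is reached directly rather than a Dynkin system. *)
Let sigma_algebra_multiplier : sigma_algebra setT [set A | multiplier \1_A].
Proof.
split => [|A MA|A MA] /=.
- by rewrite indic0; exact: multiplier_cst.
- by rewrite setTD; exact: multiplier_setC.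
rewrite -(setCK (\bigcup_k A k)); apply: multiplier_setC.
pose m_ n u : R := \prod_(k < n) \1_(~` A k) u.
apply: (@multiplier_lim m_ _ (fun=> 1)) => // [|u|n u].
- elim=> [|n ih].
    by apply: multiplier_ext (multiplier_cst 1) _ => u; rewrite /m_ big_ord0.
  apply: multiplier_ext (multiplier_mul ih (multiplier_setC (MA n))) _ => u.
  by rewrite /m_ big_ord_recr.
- apply: cvg_near_cst; rewrite setC_bigcup indicE.
  have [uA|] := pselect ((\bigcap_i ~` A i) u).
    rewrite mem_set//; apply: nearW => n; rewrite /m_ big1// => k _.
    by rewrite indicE mem_set//; exact: uA.
  move=> uA; rewrite memNset//.
  have [k uk] : exists k, A k u.
    by apply: contrapT => /forallNP nA; apply: uA => k _; exact: nA.
  near=> n; have kn : (k < n)%N by near: n; exact: nbhs_infty_gt.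
  rewrite /m_ (bigD1 (Ordinal kn))//= indicE memNset ?mul0r//.
- rewrite /m_ normr_prod; apply: prodr_ile1 => k _; rewrite normr_ge0/= indicE.
  by case: (_ \in _); rewrite ?normr1 ?normr0.
Unshelve. all: by end_near. Qed.

Let multiplier_measurable (A : set (borel X)) : measurable A -> multiplier \1_A.
Proof.
move=> mA; apply: (@smallest_sub _ (sigma_algebra setT) (@open X)
  [set A | multiplier \1_A] sigma_algebra_multiplier _ A mA).
apply: subset_trans (open_sub_halfspaces X_separable) _.
apply: smallest_sub; first exact: sigma_algebra_multiplier.
move=> _ [l [cl [c ->]]] /=.
(* The indicator of x > 0 is (s + s^2) / 2, where s is the sign of x. *)
have Ms := multiplier_sg (- c) cl.
apply: multiplier_ext (multiplier_mul (multiplier_cst 2^-1)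
  (multiplier_add Ms (multiplier_exprn 2 Ms))) _ => u.
rewrite indicE (_ : (u \in _) = (0 < l u - c)); last first.
  by rewrite subr_gt0; apply/idP/idP; rewrite inE.
have [x0|x0|->] := ltrgt0P (l u - c).
- by rewrite gtr0_sg// expr1n/=; field.
- by rewrite ltr0_sg// sqrrN expr1n addNr mulr0.
- by rewrite sgr0 expr0n addr0 mulr0.
Qed.

Lemma cameron_martin_set (A : set (borel X)) : measurable A ->
  mu [set u | A (u - h)] = (\int[mu]_(u in A) (r u)%:E)%E.
Proof.
move=> mA; have [[m1A im] bA] := multiplier_measurable mA.
have mAh : measurable ([set u | A (u - h)] : set (borel X)).
  by rewrite -[X in measurable X]setTI; exact: (measurable_translation h).
have ri : mu.-integrable setT (EFin \o (fun u : borel X => \1_A u * r u)).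
  apply: integrable_le (im 1) _ => //.
    by apply: measurable_funM => //; exact: measurable_cm_density.
  by move=> u _; rewrite normrM (ger0_norm (r_ge0 u)) /total expr1 lerDr.
have si : mu.-integrable setT (EFin \o (fun u : borel X => \1_A (u - h) : R)).
  apply: integrable_le (im 1) _ => //; first exact: measurable_shift.
  by move=> u _; rewrite /total !expr1 lerDl mulr_ge0.
(* The multiplier [\1_A] acts on the balanced function 1, tested against e^0. *)
have e0 : \int[mu]_(u in [set: borel X]) ((\1_A (u - h) : R) - \1_A u * r u) = 0.
  rewrite -(bA _ (all_moments_cst 1) balanced1 _ continuous0).
  by apply: eq_Rintegral => u _; rewrite /defect /= expR0; ring.
move: e0; rewrite RintegralB// => /eqP; rewrite subr_eq0 => /eqP e.
have e1 : (\int[mu]_(x in [set: borel X]) (\1_A (x - h)%R)%:E)%E = mu [set u | A (u - h)].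
  by rewrite -(setIT [set u | A (u - h)]) -integral_indic//.
rewrite -e1 fin_num_integral// e -fin_num_integral// [RHS]integral_mkcond.
apply: eq_integral => u _; rewrite patchE indicE.
by case: ifP => _; rewrite ?mul1r ?mul0r.
Qed.

Lemma cameron_martin_integral (F : X -> \bar R) :
  measurable_fun [set: borel X] (F : borel X -> \bar R) -> (forall u, 0 <= F u)%E ->
  (\int[mu]_u F (u - h)%R = \int[mu]_u (F u * (r u)%:E))%E.
Proof.
move=> mF F0.
pose tau : {mfun borel X >-> borel X} := HB.pack ((fun u => u - h) : borel X -> borel X)
  (isMeasurableFun.Build _ _ _ _ ((fun u => u - h) : borel X -> borel X)
    (measurable_translation h)).
rewrite -(@ge0_integral_density _ _ _ mu (pushforward mu tau))//.
- by rewrite ge0_integral_pushforward// preimage_setT.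
- exact: measurable_cm_density.
- by move=> A mA; exact: cameron_martin_set.
Qed.

End cameron_martin_theorem.

(** * Linear structure of the Cameron-Martin space *)

Section cameron_martin_space.
Context {R : realType} {X : completeNormedModType R}.
Variable mu : probability (borel X) R.
Hypothesis mug : centered_gaussian mu.
Implicit Types (h k : X) (f g : X -> R).

Let sqr_int f g : measurable_fun [set: borel X] (f : borel X -> R) ->
  measurable_fun [set: borel X] (g : borel X -> R) ->
  measurable_fun [set: borel X] ((fun u => ((f u - g u) ^+ 2)%:E) : borel X -> \bar R).
Proof.
move=> mf mg; apply/measurable_EFinP; apply: measurable_funX.
exact: measurable_funB.
Qed.

Lemma L2_dual_closure_axpy (a : R) f g : L2_dual_closure mu f -> L2_dual_closure mu g ->
  L2_dual_closure mu (fun u => a * f u + g u).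
Proof.
move=> [mf [lf clf fl]] [mg [lg clg gl]]; split.
  by apply: measurable_funD => //; exact: measurable_funM.
have ml (l : nat -> {linear X -> R}) n : (forall n, continuous (l n)) ->
    measurable_fun [set: borel X] (l n : borel X -> R).
  by move=> cl; exact: continuous_borel_measurable.
exists (fun n => (a \*: lf n) \+ lg n) => [n x|].
  by apply: cvgD; [exact: (@cvgMl_tmp _ _ _ _ (lf n : X -> R) _ (lf n x) (clf n x))|exact: clg].
pose A n := (\int[mu]_x ((f x - lf n x) ^+ 2)%:E)%E.
pose B n := (\int[mu]_x ((g x - lg n x) ^+ 2)%:E)%E.
apply: (@squeeze_cvge _ _ _ _ (cst 0%E) _ (fun n => (2 * a ^+ 2)%:E * A n + 2%:E * B n)%E).
- apply: nearW => n; rewrite integral_ge0/=; last by move=> x _; rewrite lee_fin sqr_ge0.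
  rewrite -ge0_integralZl//; last 3 first.
  + by apply: sqr_int => //; exact: ml.
  + by move=> x _; rewrite lee_fin sqr_ge0.
  + by rewrite lee_fin mulr_ge0// sqr_ge0.
  rewrite -ge0_integralZl//; last 2 first.
  + by apply: sqr_int => //; exact: ml.
  + by move=> x _; rewrite lee_fin sqr_ge0.
  rewrite -ge0_integralD//; last 4 first.
  + move=> x _; rewrite -EFinM lee_fin; apply: mulr_ge0; last exact: sqr_ge0.
    by apply: mulr_ge0 => //; exact: sqr_ge0.
  + apply: emeasurable_funM => //; apply: sqr_int => //; exact: ml.
  + by move=> x _; rewrite -EFinM lee_fin; apply: mulr_ge0; last exact: sqr_ge0.
  + apply: emeasurable_funM => //; apply: sqr_int => //; exact: ml.
  apply: ge0_le_integral => //.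
  + by move=> x _; rewrite lee_fin sqr_ge0.
  + apply/measurable_EFinP; apply: measurable_funX; apply: measurable_funB.
      by apply: measurable_funD => //; exact: measurable_funM.
    by apply: measurable_funD; [apply: measurable_funM => //|]; exact: ml.
  + apply: emeasurable_funD; apply: emeasurable_funM => //; apply: sqr_int => //; exact: ml.
  + move=> x _; rewrite lee_fin /=.
    set p := f x - _; set q := g x - _.
    have e (y z : R) : a * f x + g x - (a * y + z) = a * (f x - y) + (g x - z) by ring.
    rewrite [X in X ^+ 2](_ : _ = a * p + q); last exact: (e (lf n x) (lg n x)).
    by have := sqr_ge0 (a * p - q); nra.
- exact: cvg_cst.
rewrite -[X in _ --> X](_ : (2 * a ^+ 2)%:E * 0 + 2%:E * 0 = 0)%E; last by rewrite !mule0 adde0.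
by apply: cvgeD; [by rewrite !mule0|apply: cvgeZl|apply: cvgeZl].
Qed.

Lemma integrable_sqr_L2 g : L2_dual_closure mu g ->
  mu.-integrable [set: borel X] (EFin \o (fun u => g u ^+ 2)).
Proof. by move=> /(L2_dual_closure_mgf mug)/gaussian_mgf_integrable_sqr. Qed.

Lemma integrable_mul_L2 f g : measurable_fun [set: borel X] (f : borel X -> R) ->
  measurable_fun [set: borel X] (g : borel X -> R) ->
  mu.-integrable [set: borel X] (EFin \o (fun u => f u ^+ 2)) ->
  mu.-integrable [set: borel X] (EFin \o (fun u => g u ^+ 2)) ->
  mu.-integrable [set: borel X] (EFin \o (fun u => f u * g u)).
Proof.
move=> mf mg f2 g2; apply: integrable_le (integrable_add measurableT f2 g2) _ => //.
  exact: measurable_funM.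
move=> x _; rewrite normrM -(real_normK (num_real (f x))) -(real_normK (num_real (g x))).
by have := normr_ge0 (f x); have := normr_ge0 (g x); nra.
Qed.

Lemma integrable_sqr_dual (l : {linear X -> R}) : continuous l ->
  mu.-integrable [set: borel X] (EFin \o (fun u => l u ^+ 2)).
Proof. by move=> /(centered_gaussian_mgf mug)[v /gaussian_mgf_integrable_sqr]. Qed.

Lemma represents_axpy (a : R) h k f g : represents mu h f -> represents mu k g ->
  represents mu (a *: h + k) (fun u => a * f u + g u).
Proof.
move=> [cf hf] [cg kg]; split; first exact: L2_dual_closure_axpy.
move=> l cl; have ml := continuous_borel_measurable cl.
have l2 := integrable_sqr_dual cl.
have lfi := integrable_mul_L2 ml cf.1 l2 (integrable_sqr_L2 cf).
have lgi := integrable_mul_L2 ml cg.1 l2 (integrable_sqr_L2 cg).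
transitivity (a * l h + l k); first exact: linearP.
rewrite hf// kg// -RintegralZl// -RintegralD//; last exact: integrable_scale.
by apply: eq_Rintegral => x _; ring.
Qed.

(** The difference k represents 0, hence is orthogonal to every continuous functional. So its
    squared L^2 norm is at most the squared distance from k to each of its approximants l n, and
    these distances tend to 0. *)
Lemma represents_unique h f g : represents mu h f -> represents mu h g ->
  {ae mu, forall u : borel X, f u = g u}.
Proof.
move=> hf hg; pose k u := - 1 * g u + f u.
have [ck k0] : represents mu (-1 *: h + h) k by exact: represents_axpy.
have k2 := integrable_sqr_L2 ck.
have [mk [l cl kl]] := ck.
have le n : ((\int[mu]_x (k x) ^+ 2)%R%:E <= \int[mu]_x ((k x - l n x) ^+ 2)%:E)%E.
  have ml := continuous_borel_measurable (cl n).
  have l2 := integrable_sqr_dual (cl n).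
  have lki := integrable_mul_L2 ml mk l2 k2.
  rewrite -fin_num_integral// -[leLHS]adde0.
  have e x : (k x - l n x) ^+ 2 = k x ^+ 2 - 2 * (l n x * k x) + l n x ^+ 2 by ring.
  rewrite fin_num_integral//.
  have i1 : mu.-integrable [set: borel X] (EFin \o (fun x => (k x - l n x) ^+ 2)).
    apply: eq_integrable (integrable_add measurableT (integrable_sub measurableT k2
      (integrable_scale measurableT 2 lki)) l2) => // x _ /=.
    by rewrite e.
  rewrite fin_num_integral// adde0 lee_fin.
  under [leRHS]eq_Rintegral do rewrite e.
  rewrite RintegralD//; last by apply: integrable_sub => //; exact: integrable_scale.
  rewrite RintegralB//; last exact: integrable_scale.
  rewrite RintegralZl// -k0// scaleN1r addNr linear0 mulr0 subr0 lerDl.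
  by apply: Rintegral_ge0 => x _; exact: sqr_ge0.
have k20 : (\int[mu]_x ((k x) ^+ 2)%:E)%E = 0%E.
  apply/eqP; rewrite eq_le; apply/andP; split; last first.
    by apply: integral_ge0 => x _; rewrite lee_fin sqr_ge0.
  rewrite fin_num_integral// -(cvg_lim _ kl)//.
  by apply: lime_ge; [apply/cvg_ex; eexists; exact: kl|exact: nearW].
have : ae_eq mu setT ((fun x => ((k x) ^+ 2)%:E) : borel X -> \bar R) (cst 0%E).
  apply/ae_eq_integral_abs => //; first exact: measurable_int k2.
  rewrite -[RHS]k20; apply: eq_integral => x _ /=.
  by rewrite ger0_norm// sqr_ge0.
apply: filterS => x /(_ I) /= -[] /eqP; rewrite sqrf_eq0 /k mulN1r addrC subr_eq0.
by move=> /eqP.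
Qed.

Lemma cm_reprP h : cameron_martin mu h -> represents mu h (cm_repr mu h).
Proof. by move=> hE; exact: (xgetPex (fun=> 0)). Qed.

Lemma cameron_martin_axpy (a : R) h k : cameron_martin mu h -> cameron_martin mu k ->
  cameron_martin mu (a *: h + k).
Proof.
move=> [f hf] [g kg]; exists (fun u => a * f u + g u); exact: represents_axpy.
Qed.

(** [cm_repr] chooses its representatives at h, u and t h + u independently, so they are related
    linearly only mu-almost everywhere, by [represents_unique]; this is enough under the
    integral. *)
Lemma cm_inner_sqrD (t : R) h u : cameron_martin mu h -> cameron_martin mu u ->
  cm_inner mu (t *: h + u) (t *: h + u) =
    t ^+ 2 * cm_inner mu h h + 2 * t * cm_inner mu u h + cm_inner mu u u.
Proof.
move=> hE uE; have hr := cm_reprP hE; have ur := cm_reprP uE.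
have tr := cm_reprP (cameron_martin_axpy t hE uE).
have ar := represents_axpy t hr ur.
have h2 := integrable_sqr_L2 hr.1; have u2 := integrable_sqr_L2 ur.1.
have uh := integrable_mul_L2 ur.1.1 hr.1.1 u2 h2.
have hh := integrable_mul_L2 hr.1.1 hr.1.1 h2 h2.
have uu := integrable_mul_L2 ur.1.1 ur.1.1 u2 u2.
have i1 := integrable_scale measurableT (t ^+ 2) hh.
have i2 := integrable_scale measurableT (2 * t) uh.
have i3 := integrable_add measurableT i1 i2.
rewrite /cm_inner -(RintegralZl _ _ hh)// -(RintegralZl _ _ uh)//.
rewrite -(RintegralD _ i1 i2)// -(RintegralD _ i3 uu)//.
rewrite /Rintegral; congr fine; apply: ae_eq_integral => //.
- by apply/measurable_EFinP; apply: measurable_funM; exact: tr.1.1.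
- apply/measurable_EFinP; apply: measurable_funD; last by apply: measurable_funM; exact: ur.1.1.
  apply: measurable_funD; apply: measurable_funM => //; apply: measurable_funM;
    do ?[exact: hr.1.1|exact: ur.1.1].
apply: filterS (represents_unique tr ar) => x -> _; congr (_%:E); ring.
Qed.

End cameron_martin_space.

(** * Translation invariance of Lebesgue measure *)

Section lebesgue_translation.
Context {R : realType} {k : nat}.
Implicit Types a b c : 'rV[R]_k.

Definition box a b : set 'rV[R]_k := [set x | forall i, a 0 i <= x 0 i <= b 0 i].

Definition boxes : set (set 'rV[R]_k) := [set A | exists a b, A = box a b].

Lemma closed_box a b : closed (box a b).
Proof.
rewrite (_ : box a b = \bigcap_(i in [set: 'I_k]) ((fun x : 'rV[R]_k => x 0 i) @^-1` `[a 0 i, b 0 i])).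
  apply: closed_bigI => i _; apply: closed_comp => [x _|]; first exact: coord_continuous.
  exact: interval_closed.
by apply/seteqP; split => x xab i => [_|] /=; [rewrite in_itv/=|have := xab i I; rewrite /= in_itv].
Qed.

Lemma open_sub_boxes : @open 'rV[R]_k `<=` <<s boxes >>.
Proof.
move=> U oU; change (measurable (U : set (g_sigma_algebraType boxes))).
(* Rational centres and half-widths 1/(n+1) leave countably many boxes; those not contained in U are
   replaced by the empty set. *)
pose ctr (q : 'rV[rat]_k) : 'rV[R]_k := map_mx ratr q.
pose B (p : 'rV[rat]_k * nat) :=
  box (ctr p.1 - const_mx p.2.+1%:R^-1) (ctr p.1 + const_mx p.2.+1%:R^-1).
pose BU p := if `[< B p `<=` U >] then B p else set0.
rewrite (_ : U = \bigcup_p BU p).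
  apply: (@countable_bigcupT_measurable _ (g_sigma_algebraType boxes)).
    exact: countableP.
  move=> p; rewrite /BU; case: ifP => _; last exact: measurable0.
  by apply: sub_sigma_algebra; eexists; eexists.
apply/seteqP; split => [x Ux|x [p _]]; last first.
  by rewrite /BU; case: ifPn => // /asboolP BpU /BpU.
have /nbhs_ballP[r /= r0 xrU] : nbhs x U by exact: open_nbhs_nbhs.
have [n nr] : exists n : nat, n.+1%:R^-1 < r / 2.
  have [n _ /(_ n (leqnn n))] := near_infty_natSinv_lt (PosNum (divr_gt0 r0 (ltr0n R 2))).
  by exists n.
set e : R := n.+1%:R^-1 in nr.
have e0 : 0 < e by rewrite invr_gt0.
have ratP i : exists q : rat, (ratr q : R) \in `]x 0 i - e, x 0 i + e[%R.
  by apply: rat_in_itvoo; rewrite ltrBlDr -addrA ltrDl addr_gt0.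
have [q qP] := choice ratP.
exists (\row_i q i, n) => //; rewrite /BU; case: ifPn => [_ i|/asboolPn[]].
  by have := qP i; rewrite /= !mxE in_itv/= -/e => /andP[? ?]; apply/andP; split; lra.
move=> y yB; apply: xrU; split=> // i j; rewrite ord1 -ball_normE /=.
have := yB j; have := qP j; rewrite /= !mxE in_itv/= -/e => /andP[q1 q2] /andP[y1 y2].
by rewrite ltr_norml; apply/andP; split; lra.
Qed.

Lemma measurable_boxes : (@measurable _ (borel 'rV[R]_k)) = <<s boxes >>.
Proof.
apply/seteqP; split; apply: smallest_sub; do ?exact: smallest_sigma_algebra.
  exact: open_sub_boxes.
move=> _ [a [b ->]]; rewrite -(setCK (box a b)).
apply: (@measurableC _ (borel 'rV[R]_k)); apply: sub_sigma_algebra.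
exact/closed_openC/closed_box.
Qed.

(** The bounds may cross: a box with a_i > b_i for some i is empty, which keeps the intersection of
    disjoint boxes in the family. *)
Lemma setI_closed_boxes : setI_closed boxes.
Proof.
move=> _ _ [a [b ->]] [a' [b' ->]].
exists (\row_i Num.max (a 0 i) (a' 0 i)), (\row_i Num.min (b 0 i) (b' 0 i)).
apply/seteqP; split => x.
  move=> [xab xab'] i; rewrite !mxE ge_max le_min.
  by have /andP[-> ->] := xab i; have /andP[-> ->] := xab' i.
move=> xab; split => i; have := xab i; rewrite !mxE ge_max le_min.
  by move=> /andP[/andP[-> _] /andP[-> _]].
by move=> /andP[/andP[_ ->] /andP[_ ->]].
Qed.

Let cube (n : nat) := box (const_mx (- n%:R)) (const_mx n%:R).

Lemma normr_coord_le (x : 'rV[R]_k) i : `|x 0 i| <= `|x|.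
Proof.
rewrite [leRHS]mx_normrE.
exact: (@le_bigmax _ _ _ 0 (fun ij : 'I_1 * 'I_k => `|x ij.1 ij.2|) (0, i)).
Qed.

Lemma bounded_box (x : 'rV[R]_k) (c : R) : `|x| <= c ->
  box (const_mx (- c)) (const_mx c) x.
Proof.
by move=> xc i; rewrite !mxE -ler_norml (le_trans (normr_coord_le _ _)).
Qed.

Lemma bigcup_cube : \bigcup_n cube n = [set: 'rV[R]_k].
Proof.
apply/seteqP; split => // x _; exists (Num.truncn `|x|).+1 => //.
by apply: bounded_box; apply: ltW; exact: truncnS_gt.
Qed.

Variable lam : {measure set (borel 'rV[R]_k) -> \bar R}.
Hypothesis laml : is_lebesgue lam.

Lemma lebesgue_box_lty a b : (lam (box a b) < +oo)%E.
Proof.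
have [ab|] := pselect (forall i, a 0 i <= b 0 i); first by rewrite laml// ltry.
move=> /existsNP[i /negP]; rewrite -ltNge => ba.
rewrite (_ : box a b = set0) ?measure0//.
by apply/seteqP; split => // x /(_ i) /andP[ax xb]; have := le_trans ax xb; rewrite leNgt ba.
Qed.

Lemma lebesgue_sigma_finite : sigma_finite [set: borel 'rV[R]_k] lam.
Proof.
exists cube; first by rewrite bigcup_cube.
move=> n; split; last exact: lebesgue_box_lty.
by rewrite measurable_boxes; apply: sub_sigma_algebra; eexists; eexists.
Qed.

Lemma lebesgue_translation (c : 'rV[R]_k) (A : set (borel 'rV[R]_k)) :
  measurable A -> lam [set x | A (x - c)] = lam A.
Proof.
move=> mA; have mt : measurable_fun [set: borel 'rV[R]_k]
    ((fun u => u - c) : borel 'rV[R]_k -> borel 'rV[R]_k).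
  apply: (@continuous_borel_measurable_fun 'rV[R]_k 'rV[R]_k).
  exact: (@continuous_subr R 'rV[R]_k c).
pose tau : {mfun borel 'rV[R]_k >-> borel 'rV[R]_k} :=
  HB.pack ((fun u => u - c) : borel 'rV[R]_k -> borel 'rV[R]_k)
  (isMeasurableFun.Build _ _ _ _ ((fun u => u - c) : borel 'rV[R]_k -> borel 'rV[R]_k)
    mt).
suff : lam A = pushforward lam tau A by [].
have uniq_lam := @measure_unique _ R (borel 'rV[R]_k) boxes cube measurable_boxes
  setI_closed_boxes _ bigcup_cube lam (pushforward lam tau).
apply: uniq_lam => //.
- by move=> n; eexists; eexists.
- move=> _ [a [b ->]]; transitivity (lam (box (a + c) (b + c))); last first.
    by congr (lam _); apply/seteqP; split => x xab i; have := xab i; rewrite /= !mxE lerBrDr lerBlDr.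
  have [ab|] := pselect (forall i, a 0 i <= b 0 i).
    rewrite !laml// => [|i]; last by rewrite !mxE lerD2r.
    by congr (_%:E); apply: eq_bigr => i _; rewrite !mxE; ring.
  (* [is_lebesgue] speaks only of boxes with a <= b; when the bounds cross, the box and its
     translate are both empty. *)
  move=> /existsNP[i /negP]; rewrite -ltNge => ba.
  have e d : box (a + d) (b + d) = set0.
    apply/seteqP; split => // x /(_ i) /andP[ax xb]; have := le_trans ax xb.
    by rewrite !mxE lerD2r leNgt ba.
  by rewrite e -[a]addr0 -[b]addr0 e.
- by move=> n; exact: lebesgue_box_lty.
Qed.

End lebesgue_translation.

(** * Translation of the product of Gaussian and Lebesgue measure *)

Section product_translation.
Context {R : realType} {X : completeNormedModType R} {k : nat}.
Let W := (X * 'rV[R]_k)%type.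
Let mW := (borel X * borel 'rV[R]_k)%type.
Variable mu0 : probability (borel X) R.
Hypotheses (X_separable : separable_space X) (mu0_gaussian : centered_gaussian mu0).
Variable lam : {sigma_finite_measure set (borel 'rV[R]_k) -> \bar R}.
Hypothesis lam_lebesgue : is_lebesgue lam.

Lemma measurable_vector_translation (b : 'rV[R]_k) :
  measurable_fun [set: borel 'rV[R]_k]
    ((fun a => a - b) : borel 'rV[R]_k -> borel 'rV[R]_k).
Proof.
apply: (@continuous_borel_measurable_fun 'rV[R]_k 'rV[R]_k).
exact: (@continuous_subr R 'rV[R]_k b).
Qed.

Lemma measurable_pair_translation (z : W) :
  measurable_fun [set: mW] ((fun w => (w.1 - z.1, w.2 - z.2)) : mW -> mW).
Proof.
apply: measurable_fun_pair.
  by apply: (measurableT_comp (measurable_translation z.1)); exact: measurable_fst.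
by apply: (measurableT_comp (measurable_vector_translation z.2)); exact: measurable_snd.
Qed.

Lemma lebesgue_translation_integral (b : 'rV[R]_k) (F : 'rV[R]_k -> \bar R) :
  measurable_fun [set: borel 'rV[R]_k] (F : borel 'rV[R]_k -> \bar R) ->
  (forall a, 0 <= F a)%E -> (\int[lam]_a F (a - b)%R = \int[lam]_a F a)%E.
Proof.
move=> mF F0; have mt := measurable_vector_translation b.
pose tau : {mfun borel 'rV[R]_k >-> borel 'rV[R]_k} :=
  HB.pack ((fun u => u - b) : borel 'rV[R]_k -> borel 'rV[R]_k)
  (isMeasurableFun.Build _ _ _ _ ((fun u => u - b) : borel 'rV[R]_k -> borel 'rV[R]_k) mt).
transitivity (\int[pushforward lam tau]_a F a)%E.
  by rewrite ge0_integral_pushforward.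
apply: (@eq_measure_integral _ _ _ setT lam (pushforward lam tau)) => A mA _.
exact: (lebesgue_translation lam_lebesgue b mA).
Qed.

Lemma product_translation_integral (h : X) (g : X -> R) (b : 'rV[R]_k) (F : W -> \bar R) :
  represents mu0 h g ->
  measurable_fun [set: mW] (F : mW -> \bar R) -> (forall w, 0 <= F w)%E ->
  (\int[mu0 \x lam]_w F (w.1 - h, w.2 - b)%R =
   \int[mu0 \x lam]_w (F w * (cm_density mu0 g w.1)%:E))%E.
Proof.
move=> hg mF F0.
have mr : measurable_fun [set: mW] (fun w : mW => (cm_density mu0 g w.1)%:E).
  apply/measurable_EFinP; apply: (measurableT_comp (measurable_cm_density hg)).
  exact: measurable_fst.
have r0 u : (0 <= (cm_density mu0 g u)%:E)%E by rewrite lee_fin expR_ge0.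
have mF2 u : measurable_fun [set: borel 'rV[R]_k] (fun a : borel 'rV[R]_k => F (u, a)).
  by apply: (measurableT_comp mF); exact: measurable_pair1.
pose G (u : X) := (\int[lam]_a F (u, a))%E.
rewrite fubini_tonelli1//; last first.
  exact: (measurableT_comp mF (measurable_pair_translation (h, b))).
rewrite fubini_tonelli1//; last 2 first.
- exact: emeasurable_funM.
- by move=> w; rewrite mule_ge0.
rewrite /fubini_F /=.
transitivity (\int[mu0]_u G (u - h)%R)%E.
  apply: eq_integral => u _.
  by rewrite (@lebesgue_translation_integral b (fun a => F (u - h, a))%R).
rewrite (cameron_martin_integral X_separable mu0_gaussian hg)//.
- by apply: eq_integral => u _; rewrite ge0_integralZr.
- exact: measurable_fun_fubini_tonelli_F.
- by move=> u; exact: integral_ge0.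
Qed.

Variable nu0 : probability (borel 'rV[R]_k) R.
Variable rho : 'rV[R]_k -> R.
Hypothesis rho_ge0 : forall a, 0 <= rho a.
Hypothesis mrho : measurable_fun [set: borel 'rV[R]_k] (rho : borel 'rV[R]_k -> R).
Hypothesis rho_density : forall B : set (borel 'rV[R]_k), measurable B ->
    nu0 B = (\int[lam]_(a in B) (rho a)%:E)%E.

Lemma product_density_integral (F : W -> \bar R) :
  measurable_fun [set: mW] (F : mW -> \bar R) -> (forall w, 0 <= F w)%E ->
  (\int[mu0 \x nu0]_w F w = \int[mu0 \x lam]_w (F w * (rho w.2)%:E))%E.
Proof.
move=> mF F0.
have mr : measurable_fun [set: mW] (fun w : mW => (rho w.2)%:E).
  by apply/measurable_EFinP; apply: (measurableT_comp mrho); exact: measurable_snd.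
have mF2 u : measurable_fun [set: borel 'rV[R]_k] (fun a : borel 'rV[R]_k => F (u, a)).
  by apply: (measurableT_comp mF); exact: measurable_pair1.
rewrite fubini_tonelli1// fubini_tonelli1//; last 2 first.
- exact: emeasurable_funM.
- by move=> w; rewrite mule_ge0// lee_fin.
apply: eq_integral => u _; rewrite /fubini_F /=.
exact: (ge0_integral_density mrho rho_ge0 rho_density).
Qed.

End product_translation.

(** * Translates of sets and difference quotients of measures *)

Section translate.
Context {R : realType} {X : completeNormedModType R} {k : nat}.
Let W := (X * 'rV[R]_k)%type.
Let mW := (borel X * borel 'rV[R]_k)%type.
Implicit Types (A : set W) (z w : W).

Lemma translateE A z : translate A z = [set w | A (w - z)].
Proof.
apply/seteqP; split => [_ [w Aw <-]|w Aw] /=; first by rewrite addrK.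
by exists (w - z); rewrite ?subrK.
Qed.

Lemma measurable_translate A z : measurable (A : set mW) ->
  measurable (translate A z : set mW).
Proof.
move=> mA; rewrite translateE -[X in measurable X]setTI.
exact: (measurable_pair_translation z).
Qed.

Lemma translate_setU A B z : translate (A `|` B) z = translate A z `|` translate B z.
Proof. by rewrite !translateE; apply/seteqP; split => w. Qed.

Lemma translate_setI0 A B z : A `&` B = set0 -> translate A z `&` translate B z = set0.
Proof.
move=> AB; rewrite !translateE; apply/seteqP; split => // w [Aw Bw].
by have : (A `&` B) (w - z) by []; rewrite AB.
Qed.

Variable (P : probability mW R).

Lemma fine_probability_setU A B : measurable (A : set mW) -> measurable (B : set mW) ->
  A `&` B = set0 -> fine (P (A `|` B)) = fine (P A) + fine (P B).
Proof.
by move=> mA mB AB; rewrite (measureU P mA mB AB) fineD ?fin_num_measure.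
Qed.

Lemma fomin_quotient_setU A B z t : measurable (A : set mW) -> measurable (B : set mW) ->
  A `&` B = set0 -> fomin_quotient P z (A `|` B) t =
    fomin_quotient P z A t + fomin_quotient P z B t.
Proof.
move=> mA mB AB; rewrite /fomin_quotient translate_setU !fine_probability_setU//.
- by rewrite -mulrDl; congr (_ / _); ring.
- exact: measurable_translate.
- exact: measurable_translate.
- exact: translate_setI0.
Qed.

(* A null set N minimises t |-> P (N + t z) at t = 0, so that the derivative of
   this function vanishes there if it exists. *)
Lemma fomin_quotient_null (N : set W) z (l : R) : measurable (N : set mW) -> P N = 0%E ->
  fomin_quotient P z (~` N) t @[t --> (0 : R)^'] --> l ->
  forall A, measurable (A : set mW) -> A `<=` N ->
    fomin_quotient P z A t @[t --> (0 : R)^'] --> (0 : R).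
Proof.
move=> mN PN0 ql A mA AN.
have mNC : measurable (~` N : set mW) by exact: measurableC.
(* Total mass is invariant under translation, so the quotients of N and of its complement cancel;
   the limit assumed on the complement yields one on N. *)
have qE t : fomin_quotient P z (~` N) t = - fomin_quotient P z N t.
  apply/eqP; rewrite -addr_eq0 addrC -fomin_quotient_setU ?setICr// setUv.
  rewrite /fomin_quotient translateE (_ : [set w | _] = setT) ?subrr ?mul0r//.
have qN t : fomin_quotient P z N t = fine (P (translate N (t *: z))) / t.
  by rewrite /fomin_quotient PN0 subr0.
have Nge0 t : 0 <= fine (P (translate N (t *: z))) by exact: fine_ge0.
have qNl : fomin_quotient P z N t @[t --> (0 : R)^'] --> - l.
  rewrite (_ : fomin_quotient P z N = - fomin_quotient P z (~` N)); first exact: cvgN.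
  by apply/funext => t; rewrite /GRing.opp /= qE opprK.
(* The quotients of N are nonnegative for t > 0 and nonpositive for t < 0, so the sequences 1/(n+1)
   and -1/(n+1) squeeze the limit to 0. *)
have l0 : l = 0.
  have /cvgr_dnbhsP seq := qNl.
  have c0 : (n.+1%:R^-1 : R) @[n --> \oo] --> 0 by exact: cvg_invr_nat.
  have c0' : (- n.+1%:R^-1 : R) @[n --> \oo] --> 0.
    by rewrite -[X in _ --> X]oppr0; apply: cvgN.
  apply/eqP; rewrite eq_le; apply/andP; split.
    have h : fomin_quotient P z N n.+1%:R^-1 @[n --> \oo] --> - l.
      by apply: seq; split => // n; rewrite gt_eqF// invr_gt0.
    rewrite -oppr_ge0 -(cvg_lim _ h)//; apply: limr_ge; first by apply/cvg_ex; exists (- l).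
    by apply: nearW => n; rewrite qN divr_ge0// invr_ge0.
  have h : fomin_quotient P z N (- n.+1%:R^-1) @[n --> \oo] --> - l.
    by apply: seq; split => // n; rewrite oppr_eq0 gt_eqF// invr_gt0.
  rewrite -oppr_le0 -(cvg_lim _ h)//; apply: limr_le; first by apply/cvg_ex; exists (- l).
  by apply: nearW => n; rewrite qN mulr_ge0_le0// invr_le0 oppr_le0 invr_ge0.
rewrite l0 oppr0 in qNl.
have PA0 : P A = 0%E.
  by apply/eqP; rewrite eq_le measure_ge0 andbT -PN0 le_measure ?inE.
have qA t : `|fomin_quotient P z A t| <= `|fomin_quotient P z N t|.
  rewrite qN /fomin_quotient PA0 subr0 !normrM ler_wpM2r//.
  have mT B : measurable (B : set mW) -> measurable (translate B (t *: z) : set mW).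
    by move=> mB; exact: measurable_translate.
  rewrite (ger0_norm (Nge0 t)) ger0_norm ?fine_ge0//.
  apply: fine_le; [apply: fin_num_measure; exact: mT|apply: fin_num_measure; exact: mT|].
  apply: le_measure; rewrite ?inE; [exact: mT|exact: mT|].
  by rewrite !translateE => w; exact: AN.
apply/cvgr0Pnorm_le => e e0.
have /cvgr0Pnorm_le/(_ e e0) := qNl.
by apply: filterS => t; exact: le_trans.
Qed.

End translate.

(** * Fomin derivative of a measure with a Lipschitz density *)

Lemma is_derive_cvg (R : realType) (V : normedModType R) (F : V -> R) (x v : V) (df : R) :
  is_derive x v F df -> (F (x + t *: v) - F x) / t @[t --> (0 : R)^'] --> df.
Proof.
move=> [dF <-]; apply: cvg_trans dF; apply: near_eq_cvg; apply: nearW => t /=.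
by rewrite (addrC (t *: v)) [LHS]mulrC.
Qed.

Section fomin_density.
Context {R : realType} {X : completeNormedModType R} {k : nat}.
Let W := (X * 'rV[R]_k)%type.
Let mW := (borel X * borel 'rV[R]_k)%type.
Variable mu0 : probability (borel X) R.
Hypotheses (X_separable : separable_space X) (mu0_gaussian : centered_gaussian mu0).
Variable lam : {sigma_finite_measure set (borel 'rV[R]_k) -> \bar R}.
Hypothesis lam_lebesgue : is_lebesgue lam.
Let m := (mu0 \x lam)%E.

Variables (P : probability mW R) (f : W -> R).
Hypotheses (mf : measurable_fun [set: mW] (f : mW -> R)) (f0 : forall w, 0 <= f w).
Hypothesis Pf : forall A : set mW, measurable A -> P A = (\int[m]_(w in A) (f w)%:E)%E.
Variables (h : X) (g : X -> R) (b : 'rV[R]_k).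
Hypothesis hg : represents mu0 h g.
Let z : W := (h, b).
Let kappa := \int[mu0]_x g x ^+ 2.
Let r (t : R) (u : X) := expR (- (t * g u) - t ^+ 2 * kappa / 2).

Let mg : measurable_fun [set: borel X] (g : borel X -> R).
Proof. by have [[]] := hg. Qed.

Let kappa0 : 0 <= kappa.
Proof. by apply: Rintegral_ge0 => x _; exact: sqr_ge0. Qed.

(** Scaling is [represents_axpy] with the second vector (-1) h + h = 0. *)
Let represents_scale t : represents mu0 (t *: h) (fun u => t * g u).
Proof.
have := represents_axpy mu0_gaussian t hg (represents_axpy mu0_gaussian (- 1) hg hg).
rewrite scaleN1r addNr addr0.
by congr represents; apply/funext => u; rewrite mulN1r addNr addr0.
Qed.

Let cm_densityE t u : cm_density mu0 (fun u => t * g u) u = r t u.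
Proof.
rewrite /cm_density /r; congr (expR (_ - _ / 2)).
under eq_Rintegral do rewrite exprMn.
by rewrite RintegralZl//; apply: integrable_sqr_L2 => //; case: hg.
Qed.

Let measurable_r t : measurable_fun [set: mW] (fun w : mW => r t w.1).
Proof.
have /= := measurable_cm_density (represents_scale t).
rewrite (_ : cm_density mu0 _ = r t); last by apply/funext => u; exact: cm_densityE.
by move=> mr; apply: (measurableT_comp mr); exact: measurable_fst.
Qed.

Let measurable_ft t : measurable_fun [set: mW] ((fun w => f (w + t *: z)) : mW -> R).
Proof.
have := measurableT_comp mf (measurable_pair_translation (- (t *: z))).
by congr measurable_fun; apply/funext => w; congr f; rewrite /= !opprK.
Qed.

Let translate_integral t (A : set mW) : measurable A ->
  P (translate A (t *: z)) = (\int[m]_(w in A) (f (w + t *: z) * r t w.1)%:E)%E.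
Proof.
move=> mA; rewrite Pf; last exact: measurable_translate.
pose F w := (((fun w => (f (w + t *: z))%:E) \_ A) w)%E.
have mF : measurable_fun [set: mW] (F : mW -> \bar R).
  apply/(measurable_restrictT (fun w : mW => (f (w + t *: z))%:E)) => //.
  by apply: measurable_funTS; apply/measurable_EFinP; exact: measurable_ft.
have F0 w : (0 <= F w)%E by apply: erestrict_ge0 => y _; rewrite lee_fin.
have := product_translation_integral X_separable mu0_gaussian lam_lebesgue
  (t *: b) (represents_scale t) mF F0.
rewrite [X in _ = X -> _](_ : _ = \int[m]_(w in A) (f (w + t *: z) * r t w.1)%:E)%E; last first.
  rewrite [RHS]integral_mkcond; apply: eq_integral => w _.
  by rewrite /F !patchE cm_densityE; case: ifP => _; rewrite ?mul0e.
move=> <-; rewrite [LHS]integral_mkcond translateE; apply: eq_integral => w _.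
rewrite /F !patchE; have -> : (w.1 - t *: h, w.2 - t *: b) = w - t *: z by [].
by rewrite subrK; congr (if _ then _ else _).
Qed.

Let fine_translate t (A : set mW) : measurable A ->
  m.-integrable A (EFin \o (fun w => f (w + t *: z) * r t w.1)).
Proof.
move=> mA; apply: ge0_lty_integrable => //.
- apply: measurable_funTS; apply: measurable_funM; [exact: measurable_ft|exact: measurable_r].
- by move=> w _; rewrite mulr_ge0// expR_ge0.
- by rewrite -translate_integral// -ge0_fin_numE ?fin_num_measure//; exact: measurable_translate.
Qed.

Let integrable_f (A : set mW) : measurable A -> m.-integrable A (EFin \o f).
Proof.
move=> mA; apply: ge0_lty_integrable => //; first exact: measurable_funTS.
by rewrite -Pf// -ge0_fin_numE// fin_num_measure.
Qed.

Let fomin_quotientE t (A : set mW) : measurable A -> fomin_quotient P z A t =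
  \int[m]_(w in A) (((f (w + t *: z) * r t w.1) - f w) / t).
Proof.
move=> mA; rewrite /fomin_quotient translate_integral// Pf//.
rewrite RintegralZr//; last first.
  by apply: integrable_sub => //; [exact: fine_translate|exact: integrable_f].
by rewrite RintegralB//; [exact: fine_translate|exact: integrable_f].
Qed.

Variables (D : set W) (S : set 'rV[R]_k) (q : W -> R) (delta L : R).
Hypotheses (mD : measurable (D : set mW)) (mS : measurable (S : set (borel 'rV[R]_k))).
Hypotheses (lamS : (lam S < +oo)%E) (DS : forall w, D w -> S w.2).
Hypothesis delta0 : 0 < delta.
Hypothesis f_lip : forall w t, D w -> `|t| < delta -> `|f (w + t *: z) - f w| <= L * `|t|.
Hypothesis f_bnd : forall w, D w -> 0 < f w <= L.
Hypothesis f_der : forall w, D w -> (f (w + t *: z) - f w) / t @[t --> (0 : R)^'] --> f w * q w.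

(** The majorant of the difference quotients. The increment of f r splits into (f(w + t z) - f w) r
    and f w (r - 1); after division by t, each contributes at most L e^(kappa + 2 |g|), since L is
    both a Lipschitz constant and a bound for f. *)
Let G (w : W) := 2 * L * expR (kappa + 2 * `|g w.1|).

(** D lies over S, whose Lebesgue measure is finite, so Tonelli's theorem reduces the claim to an
    exponential moment of the Gaussian variable [g]. *)
Let integrable_G : m.-integrable D (EFin \o G).
Proof.
have g_mgf := L2_dual_closure_mgf mu0_gaussian hg.1.
have ei := integrable_expR_norm (ler0n R 2) mg (fun t => gaussian_mgf_integrable t g_mgf).
have mE : measurable_fun [set: mW] (fun w : mW => expR (2 * `|g w.1|)).
  apply: measurable_expR_comp; apply: measurable_funM => //; apply: measurableT_comp => //.
  by apply: (measurableT_comp mg); exact: measurable_fst.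
have mE1 : measurable_fun [set: borel X] (fun u : borel X => (expR (2 * `|g u|))%:E).
  apply/measurable_EFinP; apply: measurable_expR_comp; apply: measurable_funM => //.
  exact: measurableT_comp.
suff Ei : m.-integrable D (EFin \o (fun w => expR (2 * `|g w.1|))).
  have := integrable_scale mD (2 * L * expR kappa) Ei; apply: eq_integrable => // w _ /=.
  by rewrite /G expRD mulrA.
apply: ge0_lty_integrable => //; first exact: measurable_funTS.
have mS' : measurable ([set w | S w.2] : set mW).
  by rewrite -[X in measurable X]setTI; exact: measurable_snd.
apply: (@le_lt_trans _ _ (\int[m]_(w in [set w | S w.2]) (expR (2 * `|g w.1|))%:E)%E).
  apply: ge0_subset_integral => //.
  by apply: measurable_funTS; exact/measurable_EFinP.
rewrite integral_mkcond fubini_tonelli1//; last 2 first.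
- apply/(measurable_restrictT (fun w : mW => (expR (2 * `|g w.1|))%:E)) => //.
  by apply: measurable_funTS; exact/measurable_EFinP.
- by move=> w; apply: erestrict_ge0 => y _; rewrite lee_fin expR_ge0.
rewrite /fubini_F (_ : (fun u => _) = (fun u => (expR (2 * `|g u|))%:E * lam S)%E); last first.
  apply/funext => u; rewrite -[X in (_ * lam X)%E](setIT S) -(integral_indic lam measurableT mS) -ge0_integralZl//.
  + apply: eq_integral => a _; rewrite patchE indicE.
    rewrite [X in if X then _ else _](_ : _ = (a \in S)); last first.
      by apply/idP/idP => /set_mem aS; exact/mem_set.
    by case: ifP => _; rewrite ?mule1 ?mule0.
  + by apply/measurable_EFinP; exact: measurable_indic.
rewrite ge0_integralZr//.
by rewrite fin_num_integral// lte_mul_pinfty// lee_fin; apply: Rintegral_ge0 => u _; rewrite expR_ge0.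
Qed.

Let L0 w : D w -> 0 <= L.
Proof. by move=> /f_bnd /andP[/ltW fw]; exact: le_trans. Qed.

Let quotient_bound t w : D w -> t != 0 -> `|t| < Num.min delta 1 ->
  `|((f (w + t *: z) * r t w.1) - f w) / t| <= G w.
Proof.
move=> Dw t0; rewrite lt_min => /andP[td t1].
have at0 : 0 < `|t| by rewrite normr_gt0.
set a := `|g w.1|; pose y := - (t * g w.1) - t ^+ 2 * kappa / 2.
have a0 : 0 <= a by exact: normr_ge0.
(* The condition |t| < 1 replaces t^2 by |t|. *)
have yt : `|y| <= `|t| * (a + kappa / 2).
  rewrite /y (le_trans (ler_normB _ _))// normrN normrM mulrDr lerD2l.
  have k2 : 0 <= kappa / 2 by rewrite divr_ge0.
  rewrite -mulrA (ger0_norm (mulr_ge0 (sqr_ge0 t) k2)) -(real_normK (num_real t)).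
  by rewrite ler_wpM2r// expr2 ler_piMl// ltW.
have ya : `|y| <= a + kappa / 2.
  by apply: (le_trans yt); rewrite ler_piMl ?(ltW t1)// addr_ge0// divr_ge0.
have -> : (f (w + t *: z) * r t w.1 - f w) / t =
    (f (w + t *: z) - f w) / t * r t w.1 + f w * ((expR y - 1) / t).
  by rewrite /r -/y; field.
apply: (le_trans (ler_normD _ _)); rewrite !normrM normfV (ger0_norm (expR_ge0 _)).
have h1 : `|f (w + t *: z) - f w| / `|t| <= L by rewrite ler_pdivrMr// f_lip.
have h2 : expR y <= expR (kappa + 2 * a).
  rewrite ler_expR; apply: (le_trans (ler_norm _)); apply: (le_trans ya).
  by have := kappa0; move: kappa a0 => K a0 K0; lra.
(* With c = |g| + kappa / 2 and |y| <= |t| c, the numerator is at most |t| c e^c; then c <= e^c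
   gives e^(2 c). *)
have h3 : `|expR y - 1| / `|t| <= expR (kappa + 2 * a).
  rewrite ler_pdivrMr//; apply: (le_trans (normr_expR_sub1 y)).
  have e : expR (kappa + 2 * a) = expR (a + kappa / 2) * expR (a + kappa / 2).
    by rewrite -expRD; congr expR; field.
  rewrite e; set c := a + kappa / 2.
  have c0 : 0 <= c by rewrite addr_ge0// divr_ge0.
  have cc : c <= expR c by apply: le_trans (expR_ge1Dx c); rewrite lerDr.
  apply: (@le_trans _ _ ((`|t| * c) * expR c)).
    by rewrite ler_pM ?expR_ge0// ler_expR.
  by rewrite (mulrC `|t|) mulrAC ler_wpM2r// ler_wpM2r ?expR_ge0.
have /andP[fw fL] := f_bnd Dw; have LL := L0 Dw.
rewrite (ger0_norm (ltW fw)) /G mulrDl mul1r mulrDl.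
by rewrite lerD// ler_pM ?expR_ge0// divr_ge0.
Qed.

Let r_der u : (r t u - 1) / t @[t --> (0 : R)^'] --> - g u.
Proof.
have dy : is_derive (0 : R) 1 (fun t => - (t * g u) - t ^+ 2 * kappa / 2) (- g u).
  apply: is_derive_eq.
  by rewrite !scaler0 ?scale0r ?mul0r ?add0r ?addr0 /GRing.scale/=; ring.
have := is_derive_cvg (is_derive1_comp (is_derive_expR _) dy).
rewrite expr0n !mul0r oppr0 addr0 expR0 mul1r; apply: cvg_trans.
apply: near_eq_cvg; apply: nearW => t /=.
by rewrite /r mul0r expr0n !mul0r oppr0 addr0 expR0 add0r [_ *: _]mulr1.
Qed.

Let quotient_seq_cvg (t_ : nat -> R) (A : set W) : measurable (A : set mW) -> A `<=` D ->
  (forall n, t_ n != 0) -> (forall n, `|t_ n| < Num.min delta 1) -> t_ n @[n --> \oo] --> 0 ->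
  m.-integrable A (EFin \o (fun w => (q w - g w.1) * f w)) /\
  \int[m]_(w in A) ((f (w + t_ n *: z) * r (t_ n) w.1 - f w) / t_ n) @[n --> \oo] -->
  \int[m]_(w in A) ((q w - g w.1) * f w).
Proof.
move=> mA AD t0 td tl.
have dct := @Rintegral_dominated_convergence _ mW R m A mA
  (fun n w => (f (w + t_ n *: z) * r (t_ n) w.1 - f w) / t_ n)
  (fun w => (q w - g w.1) * f w) G.
apply: dct => [n|w Aw||n w Aw].
- apply: measurable_funTS; apply: measurable_funM => //; apply: measurable_funB => //.
  by apply: measurable_funM; [exact: measurable_ft|exact: measurable_r].
- have /cvgr_dnbhsP/(_ t_ (conj t0 tl)) rl := @r_der w.1.
  have /cvgr_dnbhsP/(_ t_ (conj t0 tl)) fl := f_der (AD _ Aw).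
  have r1 : r (t_ n) w.1 @[n --> \oo] --> (1 : R).
    have -> : (fun n => r (t_ n) w.1) = (fun n => t_ n * ((r (t_ n) w.1 - 1) / t_ n) + 1).
      by apply/funext => n; rewrite mulrC divfK// subrK.
    rewrite -[X in _ --> X]add0r -[X in _ --> X + _](mul0r (- g w.1)).
    by apply: cvgD; [exact: cvgM|exact: cvg_cst].
  have -> : (fun n => (f (w + t_ n *: z) * r (t_ n) w.1 - f w) / t_ n) =
      (fun n => (f (w + t_ n *: z) - f w) / t_ n * r (t_ n) w.1 +
        f w * ((r (t_ n) w.1 - 1) / t_ n)).
    by apply/funext => n; field.
  have -> : (q w - g w.1) * f w = f w * q w * 1 + f w * (- g w.1) by ring.
  by apply: cvgD; [exact: cvgM|apply: cvgM => //; exact: cvg_cst].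
- exact: integrableS integrable_G.
- by apply: quotient_bound => //; exact: AD.
Qed.

Let dm0 : 0 < Num.min delta 1.
Proof. by rewrite lt_min delta0 ltr01. Qed.

(** f q is a pointwise limit of measurable difference quotients, and f > 0 on D allows a division by
    f, written as multiplication by e^(- ln f). *)
Let measurable_q : measurable_fun (D : set mW) (q : mW -> R).
Proof.
have fq : measurable_fun (D : set mW) (fun w : mW => f w * q w).
  apply: (@measurable_fun_cvg _ _ _ _
      (fun n (w : mW) => (f (w + n.+1%:R^-1 *: z) - f w) / n.+1%:R^-1)).
    move=> n; apply: measurable_funTS; apply: measurable_funM => //.
    by apply: measurable_funB => //; exact: measurable_ft.
  move=> w Dw; have /cvgr_dnbhsP := f_der Dw; apply; split; last exact: cvg_invr_nat.
  by move=> n; rewrite gt_eqF// invr_gt0.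
have : measurable_fun (D : set mW) (fun w : mW => f w * q w * expR (- ln (f w))).
  apply: measurable_funM => //; apply: measurable_funTS; apply: measurable_expR_comp.
  by apply: measurableT_comp => //; apply: measurableT_comp => //; exact: measurable_ln.
apply: eq_measurable_fun => w /[!inE] Dw.
have /andP[fw _] := f_bnd Dw.
by rewrite expRN lnK ?posrE// mulrAC mulfV ?gt_eqF// mul1r.
Qed.

Let integrable_qf : m.-integrable D (EFin \o (fun w => (q w - g w.1) * f w)).
Proof.
pose t_ (n : nat) : R := (Num.min delta 1 / 2) / n.+1%:R.
have t0 n : 0 < t_ n by rewrite !divr_gt0.
have [] // := @quotient_seq_cvg t_ D mD.
- by move=> n; rewrite gt_eqF.
- move=> n; rewrite gtr0_norm//; apply: (@le_lt_trans _ _ (Num.min delta 1 / 2)).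
    by rewrite ler_pdivrMr// ler_peMr ?ler1n// ltW// divr_gt0.
  by rewrite ltr_pdivrMr// ltr_pMr// ltr1n.
- by rewrite -[X in _ --> X](mulr0 (Num.min delta 1 / 2)); apply: cvgMr; exact: cvg_invr_nat.
Qed.

Let measurable_gamma : measurable_fun (D : set mW) ((fun w => q w - g w.1) : mW -> R).
Proof.
apply: measurable_funB => //; apply: measurable_funTS.
by apply: (measurableT_comp mg); exact: measurable_fst.
Qed.

Lemma fomin_density_cvg : 
  P.-integrable D (EFin \o (fun w => q w - g w.1)) /\
  forall A, measurable (A : set mW) -> A `<=` D ->
    fomin_quotient P z A t @[t --> (0 : R)^'] --> \int[P]_(w in A) (q w - g w.1).
Proof.
have dens A : measurable (A : set mW) -> A `<=` D ->
    P.-integrable A (EFin \o (fun w => q w - g w.1)) /\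
    \int[P]_(w in A) (q w - g w.1) = \int[m]_(w in A) ((q w - g w.1) * f w).
  move=> mA AD; have [] := integral_density mf f0 Pf mA
    (measurable_funS mD AD measurable_gamma) (integrableS mD mA AD integrable_qf).
  by move=> Pi e; split => //; rewrite /Rintegral e.
split; first exact: (dens D mD (@subset_refl _ D)).1.
move=> A mA AD; apply/cvgr_dnbhsP => t_ [t0 tl].
have [N _ Nt] : \forall n \near \oo, `|t_ n| < Num.min delta 1.
  by move/cvgr0Pnorm_lt : tl; apply.
have tl' : t_ (n + N)%N @[n --> \oo] --> 0 by rewrite (cvg_shiftn N).
rewrite (dens A mA AD).2 -(cvg_shiftn N).
have [] := @quotient_seq_cvg (fun n => t_ (n + N)%N) A mA AD _ _ tl'.
- by move=> n; exact: t0.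
- by move=> n; apply: Nt; rewrite /= leq_addl.
move=> _; apply: cvg_trans; apply: near_eq_cvg; apply: nearW => n /=.
by rewrite fomin_quotientE.
Qed.

End fomin_density.

(** * Estimates along lines *)

Section line_calculus.
Context {R : realType}.

Lemma is_derive_line (V : normedModType R) (F : V -> R) (x v : V) (t d : R) :
  is_derive (x + t *: v) v F d -> is_derive t 1 (fun s => F (x + s *: v)) d.
Proof.
move=> [dF dE].
have e : (fun h : R => h^-1 *: (((fun s => F (x + s *: v)) \o shift t) (h *: 1) - F (x + t *: v))) =
    (fun h => h^-1 *: ((F \o shift (x + t *: v)) (h *: v) - F (x + t *: v))).
  apply/funext => h /=; congr (_ *: (F _ - _)).
  by rewrite [h *: 1]mulr1 scalerDl addrCA.
by split; [rewrite /derivable e|rewrite /derive e].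
Qed.

Lemma mvt_bound (phi : R -> R) (x y K : R) : 0 <= K ->
  (forall s, Num.min x y < s < Num.max x y -> exists2 d, is_derive s 1 phi d & `|d| <= K) ->
  (forall s, Num.min x y <= s <= Num.max x y -> {for s, continuous phi}) ->
  `|phi y - phi x| <= K * `|y - x|.
Proof.
move=> K0; wlog xy : x y / x <= y => [wl|].
  have /orP[xy|yx] := le_total x y; first exact: wl.
  by rewrite minC maxC (distrC (phi y)) (distrC y); exact: wl.
rewrite min_l// max_r// => dphi cphi.
pose df s := 'D_1 phi s.
have isd s : s \in `]x, y[%R -> is_derive s 1 phi (df s).
  by rewrite in_itv/= => /dphi[d [dd _] _]; exact: derivableP.
have cw : {within `[x, y], continuous phi}.
  apply: continuous_in_subspaceT => s; rewrite inE/= in_itv/=; exact: cphi.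
have [xlty|] := ltP x y; last first.
  move=> yx; have -> : y = x by apply/eqP; rewrite eq_le yx xy.
  by rewrite !subrr normr0 mulr0.
have [c cxy ->] := MVT xlty isd cw.
rewrite normrM ler_wpM2r//; move: cxy; rewrite in_itv/= => /dphi[d [_ dE] dK].
by rewrite /df dE.
Qed.

(* The first zero of phi after 0 splits the segment: phi is positive before it. *)
Lemma exit_bound (phi : R -> R) (s K : R) : 0 <= K -> continuous phi -> phi s = 0 ->
  (forall t, phi t != 0 -> exists2 d, is_derive t 1 phi d & `|d| <= K) ->
  `|phi 0| <= K * `|s|.
Proof.
move=> K0; wlog s0 : phi s / 0 <= s => [wl|].
  have [/wl sp|sn] := leP 0 s; first exact: sp.
  move=> cphi phis dphi.
  have := wl (fun t => phi (- t)) (- s); rewrite oppr0 opprK normrN oppr_ge0.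
  apply => //; first exact: ltW.
  - by move=> t; apply: (@continuous_comp _ _ _ (fun t => - t) phi); [exact: opp_continuous|exact: cphi].
  - move=> t /dphi[d dd dK]; exists (- d); last by rewrite normrN.
    have dN : is_derive t 1 (fun t : R => - t) (- 1) by apply: is_derive_eq.
    by have := is_derive1_comp dd dN; rewrite mulrN1.
move=> cphi phis dphi; rewrite (ger0_norm s0).
pose E := [set t | 0 <= t /\ phi t = 0].
have hE : has_inf E by split; [exists s|exists 0 => t []].
set T := inf E.
have T0 : 0 <= T by apply: lb_le_inf => [|t []]; first by exists s.
have Ts : T <= s by apply: ge_inf => //; exact: hE.2.
have phiT : phi T = 0.
  apply/eqP; apply: contrapT => /negP phiT.
  have /nbhs_ballP[e /= e0 eB] : nbhs T [set t | phi t != 0].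
    apply: (cphi T [set y | y != 0]); apply: open_nbhs_nbhs; split => //; exact: open_neq.
  have [t [t0 pt] tT] := inf_adherent e0 hE.
  have Tt : T <= t by apply: ge_inf => //; exact: hE.2.
  have /eB/= : ball T e t by rewrite -ball_normE/= ltr_norml; apply/andP; split; lra.
  by rewrite pt eqxx.
have := @mvt_bound phi T 0 K K0; rewrite phiT subr0 sub0r normrN (ger0_norm T0).
move=> mvt; apply: (@le_trans _ _ (K * T)); last by rewrite ler_wpM2l.
apply: mvt => [t|t _]; last exact: cphi.
rewrite min_r// max_l// => /andP[t0 tT]; apply: dphi; apply/eqP => pt.
have : T <= t by apply: ge_inf; [exact: hE.2|split => //; exact: ltW].
by rewrite leNgt tT.
Qed.

(** The near-covering form of compactness makes the neighbourhood of t = 0 uniform in a. *)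
Lemma compact_open_translation (V : normedModType R) (C O : set V) (b : V) :
  compact C -> open O -> C `<=` O ->
  exists2 delta, 0 < delta & forall a t, C a -> `|t| < delta -> O (a + t *: b).
Proof.
move=> /compact_near_coveringP Ccov oO CO.
have := Ccov R (nbhs (0 : R)) (fun t a => O (a + t *: b)) _ _.
case=> [a Ca|e /= e0 eO].
  have : O (a + 0 *: b) by rewrite scale0r addr0; exact: CO.
  move=> Oa; have : nbhs ((a, 0) : V * R) [set p : V * R | O (p.1 + p.2 *: b)].
    have cf : {for (a, 0), continuous (fun p : V * R => p.1 + p.2 *: b)}.
      apply: (@cvgD R V _ (nbhs ((a, 0) : V * R)) _ (fun p => p.1) (fun p => p.2 *: b)).
        exact: cvg_fst.
      by apply: cvgZr_tmp; exact: cvg_snd.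
    by apply: cf; exact: open_nbhs_nbhs.
  by case=> -[A B] /= [nA nB] AB; exists (A, B).
exists e => // a t Ca te; apply: eO => //.
by rewrite /= sub0r normrN.
Qed.

End line_calculus.

(** * Bounds and derivatives of the posterior density *)

Lemma continuous_of_within (R : realType) (V : topologicalType) (S : set V) (rho : V -> R) :
  closed S -> {within S, continuous rho} -> (forall a, ~ interior S a -> rho a = 0) ->
  continuous rho.
Proof.
move=> cS crho rho0 a.
have rho_supp x : ~ S x -> rho x = 0 by move=> nSx; apply: rho0 => /interior_subset.
have [Sa|Sa] := pselect (S a); last first.
  have nSa : nbhs a (~` S) by apply: open_nbhs_nbhs; split => //; exact: closed_openC.
  apply/cvgrPdist_lt => e e0; near=> x; rewrite !rho_supp ?subrr ?normr0//.
  by near: x; exact: nSa.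
have ca : rho x @[x --> within S (nbhs a)] --> rho a.
  by move/subspace_continuousP : crho; exact.
apply/cvgrPdist_lt => e e0; have /cvgrPdist_lt/(_ e e0) He := ca.
have [Sia|nSia] := pselect (interior S a); near=> x.
  have : S x by near: x; exact: Sia.
  by near: x; exact: He.
have [Sx|nSx] := pselect (S x); first by move: Sx; near: x; exact: He.
by rewrite (rho_supp x)// (rho0 a)// subrr normr0.
Unshelve. all: by end_near. Qed.

Section posterior_density.
Context {R : realType} {X : completeNormedModType R} {k : nat}.
Let W := (X * 'rV[R]_k)%type.
Variables (Lambda S : set 'rV[R]_k) (rho : 'rV[R]_k -> R) (Phi : W -> R).
Hypotheses (S_compact : compact S) (S_Lambda : S `<=` Lambda).
Hypotheses (rho_ge0 : forall a, 0 <= rho a) (rho_supp : forall a, ~ S a -> rho a = 0).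
Hypotheses (rho_continuous : {within S, continuous rho})
  (rho_gt0 : forall a, interior S a -> 0 < rho a) (rho_C1 : C1_on S rho).
Hypothesis Phi_bounded : exists M : R, forall u a, Lambda a -> `|Phi (u, a)| <= M.
Hypothesis Phi_derivative : exists M : R, forall u a, interior Lambda a ->
    differentiable Phi (u, a) /\ forall z, `|'D_z Phi (u, a)| <= M * `|z|.
Variable c : R.
Hypothesis c0 : 0 < c.

Definition post_density (w : W) : R := c * expR (- Phi w) * rho w.2.
Let f := post_density.

Variables (h : X) (b : 'rV[R]_k).
Let z : W := (h, b).

(** The derivative along [z] of the logarithm of [post_density] over the interior of S; the Gaussian
    term of the logarithmic derivative is added separately. *)
Definition post_score (w : W) : R :=
  - 'D_z Phi w + 'D_b (fun a => ln (rho a)) w.2.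
Let q := post_score.

Lemma compact_continuous_bounded (V : normedModType R) (G : 'rV[R]_k -> V) :
  {within S, continuous G} -> exists2 M, 0 <= M & forall a, S a -> `|G a| <= M.
Proof.
move=> cG; have /compact_bounded[M [_ /(_ (`|M| + 1))]] := continuous_compact cG S_compact.
rewrite (le_lt_trans (ler_norm M)) ?ltrDl// => /(_ isT) GM.
by exists (`|M| + 1) => [|a Sa]; [rewrite addr_ge0|apply: GM; exists a].
Qed.

Lemma is_derive_rho a : interior S a -> is_derive a b rho ('D_b rho a).
Proof. by move=> Sa; apply: derivableP; apply: diff_derivable; exact: rho_C1.1. Qed.

Lemma is_derive_ln_rho a : interior S a ->
  is_derive a b (fun a => ln (rho a)) ((rho a)^-1 * 'D_b rho a).
Proof.
move=> Sa; have ra := rho_gt0 Sa.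
have d0 : is_derive (a + 0 *: b) b rho ('D_b rho a).
  by rewrite scale0r addr0; exact: is_derive_rho.
have d1 := is_derive_line d0.
have d2 : is_derive (rho (a + 0 *: b)) 1 (@ln R) (rho a)^-1.
  by rewrite scale0r addr0; exact: is_derive1_ln.
have := is_derive_cvg (is_derive1_comp d2 d1).
move=> cv; apply: DeriveDef.
  apply/cvg_ex; exists ((rho a)^-1 * 'D_b rho a); apply: cvg_trans cv.
  apply: near_eq_cvg; apply: nearW => t /=.
  by rewrite add0r [t *: 1]mulr1 scale0r addr0 [RHS]mulrC (addrC a).
apply: cvg_lim => //; apply: cvg_trans cv.
apply: near_eq_cvg; apply: nearW => t /=.
by rewrite add0r [t *: 1]mulr1 scale0r addr0 [RHS]mulrC (addrC a).
Qed.

Let interior_Lambda a : interior S a -> interior Lambda a.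
Proof. by apply: filterS. Qed.

Lemma is_derive_Phi w : interior S w.2 -> is_derive w z Phi ('D_z Phi w).
Proof.
move=> Sw; apply: derivableP; apply: diff_derivable.
have [M PhiM] := Phi_derivative.
by case: w Sw => u a Sa; exact: (PhiM u a (interior_Lambda Sa)).1.
Qed.

Let is_derive_f w t : interior S (w + t *: z).2 ->
  is_derive t 1 (fun s => f (w + s *: z)) (f (w + t *: z) * q (w + t *: z)).
Proof.
move=> Swt.
have d1 := is_derive_line (is_derive_Phi Swt).
have d2 : is_derive t 1 (fun s => rho (w.2 + s *: b)) ('D_b rho (w.2 + t *: b)).
  by apply: is_derive_line; exact: is_derive_rho.
have d1N : is_derive t 1 (fun s => - Phi (w + s *: z)) (- 'D_z Phi (w + t *: z)).
  exact: is_deriveN.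
have d3 := is_derive1_comp (is_derive_expR _) d1N.
have d4 := is_deriveM (is_deriveM (is_derive_cst c t 1) d3) d2.
apply: (is_derive_eq d4).
have [_ lnE] := is_derive_ln_rho Swt.
rewrite /q /post_score lnE /f /post_density.
have r0 : rho (w.2 + t *: b) != 0 by rewrite gt_eqF// rho_gt0.
have key (e r dP dr : R) : r != 0 ->
    c * e * dr + r * (c * (e * - dP) + e * 0) = c * e * r * (- dP + r^-1 * dr).
  by move=> r_neq0; field.
exact: key.
Qed.

Let score_bounds : exists M Mr Kp Kr, [/\ 0 <= M, 0 <= Mr, 0 <= Kp & 0 <= Kr] /\
  [/\ forall w, S w.2 -> `|Phi w| <= M, forall a, rho a <= Mr,
      forall w, interior S w.2 -> `|'D_z Phi w| <= Kp &
      forall a, interior S a -> `|'D_b rho a| <= Kr].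
Proof.
have [M PhiM] := Phi_bounded.
have [Mr Mr0 rhoM] := compact_continuous_bounded rho_continuous.
have [Kp PhiK] := Phi_derivative.
have [g gcont rhog] := rho_C1.2.
have [Kr Kr0 gK] := compact_continuous_bounded gcont.
exists `|M|, Mr, (`|Kp| * `|z|), (\sum_i Kr * `|b 0 i|).
split; first by rewrite mulr_ge0// sumr_ge0// => i _; rewrite mulr_ge0.
split.
- by move=> [u a] /S_Lambda La; apply: (le_trans (PhiM u a La)); exact: ler_norm.
- move=> a; have [Sa|Sa] := pselect (S a); last by rewrite rho_supp.
  by apply: le_trans (ler_norm _) _; exact: rhoM.
- move=> [u a] Sa; have [_ /(_ z)] := PhiK u a (interior_Lambda Sa).
  by move=> /le_trans; apply; rewrite ler_wpM2r// ler_norm.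
- move=> a Sa; rewrite rhog//; apply: (le_trans (ler_norm_sum _ _ _)).
  apply: ler_sum => i _; rewrite normrM ler_wpM2r//.
  by rewrite (le_trans (normr_coord_le _ _))// gK//; exact: interior_subset.
Qed.

(** L is a sum so that it bounds both f and its increments over segments inside the interior of S,
    where the mean value theorem applies. On a segment that leaves the interior, Phi may fail to be
    differentiable; instead f <= A rho and [exit_bound] for rho bound both end values by A Kr |t|,
    and being nonnegative they differ by no more than that. *)
Lemma post_density_bounds : exists L K, [/\ 0 <= L, 0 <= K,
  forall w, f w <= L,
  (forall w t, (forall s, Num.min 0 t <= s <= Num.max 0 t -> interior S (w.2 + s *: b)) ->
    `|f (w + t *: z) - f w| <= L * `|t|) &
  (forall a, S a -> ~ interior S a -> rho a = 0) ->
    forall w t, `|f (w + t *: z) - f w| <= K * `|t|].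
Proof.
have [M [Mr [Kp [Kr [[M0 Mr0 Kp0 Kr0] [PhiM rhoM PhiK rhoK]]]]]] := score_bounds.
pose A := c * expR M.
have A0 : 0 <= A by rewrite mulr_ge0 ?expR_ge0// ltW.
have f_ge0 w : 0 <= f w by rewrite /f /post_density !mulr_ge0 ?expR_ge0// ltW.
have fA w : f w <= A * rho w.2.
  have [Sw|Sw] := pselect (S w.2); last by rewrite /f /post_density rho_supp// !mulr0.
  rewrite /f /post_density ler_wpM2r// ler_wpM2l ?(ltW c0)// ler_expR.
  by rewrite (le_trans (ler_norm _))// normrN PhiM.
pose L1 := A * (Kp * Mr + Kr).
have L10 : 0 <= L1 by rewrite mulr_ge0// addr_ge0// mulr_ge0.
have seg w t : (forall s, Num.min 0 t <= s <= Num.max 0 t -> interior S (w.2 + s *: b)) ->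
    `|f (w + t *: z) - f w| <= L1 * `|t|.
  move=> wt; have := @mvt_bound R (fun s => f (w + s *: z)) 0 t L1 L10.
  rewrite scale0r addr0 subr0; apply => [s /andP[s1 s2]|s /wt Ss].
    have Ss : interior S (w + s *: z).2 by apply: wt; rewrite (ltW s1) (ltW s2).
    exists (f (w + s *: z) * q (w + s *: z)); first exact: is_derive_f.
    have rs := rho_gt0 Ss; have [_ e] := is_derive_ln_rho Ss.
    rewrite /q /post_score e.
    set w' := w + s *: z in Ss rs e *.
    have -> : f w' * (- 'D_z Phi w' + (rho w'.2)^-1 * 'D_b rho w'.2) =
        c * expR (- Phi w') * (- 'D_z Phi w' * rho w'.2 + 'D_b rho w'.2).
      by rewrite /f /post_density; field; rewrite gt_eqF.
    rewrite normrM (@ger0_norm _ (c * _)) ?mulr_ge0 ?expR_ge0 ?(ltW c0)//.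
    apply: ler_pM => //; first by rewrite mulr_ge0 ?expR_ge0 ?(ltW c0).
      rewrite ler_wpM2l ?(ltW c0)// ler_expR (le_trans (ler_norm _))// normrN PhiM//.
      exact: interior_subset.
    apply: (le_trans (ler_normD _ _)); rewrite normrM normrN lerD ?rhoK//.
    by rewrite ler_pM// ?PhiK// ger0_norm ?rho_ge0.
  have [df _] := is_derive_f Ss.
  by apply: differentiable_continuous; exact/derivable1_diffP.
exists (A * Mr + L1), (L1 + A * Kr); split.
- by rewrite addr_ge0// mulr_ge0.
- by rewrite addr_ge0// mulr_ge0.
- by move=> w; apply: (le_trans (fA w)); rewrite ler_wpDr// ler_wpM2l.
- move=> w t /seg /le_trans; apply; rewrite ler_wpM2r// lerDr mulr_ge0//.
move=> rho_bd w t.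
have rho0 a : ~ interior S a -> rho a = 0.
  by move=> Sa; have [/rho_bd->|/rho_supp] := pselect (S a).
have crho : continuous rho.
  apply: continuous_of_within rho_continuous rho0.
  exact: compact_closed (@norm_hausdorff _ _) S_compact.
have ex a s : rho (a + s *: b) = 0 -> rho a <= Kr * `|s|.
  move=> ras; have := @exit_bound R (fun t => rho (a + t *: b)) s Kr Kr0.
  rewrite scale0r addr0 ger0_norm//; apply => //.
    move=> t'; apply: (@continuous_comp _ _ _ (fun t : R => a + t *: b) rho); last exact: crho.
    by apply: cvgD; [exact: cvg_cst|apply: cvgZr_tmp; exact: cvg_id].
  move=> t' /eqP rt.
  have Sat : interior S (a + t' *: b) by apply: contrapT => /rho0.
  exists ('D_b rho (a + t' *: b)); last exact: rhoK.
  by apply: is_derive_line; exact: is_derive_rho.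
have [wt|/existsNP[s /not_implyP[st /rho0 rs]]] :=
    pselect (forall s, Num.min 0 t <= s <= Num.max 0 t -> interior S (w.2 + s *: b)).
  by apply: (le_trans (seg _ _ wt)); rewrite ler_wpM2r// lerDl mulr_ge0.
(* The parameter s of a zero of rho is within |t| of both end parameters 0 and t. *)
have [st1 st2] : `|s| <= `|t| /\ `|s - t| <= `|t|.
  move: st; have [t0|t0] := leP 0 t; move=> /andP[s1 s2].
    by rewrite (ger0_norm t0) !ler_norml; split; apply/andP; split; lra.
  by rewrite (ltr0_norm t0) !ler_norml; split; apply/andP; split; lra.
have b1 : f w <= A * Kr * `|t|.
  apply: (le_trans (fA w)); rewrite -mulrA ler_wpM2l//.
  by apply: (le_trans (ex _ _ rs)); rewrite ler_wpM2l.
have b2 : f (w + t *: z) <= A * Kr * `|t|.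
  apply: (le_trans (fA _)); rewrite -mulrA ler_wpM2l//.
  apply: le_trans (ex _ (s - t) _) _; last by rewrite ler_wpM2l.
  by rewrite /= -addrA -scalerDl (addrC t) subrK.
have := f_ge0 w; have := f_ge0 (w + t *: z).
rewrite mulrDl ler_norml; have : 0 <= L1 * `|t| by rewrite mulr_ge0.
by move=> *; apply/andP; split; lra.
Qed.

Lemma post_density_der w : interior S w.2 ->
  (f (w + t *: z) - f w) / t @[t --> (0 : R)^'] --> f w * q w.
Proof.
move=> Sw; have := @is_derive_f w 0; rewrite scale0r addr0 => /(_ Sw) d.
have := is_derive_cvg d; apply: cvg_trans; apply: near_eq_cvg; apply: nearW => t /=.
by rewrite scale0r addr0 add0r [t *: 1]mulr1.
Qed.

Lemma post_density_gt0 w : interior S w.2 -> 0 < f w.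
Proof. by move=> Sw; rewrite /f /post_density !mulr_gt0 ?expR_gt0// rho_gt0. Qed.

End posterior_density.

(** Serves for [I_fun] and [K_fun], which follow a smooth formula along a line only near the base
    point. *)
Lemma is_derive_of_line (R : realType) (V : normedModType R) (F : V -> R) (x v : V)
    (psi : R -> R) (d : R) :
  is_derive (0 : R) 1 psi d -> (\forall t \near (0 : R), F (x + t *: v) = psi t) ->
  is_derive x v F d.
Proof.
move=> dpsi Fpsi.
have F0 : F x = psi 0 by have := nbhs_singleton Fpsi; rewrite /= scale0r addr0.
have cv : h^-1 *: ((F \o shift x) (h *: v) - F x) @[h --> (0 : R)^'] --> d.
  have := is_derive_cvg dpsi; apply: cvg_trans; apply: near_eq_cvg.
  have : \forall t \near (0 : R)^', F (x + t *: v) = psi t by exact: cvg_within.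
  apply: filterS => t /= e; rewrite (addrC (t *: v)) e F0 add0r [t *: 1]mulr1.
  by rewrite [LHS]mulrC.
by split; [apply/cvg_ex; exists d|exact: cvg_lim].
Qed.

(* The points of U at distance at least 1/(n+1) from its complement. *)
Lemma compact_exhaustion (R : realType) (V : normedModType R) (S U : set V) :
  compact S -> open U -> U `<=` S ->
  exists C : nat -> set V, [/\ forall n, compact (C n), forall n, C n `<=` U &
    forall a, U a -> exists n, C n a].
Proof.
move=> cS oU US.
pose C (n : nat) := [set a | forall y, `|a - y| < n.+1%:R^-1 -> U y].
have CU n : C n `<=` U by move=> a; apply; rewrite subrr normr0 invr_gt0.
exists C; split => // [n|a Ua].
  apply: (subclosed_compact _ cS); last by move=> a /CU; exact: US.
  rewrite -(setCK (C n)); apply: open_closedC.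
  rewrite (_ : ~` C n = \bigcup_(y in ~` U) ball y n.+1%:R^-1).
    by apply: bigcup_open => y _; exact: ball_open.
  apply/seteqP; split=> [a|a [y Uy]] /=.
    by move=> /existsNP[y /not_implyP[ay Uy]]; exists y => //; rewrite -ball_normE/= distrC.
  by rewrite -ball_normE/= distrC => ay /(_ y ay).
have /nbhs_ballP[r /= r0 arU] : nbhs a U by exact: open_nbhs_nbhs.
have [n _ /(_ n (leqnn n)) nr] := near_infty_natSinv_lt (PosNum r0).
exists n => y ay; apply: arU; rewrite -ball_normE/=.
exact: lt_trans nr.
Qed.

(** * Densities with compact support *)

Section supported_density.
Context {R : realType} {k : nat}.
Variables (S : set 'rV[R]_k) (rho : 'rV[R]_k -> R).
Hypothesis S_compact : compact S.

Lemma open_borel (U : set 'rV[R]_k) : open U -> measurable (U : set (borel 'rV[R]_k)).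
Proof. by move=> oU; exact: sub_sigma_algebra. Qed.

Lemma compact_borel (C : set 'rV[R]_k) : compact C -> measurable (C : set (borel 'rV[R]_k)).
Proof.
move=> cC; rewrite -(setCK C); apply: measurableC; apply: open_borel.
by apply: closed_openC; exact: compact_closed (@norm_hausdorff _ _) cC.
Qed.

Lemma measurable_within_continuous : {within S, continuous rho} ->
  (forall a, ~ S a -> rho a = 0) ->
  measurable_fun [set: borel 'rV[R]_k] (rho : borel 'rV[R]_k -> R).
Proof.
move=> crho rho0; have mS := compact_borel S_compact.
have -> : rho = rho \_ S.
  apply/funext => a; rewrite patchE; case: ifPn => // /negP aS.
  by rewrite rho0// => Sa; apply: aS; exact: mem_set.
apply/(measurable_restrictT (rho : borel 'rV[R]_k -> R)) => //.
apply: (measurability _ (RGenOpens.measurableE R)) => _ [_ [a [b ->] <-]].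
have /open_subspaceP[V oV VS] : open (rho @^-1` `]a, b[%classic : set (subspace S)).
  by move/continuousP : crho; apply; exact: interval_open.
rewrite setIC -VS; apply: measurableI => //; exact: open_borel.
Qed.

Lemma lebesgue_compact_lty (lam : {measure set (borel 'rV[R]_k) -> \bar R}) :
  is_lebesgue lam -> (lam S < +oo)%E.
Proof.
move=> laml; have /compact_bounded[M [_ /(_ (`|M| + 1))]] := S_compact.
rewrite (le_lt_trans (ler_norm M)) ?ltrDl// => /(_ isT) SM.
apply: le_lt_trans (lebesgue_box_lty laml (const_mx (- (`|M| + 1))) (const_mx (`|M| + 1))).
apply: le_measure; rewrite ?inE.
- exact: compact_borel.
- by rewrite measurable_boxes; apply: sub_sigma_algebra; eexists; eexists.
- by move=> a Sa; apply: bounded_box; exact: SM.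
Qed.

End supported_density.

(** * The posterior as a measure with a density *)

Section posterior_measure.
Context {R : realType} {X : completeNormedModType R} {k : nat}.
Let W := (X * 'rV[R]_k)%type.
Let mW := (borel X * borel 'rV[R]_k)%type.
Variable mu0 : probability (borel X) R.
Variable lam : {sigma_finite_measure set (borel 'rV[R]_k) -> \bar R}.
Variable nu0 : probability (borel 'rV[R]_k) R.
Variables (Lambda S : set 'rV[R]_k) (rho : 'rV[R]_k -> R) (Phi : W -> R).
Hypotheses (S_compact : compact S) (S_Lambda : S `<=` Lambda).
Hypotheses (rho_ge0 : forall a, 0 <= rho a) (rho_supp : forall a, ~ S a -> rho a = 0).
Hypothesis mrho : measurable_fun [set: borel 'rV[R]_k] (rho : borel 'rV[R]_k -> R).
Hypothesis rho_density : forall B : set (borel 'rV[R]_k), measurable B ->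
    nu0 B = (\int[lam]_(a in B) (rho a)%:E)%E.
Hypothesis Phi_measurable : forall Y : set R, measurable Y ->
    exists2 B : set mW, measurable B &
      (setT `*` Lambda) `&` Phi @^-1` Y = (setT `*` Lambda) `&` B.
Variable mu : probability mW R.
Hypothesis mu_posterior : forall A : set mW, measurable A ->
    mu A = posterior mu0 nu0 S Phi A.

Let Z := partition_function mu0 nu0 S Phi.
Let f := post_density rho Phi Z^-1.

Let mXS : measurable (setT `*` S : set mW).
Proof. by apply: measurableX => //; exact: compact_borel. Qed.

Let mE : measurable_fun (setT `*` S : set mW) ((fun w => expR (- Phi w)) : mW -> R).
Proof.
have mPhi : measurable_fun (setT `*` S : set mW) (Phi : mW -> R).
  move=> _ Y mY; have [B mB e] := Phi_measurable mY.
  have SL : setT `*` S `<=` (setT : set X) `*` Lambda by move=> w [_ /S_Lambda].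
  rewrite (_ : _ `&` _ = (setT `*` S) `&` B); first exact: measurableI.
  apply/seteqP; split => w [Sw wY]; split => //.
    by have [] : ((setT `*` Lambda) `&` B) w by rewrite -e; split => //; exact: SL.
  by have [] : ((setT `*` Lambda) `&` Phi @^-1` Y) w by rewrite e; split => //; exact: SL.
by apply: (measurableT_comp (@measurable_expR R)); exact: measurableT_comp.
Qed.

(** [Phi] is measurable over Lambda only, so the exponential is cut off outside S, where rho
    vanishes. *)
Let densityE w : f w = Z^-1 * ((fun w => expR (- Phi w)) \_ (setT `*` S)) w * rho w.2.
Proof.
rewrite /f /post_density patchE; case: ifPn => // /negP wS.
by rewrite rho_supp ?mulr0// => Sw; apply: wS; apply: mem_set.
Qed.

Lemma measurable_post_density : measurable_fun [set: mW] (f : mW -> R).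
Proof.
rewrite (_ : f = fun w => Z^-1 * ((fun w => expR (- Phi w)) \_ (setT `*` S)) w * rho w.2).
  apply: measurable_funM; last by apply: (measurableT_comp mrho); exact: measurable_snd.
  apply: measurable_funM => //.
  exact/(measurable_restrictT (fun w : mW => expR (- Phi w))).
by apply/funext => w; exact: densityE.
Qed.

(** If Z were 0, the convention 0^-1 = 0 would make the posterior the zero measure, whereas [mu] has
    mass 1. *)
Lemma partition_gt0 : 0 < Z.
Proof.
rewrite lt0r Rintegral_ge0 ?andbT; last by move=> w _; exact: expR_ge0.
apply/eqP => Z0; have := mu_posterior measurableT.
rewrite probability_setT /posterior -/Z Z0 invr0 mul0e.
by move=> /eqP; rewrite onee_eq0.
Qed.

Lemma posterior_densityE (A : set mW) : measurable A ->
  mu A = (\int[mu0 \x lam]_(w in A) (f w)%:E)%E.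
Proof.
move=> mA; rewrite mu_posterior// /posterior -/Z.
have mAS : measurable (A `&` (setT `*` S) : set mW) by exact: measurableI.
pose F : mW -> \bar R := (fun w => (expR (- Phi w))%:E) \_ (A `&` (setT `*` S)).
have F0 w : (0 <= F w)%E by apply: erestrict_ge0 => ? _; rewrite lee_fin expR_ge0.
have mF : measurable_fun [set: mW] F.
  apply/(measurable_restrictT (fun w : mW => (expR (- Phi w))%:E)) => //.
  by apply/measurable_EFinP; apply: measurable_funS mE => // w [].
rewrite integral_mkcond -/F (product_density_integral mu0 rho_ge0 mrho rho_density mF F0).
rewrite -ge0_integralZl//; last 3 first.
- apply: emeasurable_funM => //; apply/measurable_EFinP.
  by apply: (measurableT_comp mrho); exact: measurable_snd.
- by move=> w _; rewrite mule_ge0// lee_fin.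
- by rewrite lee_fin invr_ge0 ltW// partition_gt0.
rewrite [RHS]integral_mkcond; apply: eq_integral => w _.
rewrite /F !patchE in_setI.
have [wA|] /= := boolP (w \in A); last by rewrite mul0e mule0.
by rewrite densityE patchE; case: ifP => _; rewrite -?EFinM ?mulrA// mul0e mule0 mulr0 mul0r.
Qed.

(** [mu] has a density with respect to the product of [mu0] and [lam], so a [mu0]-null set of first
    coordinates is [mu]-null. This transfers the almost sure equality of [PW h] and [cm_repr mu0 h]
    to [mu]. *)
Lemma ae_posterior_fst (Q : X -> Prop) : {ae mu0, forall u : borel X, Q u} ->
  {ae mu, forall w : mW, Q w.1}.
Proof.
move=> [N [mN N0 QN]]; exists (N `*` setT); split.
- by apply: measurableX.
- rewrite posterior_densityE; last exact: measurableX.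
  apply: null_set_integral; first exact: measurableX.
    by apply: measurable_funTS; apply/measurable_EFinP; exact: measurable_post_density.
  have e0 : (mu0 N * lam setT = 0)%E by rewrite N0 mul0e.
  exact: etrans (@product_measure1E _ _ _ _ _ mu0 lam N setT mN measurableT) e0.
- by move=> w /= Qw; split => //; exact: QN.
Qed.

End posterior_measure.

(** * The directional derivative of I over the interior of S *)

Section derivative_of_I.
Context {R : realType} {X : completeNormedModType R} {k : nat}.
Let W := (X * 'rV[R]_k)%type.
Variable mu0 : probability (borel X) R.
Hypothesis mu0_gaussian : centered_gaussian mu0.
Variable PW : X -> X -> R.
Hypothesis PW_spec : forall h, cameron_martin mu0 h -> is_paley_wiener mu0 h (PW h).
Variables (Lambda S : set 'rV[R]_k) (rho : 'rV[R]_k -> R) (Phi : W -> R).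
Hypotheses (S_Lambda : S `<=` Lambda)
  (rho_gt0 : forall a, interior S a -> 0 < rho a) (rho_C1 : C1_on S rho).
Hypothesis Phi_derivative : exists M : R, forall u a, interior Lambda a ->
    differentiable Phi (u, a) /\ forall z, `|'D_z Phi (u, a)| <= M * `|z|.

Let near_line (a b : 'rV[R]_k) : interior S a ->
  \forall t \near (0 : R), interior S (a + t *: b).
Proof.
move=> Sa; have [e e0 eS] := compact_open_translation b (@compact_set1 _ a)
  (@open_interior _ S) (ltac:(by move=> _ ->) : [set a] `<=` interior S).
apply/nbhs_ballP; exists e => // t; rewrite -ball_normE/= sub0r normrN.
exact: eS.
Qed.

Let is_derive_ln_line (a b : 'rV[R]_k) : interior S a ->
  is_derive (0 : R) 1 (fun t => ln (rho (a + t *: b))) ('D_b (fun a => ln (rho a)) a).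
Proof.
move=> Sa; apply: (@is_derive_line _ _ (fun a => ln (rho a)) a b 0).
rewrite scale0r addr0; have [dln _] := is_derive_ln_rho rho_gt0 rho_C1 b Sa.
exact: (derivableP dln).
Qed.

(** For u in E, I is finite on the line near (u, a), and J is there a quadratic polynomial in t
    whose derivative at 0 is the inner product of u and h; the last clause of [is_paley_wiener]
    identifies it with [PW h u]. For u outside E the same sum is the convention. *)
Lemma dI_interior (u : X) (a : 'rV[R]_k) (h : X) (b : 'rV[R]_k) :
  interior S a -> cameron_martin mu0 h ->
  dI mu0 S rho Phi PW (u, a) (h, b) =
    'D_((h, b) : W) Phi (u, a) + PW h u - 'D_b (fun a' => ln (rho a')) a.
Proof.
move=> Sa hE; pose z : W := (h, b).
have KE a' : interior S a' -> K_fun S rho a' = (- ln (rho a'))%:E.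
  by move=> Sa'; rewrite /K_fun; case: ifPn => // /asboolPn.
have dln := is_derive_ln_line b Sa.
have dPhi : is_derive (0 : R) 1 (fun t => Phi ((u, a) + t *: z)) ('D_z Phi (u, a)).
  apply: (@is_derive_line _ _ Phi (u, a) z 0); rewrite scale0r addr0.
  exact: (is_derive_Phi S_Lambda Phi_derivative h b (w := (u, a)) Sa).
rewrite /dI; case: ifPn => [/asboolP /= uE|_ /=]; last first.
  congr (_ + _ + _).
  have [_ ->] // : is_derive a b (fine \o K_fun S rho) (- 'D_b (fun a' => ln (rho a')) a).
  apply: (is_derive_of_line (is_deriveN dln)).
  by apply: filterS (near_line b Sa) => t St; rewrite /= KE.
have [_ _ /(_ u uE) PWu] := PW_spec hE.
pose psi t : R := Phi ((u, a) + t *: z) +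
  2^-1 * (t ^+ 2 * cm_inner mu0 h h + 2 * t * cm_inner mu0 u h + cm_inner mu0 u u) -
  ln (rho (a + t *: b)).
have dJ : is_derive (0 : R) 1 (fun t : R => 2^-1 * (t ^+ 2 * cm_inner mu0 h h +
    2 * t * cm_inner mu0 u h + cm_inner mu0 u u)) (PW h u).
  rewrite PWu; apply: is_derive_eq.
  by rewrite /GRing.scale/=; field.
have dpsi : is_derive (0 : R) 1 psi
    ('D_z Phi (u, a) + PW h u - 'D_b (fun a' => ln (rho a')) a).
  exact: is_deriveB (is_deriveD dPhi dJ) dln.
suff: is_derive ((u, a) : W) z (fine \o I_fun mu0 S rho Phi)
  ('D_z Phi (u, a) + PW h u - 'D_b (fun a' => ln (rho a')) a) by case.
apply: (is_derive_of_line dpsi); apply: filterS (near_line b Sa) => t St; rewrite /= /I_fun /= KE// /J_fun.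
have -> : u + t *: h = t *: h + u by rewrite addrC.
case: ifPn => [_|/asboolPn[]]; last exact: cameron_martin_axpy.
by rewrite -!EFinD /= cm_inner_sqrD.
Qed.

End derivative_of_I.

(** * The logarithmic derivative of the posterior *)

Section log_derivative_of_posterior.
Context {R : realType} {X : completeNormedModType R} {k : nat}.
Let W := (X * 'rV[R]_k)%type.
Let mW := (borel X * borel 'rV[R]_k)%type.
Variable mu0 : probability (borel X) R.
Hypotheses (X_separable : separable_space X) (mu0_gaussian : centered_gaussian mu0).
Variable PW : X -> X -> R.
Hypothesis PW_spec : forall h, cameron_martin mu0 h -> is_paley_wiener mu0 h (PW h).
Variable lam : {sigma_finite_measure set (borel 'rV[R]_k) -> \bar R}.
Hypothesis lam_lebesgue : is_lebesgue lam.
Variable nu0 : probability (borel 'rV[R]_k) R.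
Variables (Lambda S : set 'rV[R]_k) (rho : 'rV[R]_k -> R) (Phi : W -> R).
Hypotheses (S_compact : compact S) (S_Lambda : S `<=` Lambda).
Hypotheses (rho_ge0 : forall a, 0 <= rho a) (rho_supp : forall a, ~ S a -> rho a = 0).
Hypothesis rho_density : forall B : set (borel 'rV[R]_k), measurable B ->
    nu0 B = (\int[lam]_(a in B) (rho a)%:E)%E.
Hypotheses (rho_continuous : {within S, continuous rho})
  (rho_gt0 : forall a, interior S a -> 0 < rho a) (rho_C1 : C1_on S rho).
Hypothesis Phi_measurable : forall Y : set R, measurable Y ->
    exists2 B : set mW, measurable B &
      (setT `*` Lambda) `&` Phi @^-1` Y = (setT `*` Lambda) `&` B.
Hypothesis Phi_bounded : exists M : R, forall u a, Lambda a -> `|Phi (u, a)| <= M.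
Hypothesis Phi_derivative : exists M : R, forall u a, interior Lambda a ->
    differentiable Phi (u, a) /\ forall z, `|'D_z Phi (u, a)| <= M * `|z|.
Variable mu : probability mW R.
Hypothesis mu_posterior : forall A : set mW, measurable A ->
    mu A = posterior mu0 nu0 S Phi A.

Variables (h : X) (b : 'rV[R]_k).
Hypothesis hE : cameron_martin mu0 h.
Let z : W := (h, b).
Let Z := partition_function mu0 nu0 S Phi.
Let f := post_density rho Phi Z^-1.
Let g := cm_repr mu0 h.
Let q := post_score rho Phi h b.
Let beta (w : W) := - 'D_z Phi w - PW h w.1 + 'D_b (fun a => ln (rho a)) w.2.

Let mrho := measurable_within_continuous S_compact rho_continuous rho_supp.

Let Z0 : 0 < Z^-1.
Proof. by rewrite invr_gt0; exact: (partition_gt0 mu_posterior). Qed.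

Let mf : measurable_fun [set: mW] (f : mW -> R) :=
  measurable_post_density mu0 nu0 S_compact S_Lambda rho_supp mrho Phi_measurable.

Let muE (A : set mW) : measurable A -> mu A = (\int[mu0 \x lam]_(w in A) (f w)%:E)%E :=
  posterior_densityE S_compact S_Lambda rho_ge0 rho_supp mrho rho_density
    Phi_measurable mu_posterior (A := A).

Let f0 w : 0 <= f w.
Proof. by rewrite /f /post_density !mulr_ge0 ?expR_ge0// ltW. Qed.

Let open_G : open (interior S).
Proof. exact: open_interior. Qed.

(* Unlike beta, which involves PW h, this version of the density is Borel. *)
Let gamma (w : W) := q w - g w.1.

Let ae_beta : {ae mu, forall w : mW, beta w = gamma w}.
Proof.
have [_ PWg _] := PW_spec hE.
have := ae_posterior_fst S_compact S_Lambda rho_ge0 rho_supp mrho rho_density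
    Phi_measurable mu_posterior PWg.
apply: filterS => w /= e; rewrite /beta /gamma /q /post_score -/z e -/g; ring.
Qed.

Let fomin_cvg_on (D : set W) (delta L : R) : measurable (D : set mW) ->
  (forall w, D w -> interior S w.2) -> 0 < delta ->
  (forall w t, D w -> `|t| < delta -> `|f (w + t *: z) - f w| <= L * `|t|) ->
  mu.-integrable D (EFin \o gamma) /\
  forall A, measurable (A : set mW) -> A `<=` D ->
    fomin_quotient mu z A t @[t --> (0 : R)^'] --> \int[mu]_(w in A) gamma w.
Proof.
move=> mD DG delta0 lip.
have [L1 [_ [L10 _ fL _ _]]] := post_density_bounds S_compact S_Lambda rho_ge0
  rho_supp rho_continuous rho_gt0 rho_C1 Phi_bounded Phi_derivative Z0 h b.
(* One constant must serve as Lipschitz constant and as bound for f, hence the maximum. *)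
apply: (fomin_density_cvg X_separable mu0_gaussian lam_lebesgue mf f0 muE
  (cm_reprP hE) mD (compact_borel S_compact) (lebesgue_compact_lty S_compact lam_lebesgue)
  (delta := delta) (L := Num.max L L1)) => //.
- by move=> w /DG; exact: interior_subset.
- by move=> w t Dw td; rewrite (le_trans (lip _ _ Dw td))// ler_wpM2r// le_max lexx.
- move=> w /DG Sw; apply/andP; split.
    by have := @post_density_gt0 _ _ _ _ _ Phi rho_gt0 _ Z0 w Sw.
  by rewrite le_max; apply/orP; right; exact: fL.
- move=> w /DG Sw.
  by have := post_density_der S_Lambda rho_gt0 rho_C1 Phi_derivative (c := Z^-1) (h := h) (b := b) Sw.
Qed.

Let fomin_cvg_compact (C : set 'rV[R]_k) : compact C -> C `<=` interior S ->
  mu.-integrable (setT `*` C) (EFin \o gamma) /\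
  forall A, measurable (A : set mW) -> A `<=` setT `*` C ->
    fomin_quotient mu z A t @[t --> (0 : R)^'] --> \int[mu]_(w in A) gamma w.
Proof.
move=> cC CG; have [delta delta0 Cd] := compact_open_translation b cC open_G CG.
have [L [_ [_ _ _ seg _]]] := post_density_bounds S_compact S_Lambda rho_ge0
  rho_supp rho_continuous rho_gt0 rho_C1 Phi_bounded Phi_derivative Z0 h b.
apply: (fomin_cvg_on (delta := delta) (L := L)) => //.
- by apply: measurableX => //; exact: compact_borel.
- by move=> w [_ /CG].
- move=> w t [_ Cw] td; apply: seg => s st; apply: Cd => //.
  apply: le_lt_trans td; move: st; have [t0|t0] := leP 0 t; move=> /andP[s1 s2].
    by rewrite (ger0_norm t0) ler_norml; apply/andP; split; lra.
  by rewrite (ltr0_norm t0) ler_norml; apply/andP; split; lra.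
Qed.

Lemma log_derivative_on_compact (C : set 'rV[R]_k) : compact C -> C `<=` interior S ->
  log_derivative_on mu (setT `*` C) z beta.
Proof.
move=> cC CG; have [ig cvg_q] := fomin_cvg_compact cC CG; split.
  by move=> A mA AC; apply/cvg_ex; eexists; exact: cvg_q.
exists gamma; split => //; last by apply: filterS ae_beta.
by move=> A mA AC; apply: cvg_lim => //; exact: cvg_q.
Qed.

Lemma log_derivative_posterior : (forall a, S a -> ~ interior S a -> rho a = 0) ->
  log_derivative mu z beta.
Proof.
move=> rho_bd; pose G := [set w : W | interior S w.2].
have mG : measurable (G : set mW).
  by rewrite -[X in measurable X]setTI; apply: measurable_snd => //; exact: open_borel.
have mGC : measurable (~` G : set mW) by exact: measurableC.
have [_ [K [_ _ _ _ fK]]] := post_density_bounds S_compact S_Lambda rho_ge0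
  rho_supp rho_continuous rho_gt0 rho_C1 Phi_bounded Phi_derivative Z0 h b.
have [ig cvg_q] := fomin_cvg_on mG (fun w Gw => Gw) (@ltr01 R) (fun w t _ _ => fK rho_bd w t).
have muGC : mu (~` G) = 0%E.
  rewrite muE// integral0_eq// => w Gw; rewrite /f /post_density.
  by have [/rho_bd->|/rho_supp->] := pselect (S w.2); rewrite ?mulr0.
have cvg_qC A : measurable (A : set mW) -> A `<=` ~` G ->
    fomin_quotient mu z A t @[t --> (0 : R)^'] --> (0 : R).
  apply: (fomin_quotient_null mGC muGC); rewrite setCK; exact: cvg_q.
have cvg_qT A : measurable (A : set mW) ->
    fomin_quotient mu z A t @[t --> (0 : R)^'] --> \int[mu]_(w in A) (gamma \_ G) w.
  move=> mA; have mAG : measurable (A `&` G : set mW) by exact: measurableI.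
  have mAGC : measurable (A `&` ~` G : set mW) by exact: measurableI.
  rewrite -Rintegral_mkcondr -[X in _ --> X]addr0.
  have AE : A = (A `&` G) `|` (A `&` ~` G) by rewrite -setIUr setUv setIT.
  have AI : (A `&` G) `&` (A `&` ~` G) = set0.
    by rewrite setIACA setICr setI0.
  rewrite (_ : fomin_quotient mu z A =
      (fun t => fomin_quotient mu z (A `&` G) t + fomin_quotient mu z (A `&` ~` G) t)).
    by apply: cvgD; [apply: cvg_q => //; exact: subIsetr|apply: cvg_qC => //; exact: subIsetr].
  by apply/funext => t; rewrite [in LHS]AE fomin_quotient_setU.
split; first by move=> A mA _; apply/cvg_ex; eexists; exact: cvg_qT.
(* The density is set to 0 on the null set off [G], where the derivative of [mu] vanishes. *)
exists (gamma \_ G); split.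
- have := integrable_mkcond (mu := mu) (EFin \o (gamma : mW -> R)) mG.
  by rewrite restrict_EFin => <-.
- by move=> A mA _; apply: cvg_lim => //; exact: cvg_qT.
- have GC : {ae mu, forall w : mW, G w}.
    by exists (~` G); split => // w.
  by apply: (@filterS2 _ _ (ae_filter_ringOfSetsType mu) _ _ _ _ GC ae_beta) => w Gw e _; rewrite e patchE mem_set.
Qed.

(** Without a condition on the boundary, the derivative of [mu] has been computed only over compact
    parts of the interior. Over each of them the Borel version of gamma' and [gamma] have equal
    integrals on all Borel subsets, hence agree almost everywhere; countably many such parts exhaust
    the interior. *)
Lemma log_derivative_unique (gamma' : W -> R) : log_derivative mu z gamma' ->
  {ae mu, forall w : mW, interior S w.2 -> gamma' w = beta w}.
Proof.
move=> [_ [gamma1 [ig1 dE gammaE]]].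
have [C [cC CG UC]] := compact_exhaustion S_compact open_G (@interior_subset _ S).
have aeC n : {ae mu, forall w : mW, (setT `*` C n) w -> gamma1 w = gamma w}.
  have [ig cvg_q] := fomin_cvg_compact (cC n) (@CG n).
  have mC : measurable (setT `*` C n : set mW).
    by apply: measurableX => //; exact: compact_borel.
  have ig1C := integrableS measurableT mC (@subsetT _ _) ig1.
  have := integral_ae_eq mC ig1C (measurable_int _ ig).
  move=> h1; have : ae_eq mu (setT `*` C n) (EFin \o gamma1) (EFin \o gamma).
    apply: h1 => A AC mA.
    have iA := integrableS mC mA AC ig; have i1A := integrableS mC mA AC ig1C.
    rewrite [LHS](fin_num_integral mA i1A) [RHS](fin_num_integral mA iA); congr EFin.
    by rewrite -dE//; apply: cvg_lim => //; exact: cvg_q.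
  by apply: filterS => w e Cw; have [] := e Cw.
have aeCn : {ae mu, forall (w : mW) n, (setT `*` C n) w -> gamma1 w = gamma w}.
  exact/ae_foralln.
apply: (@filterS3 _ _ (ae_filter_ringOfSetsType mu) _ _ _ _ _ gammaE ae_beta aeCn) => w e1 e2 e3 Sw.
have [n Cn] := UC _ Sw; rewrite e1// e2; exact: (e3 n).
Qed.

End log_derivative_of_posterior.

Section lebesgue_copy.
Context {R : realType} {k : nat}.
Variable lam : {measure set (borel 'rV[R]_k) -> \bar R}.
Hypothesis lam_lebesgue : is_lebesgue lam.

(* A name for lam under which its sigma-finiteness can be registered. *)
Definition lebesgue_copy of is_lebesgue lam : set (borel 'rV[R]_k) -> \bar R := lam.

HB.instance Definition _ := Measure.copy (lebesgue_copy lam_lebesgue) lam.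
HB.instance Definition _ := Measure_isSigmaFinite.Build _ _ _
  (lebesgue_copy lam_lebesgue) (lebesgue_sigma_finite lam_lebesgue).

End lebesgue_copy.

(** * Logarithmic derivative and critical points *)

Theorem theorem5p7 (R : realType) (X : completeNormedModType R) (k : nat)
  (X_separable : separable_space X)
  (mu0 : probability (borel X) R)
  (mu0_gaussian : centered_gaussian mu0)
  (PW : X -> X -> R)
  (PW_spec : forall h, cameron_martin mu0 h -> is_paley_wiener mu0 h (PW h))
  (Lambda S : set 'rV[R]_k)
  (lam : {measure set (borel 'rV[R]_k) -> \bar R})
  (lam_lebesgue : is_lebesgue lam)
  (nu0 : probability (borel 'rV[R]_k) R)
  (S_support : S = measure_support nu0)
  (S_compact : compact S)
  (S_Lambda : S `<=` Lambda)
  (rho : 'rV[R]_k -> R)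
  (rho_ge0 : forall a, 0 <= rho a)
  (rho_density : forall B : set (borel 'rV[R]_k), measurable B ->
    nu0 B = (\int[lam]_(a in B) (rho a)%:E)%E)
  (rho_supp : forall a, ~ S a -> rho a = 0)
  (rho_continuous : {within S, continuous rho})
  (rho_gt0 : forall a, interior S a -> 0 < rho a)
  (rho_C1 : C1_on S rho)
  (Phi : X * 'rV[R]_k -> R)
  (Phi_measurable : forall Y : set R, measurable Y ->
    exists2 B : set (borel X * borel 'rV[R]_k), measurable B &
      (setT `*` Lambda) `&` Phi @^-1` Y = (setT `*` Lambda) `&` B)
  (Phi_bounded : exists M : R, forall u a, Lambda a -> `|Phi (u, a)| <= M)
  (Phi_derivative : exists M : R, forall u a, interior Lambda a ->
    differentiable Phi (u, a) /\
    forall z, `|'D_z Phi (u, a)| <= M * `|z|)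
  (mu : probability (borel X * borel 'rV[R]_k)%type R)
  (mu_posterior : forall A : set (borel X * borel 'rV[R]_k), measurable A ->
    mu A = posterior mu0 nu0 S Phi A) :
  exists beta : X -> 'rV[R]_k -> X * 'rV[R]_k -> R,
    [/\ (* Without the premise on the boundary of S, mu need not be Fomin
           differentiable (e.g. rho uniform on [0, 1], b = 1). *)
        [/\ (forall a, S a -> ~ interior S a -> rho a = 0) ->
              forall h b, cameron_martin mu0 h ->
                log_derivative mu (h, b) (beta h b),
            forall h b, cameron_martin mu0 h ->
              forall C, compact C -> C `<=` interior S ->
                log_derivative_on mu (setT `*` C) (h, b) (beta h b) &
            forall h b, cameron_martin mu0 h ->
              forall gamma, log_derivative mu (h, b) gamma ->
                {ae mu, forall x, interior S x.2 -> gamma x = beta h b x}],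
        forall u a h b, interior S a -> cameron_martin mu0 h ->
          beta h b (u, a) =
            - 'D_((h, b) : X * 'rV[R]_k) Phi (u, a) - PW h u
            + 'D_b (fun a' => ln (rho a')) a /\
          beta h b (u, a) = - dI mu0 S rho Phi PW (u, a) (h, b) &
        forall u a, interior S a ->
          critical_point mu0 S rho Phi PW (u, a) <->
          (forall h b, cameron_martin mu0 h -> beta h b (u, a) = 0)].
Proof.
(* Tonelli's theorem for the product with [mu0] asks for a sigma-finite measure. *)
pose lamS : {sigma_finite_measure set (borel 'rV[R]_k) -> \bar R} := lebesgue_copy lam_lebesgue.
(* The representative is the displayed formula at every point, so its comparison with [dI] is
   pointwise and the criterion for critical points reduces to a change of sign. *)
pose beta h b (w : X * 'rV[R]_k) :=
  - 'D_((h, b) : X * 'rV[R]_k) Phi w - PW h w.1 + 'D_b (fun a => ln (rho a)) w.2.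
have dIE u a h b : interior S a -> cameron_martin mu0 h ->
    beta h b (u, a) = - dI mu0 S rho Phi PW (u, a) (h, b).
  move=> Sa hE; rewrite (dI_interior mu0_gaussian PW_spec S_Lambda rho_gt0 rho_C1
    Phi_derivative u b Sa hE) /beta /=; ring.
exists beta; split.
- split.
  + move=> rho_bd h b hE.
    exact: (log_derivative_posterior X_separable mu0_gaussian PW_spec (lam := lamS)
      lam_lebesgue S_compact S_Lambda rho_ge0 rho_supp rho_density rho_continuous
      rho_gt0 rho_C1 Phi_measurable Phi_bounded Phi_derivative mu_posterior b hE rho_bd).
  + move=> h b hE C cC CS.
    exact: (log_derivative_on_compact X_separable mu0_gaussian PW_spec (lam := lamS)
      lam_lebesgue S_compact S_Lambda rho_ge0 rho_supp rho_density rho_continuous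
      rho_gt0 rho_C1 Phi_measurable Phi_bounded Phi_derivative mu_posterior b hE cC CS).
  + move=> h b hE gamma gammaE.
    exact: (log_derivative_unique X_separable mu0_gaussian PW_spec (lam := lamS)
      lam_lebesgue S_compact S_Lambda rho_ge0 rho_supp rho_density rho_continuous
      rho_gt0 rho_C1 Phi_measurable Phi_bounded Phi_derivative mu_posterior hE gammaE).
- by move=> u a h b Sa hE; split => //; exact: dIE.
- move=> u a Sa; split=> [crit h b hE|beta0 h b hE].
  + by rewrite dIE// crit// oppr0.
  + by apply/eqP; rewrite -oppr_eq0 -dIE// beta0.
Qed.
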